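(* Let $M$ be a closed, connected, piecewise linear $n$-manifold with a multisection $\{H_i\}$, where $0\le i\le k$ and $n=2k$ or $n=2k+1$. Then the homomorphism induced by inclusion $$\pi_1(H_0\cap H_1\cap\cdots\cap H_k)\to\pi_1(M)$$ is onto, and the homomorphism induced by inclusion $$\pi_1\Big(\bigcup (H_{i_1}\cap H_{i_2}\cap\cdots\cap H_{i_k})\Big)\to\pi_1(M)$$ is an isomorphism, where the union is taken over all intersections of $k$ pairwise distinct handlebodies of the multisection.
   Context: All manifolds and maps are piecewise linear (PL). Spine: let $N$ be a compact manifold with non-empty boundary. A subpolyhedron $P$ is a spine of $N$ if $P\subset \mathrm{int}(N)$ and $N$ PL collapses onto $P$. 1-handlebody: an $n$-dimensional 1-handlebody of genus $g$ is a PL $n$-manifold obtained from one $0$-handle (an $n$-ball) by attaching $g$ $1$-handles. Multisection: let $M$ be a closed, connected PL $n$-manifold and write $n=2k$ or $n=2k+1$. A multisection of $M$ is a collection of $k+1$ PL submanifolds $H_i\subset M$, $0\le i\le k$, such that (1) each $H_i$ has a single $0$-handle and a finite number $g_i$ of $1$-handles, and is PL homeomorphic to a standard $n$-dimensional 1-handlebody of genus $g_i$; (2) the $H_i$ have pairwise disjoint interiors and $M=\bigcup_i H_i$; (3) the intersection $H_{i_1}\cap\cdots\cap H_{i_r}$ of any proper (non-empty) subcollection of $r$ distinct handlebodies ($1\le r\le k$) is a compact, connected submanifold with boundary, of dimension $n-r+1$; moreover it has a spine of dimension $r$, except that if $n=2k$ and $r=k$ it has a spine of dimension $r-1$; (4)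 the intersection $H_0\cap H_1\cap\cdots\cap H_k$ of all handlebodies is a closed, connected submanifold of $M$ of dimension $n-k$ (the central submanifold). *)

(* Defs.v *)
From HB Require Import structures.
From mathcomp Require Import all_boot all_order all_algebra generic_quotient.
From mathcomp Require Import all_classical all_reals all_analysis.
From mathcomp Require Import homotopy lra.
From Stdlib Require Relation_Operators.

Set Implicit Arguments.
Unset Strict Implicit.
Unset Printing Implicit Defensive.

Import Order.TTheory GRing.Theory Num.Theory.
Import numFieldNormedType.Exports.

Local Open Scope classical_set_scope.
Local Open Scope ring_scope.
Local Open Scope quotient_scope.

Lemma comp_continuous (X Y Z : topologicalType) (f : X -> Y) (g : Y -> Z) :
  continuous f -> continuous g -> continuous (fun z => g (f z)).
Proof. by move=> cf cg z; apply: continuous_comp; [exact: cf|exact: cg]. Qed.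

Lemma pair_continuous (X Y Z : topologicalType) (f : X -> Y) (g : X -> Z) :
  continuous f -> continuous g -> continuous (fun z => (f z, g z)).
Proof. by move=> cf cg z; apply: cvg_pair; [exact: cf|exact: cg]. Qed.

Lemma fst_continuous (X Y : topologicalType) :
  continuous (fun z : X * Y => z.1).
Proof. by move=> z; exact: cvg_fst. Qed.

Lemma snd_continuous (X Y : topologicalType) :
  continuous (fun z : X * Y => z.2).
Proof. by move=> z; exact: cvg_snd. Qed.

Definition unit_interval (R : realType) : Type := set_type `[(0 : R), 1].

Section unit_interval.
Context {R : realType}.
Local Notation I := (unit_interval R).

HB.instance Definition _ := Topological.copy I (set_type `[(0 : R), 1]).

Definition clampI (r : R) : I.
Proof.
exists (Num.min 1 (Num.max 0 r)); apply/mem_set; rewrite /= in_itv /=.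
by rewrite le_min ler01 le_max lexx /= ge_min lexx.
Defined.

Definition ival (t : I) : R := set_val t.

Lemma ival_clamp r : ival (clampI r) = Num.min 1 (Num.max 0 r).
Proof. by []. Qed.

Lemma ival_ge0 (t : I) : 0 <= ival t.
Proof. by have := set_valP t; rewrite /= in_itv /= => /andP[]. Qed.

Lemma ival_le1 (t : I) : ival t <= 1.
Proof. by have := set_valP t; rewrite /= in_itv /= => /andP[]. Qed.

Lemma ival_inj : injective ival.
Proof. exact: val_inj. Qed.

Lemma ival_clampE r : 0 <= r <= 1 -> ival (clampI r) = r.
Proof. by case/andP=> r0 r1; rewrite ival_clamp max_r// min_r. Qed.

Lemma ivalK : cancel ival clampI.
Proof. by move=> t; apply: ival_inj; rewrite ival_clampE// ival_ge0 ival_le1. Qed.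

Lemma ival_continuous : continuous ival.
Proof. exact: initial_continuous. Qed.

Lemma clampI_continuous : continuous clampI.
Proof.
apply: continuous_comp_initial => r.
apply: (@continuous_min R R (cst 1) (cst 0 \max id)); first exact: cst_continuous.
by apply: continuous_max => //; exact: cst_continuous.
Qed.

Lemma zero_one_neqI : clampI 0 != clampI 1.
Proof.
apply/eqP => /(congr1 ival); rewrite !ival_clampE ?lexx ?ler01//.
by move/eqP; rewrite eq_sym oner_eq0.
Qed.

HB.instance Definition _ := isBiPointed.Build I zero_one_neqI.

Lemma ival0 : ival zero = 0.
Proof. by rewrite ival_clampE// lexx ler01. Qed.

Lemma ival1 : ival one = 1.
Proof. by rewrite ival_clampE// lexx ler01. Qed.

Lemma clampI_le0 r : r <= 0 -> clampI r = zero.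
Proof.
move=> r0; apply: ival_inj; rewrite ival0 ival_clamp.
by rewrite (max_l r0) min_r// ler01.
Qed.

Lemma clampI_ge1 r : 1 <= r -> clampI r = one.
Proof.
move=> r1; apply: ival_inj; rewrite ival1 ival_clamp.
by rewrite max_r ?min_l// (le_trans ler01).
Qed.

Lemma paste_continuous (X T : topologicalType) (u : X -> R) (c : R)
    (f g : X -> T) :
  continuous u -> continuous f -> continuous g ->
  (forall x, u x = c -> f x = g x) ->
  continuous (fun x => if u x <= c then f x else g x).
Proof.
move=> cu cf cg fg x V; rewrite /= nbhs_simpl /=.
have [uxc|uxc|uxc] := ltgtP (u x) c => Vx.
- have := cf x V Vx; rewrite /= !nbhs_simpl /= => fV.
  have cV : \forall y \near x, u y < c by apply: (cvgr_lt (u x)) => //; exact: cu.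
  by near=> y => /=; rewrite ltW; near: y.
- have := cg x V Vx; rewrite /= !nbhs_simpl /= => gV.
  have cV : \forall y \near x, c < u y by apply: (cvgr_gt (u x)) => //; exact: cu.
  by near=> y => /=; rewrite lt_geF; near: y.
- have Vg : nbhs (g x) V by rewrite -fg.
  have := cf x V Vx; have := cg x V Vg; rewrite /= !nbhs_simpl /= => gV fV.
  by near=> y => /=; case: ifP => _; near: y.
Unshelve. all: end_near.
Qed.

Lemma affine_continuous (X : topologicalType) (f : X -> R) (a b : R) :
  continuous f -> continuous (fun z => a * f z + b).
Proof.
move=> cf z; apply: cvgD; last exact: cvg_cst.
by apply: cvgM; [exact: cvg_cst|exact: cf].
Qed.

Lemma clamp_affine_continuous (X : topologicalType) (f : X -> I) (a b : R) :
  continuous f -> continuous (fun z => clampI (a * ival (f z) + b)).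
Proof.
move=> cf; apply: comp_continuous clampI_continuous.
by apply: affine_continuous; apply: comp_continuous cf ival_continuous.
Qed.

End unit_interval.

Section fundamental_group.
Context {R : realType} {T : topologicalType} (x : T).
Local Notation I := (unit_interval R).
Local Notation loop := {path I from x to x}.
Implicit Types p q r : loop.

(* Homotopy relative to the endpoints; the first coordinate of [I * I] is the
   homotopy parameter. *)
Definition path_homotopic p q := exists H : I * I -> T,
  [/\ continuous H,
      forall t, H (zero, t) = p t,
      forall t, H (one, t) = q t &
      forall s, H (s, zero) = x /\ H (s, one) = x].

Lemma path_homotopic_refl p : path_homotopic p p.
Proof.
exists (fun st => p st.2); split => // [|s]; last by rewrite path_zero path_one.
by apply: comp_continuous; [exact: snd_continuous|exact: cts_fun].
Qed.

Lemma path_homotopic_sym p q : path_homotopic p q -> path_homotopic q p.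
Proof.
case=> H [cH H0 H1 Hx].
exists (fun st => H (clampI (-1 * ival st.1 + 1), st.2)); split => /=.
- apply: comp_continuous cH; apply: pair_continuous; last exact: snd_continuous.
  exact/clamp_affine_continuous/fst_continuous.
- by move=> t; rewrite ival0 mulr0 add0r clampI_ge1.
- by move=> t; rewrite ival1 mulr1 addNr clampI_le0.
- by move=> s.
Qed.

Lemma path_homotopic_trans p q r :
  path_homotopic p q -> path_homotopic q r -> path_homotopic p r.
Proof.
case=> H [cH H0 H1 Hx] [K [cK K0 K1 Kx]].
exists (fun st => if ival st.1 <= 2^-1 then H (clampI (2 * ival st.1 + 0), st.2)
                  else K (clampI (2 * ival st.1 + -1), st.2)); split => /=.
- apply: (@paste_continuous _ _ _ (fun st : I * I => ival st.1) _
    (fun st => H (clampI (2 * ival st.1 + 0), st.2))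
    (fun st => K (clampI (2 * ival st.1 + -1), st.2))).
  + exact: comp_continuous (@fst_continuous _ _) ival_continuous.
  + apply: comp_continuous cH; apply: pair_continuous; last exact: snd_continuous.
    exact/clamp_affine_continuous/fst_continuous.
  + apply: comp_continuous cK; apply: pair_continuous; last exact: snd_continuous.
    exact/clamp_affine_continuous/fst_continuous.
  + by move=> st ->; rewrite clampI_ge1 ?clampI_le0 ?H1 ?K0//; lra.
- by move=> t; rewrite ival0 invr_ge0 ler0n mulr0 addr0 clampI_le0.
- move=> t; rewrite ival1 ifF; last by apply/negP; lra.
  by rewrite clampI_ge1 //; lra.
- by move=> s; case: ifP.
Qed.

Definition path_rel p q := `[< path_homotopic p q >].

Lemma path_rel_refl : reflexive path_rel.
Proof. by move=> p; apply/asboolP; exact: path_homotopic_refl. Qed.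

Lemma path_rel_sym : symmetric path_rel.
Proof.
by move=> p q; apply/idP/idP => /asboolP pq; apply/asboolP;
  exact: path_homotopic_sym.
Qed.

Lemma path_rel_trans : transitive path_rel.
Proof.
move=> q p r /asboolP pq /asboolP qr; apply/asboolP.
exact: path_homotopic_trans pq qr.
Qed.

Definition path_equiv :=
  EquivRel path_rel path_rel_refl path_rel_sym path_rel_trans.

Definition pi1 : Type := {eq_quot path_equiv}.

HB.instance Definition _ := Choice.on pi1.
HB.instance Definition _ := Quotient.on pi1.

Lemma pi1_eq p q : \pi_pi1 p = \pi_pi1 q <-> path_homotopic p q.
Proof.
split; first by move=> /eqquotP/asboolP.
by move=> pq; apply/eqquotP/asboolP.
Qed.

Lemma pi1_repr p : path_homotopic (repr (\pi_pi1 p)) p.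
Proof. by apply/pi1_eq; rewrite reprK. Qed.

Definition concat_fun p q (t : I) : T :=
  if ival t <= 2^-1 then p (clampI (2 * ival t))
  else q (clampI (2 * ival t - 1)).

Lemma loop_clamp_continuous (X : topologicalType) p (f : X -> R) :
  continuous f -> continuous (fun z => p (clampI (f z))).
Proof.
move=> cf; apply: (@comp_continuous _ _ _ (fun z => clampI (f z)));
  last exact: cts_fun.
exact: comp_continuous cf clampI_continuous.
Qed.

Lemma concat_continuous p q : continuous (concat_fun p q).
Proof.
apply: (@paste_continuous _ _ _ ival _ (fun t => p (clampI (2 * ival t)))
  (fun t => q (clampI (2 * ival t - 1)))).
- exact: ival_continuous.
- apply: loop_clamp_continuous.
  under eq_fun do rewrite -[2 * _]addr0.
  exact/affine_continuous/ival_continuous.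
- exact/loop_clamp_continuous/affine_continuous/ival_continuous.
- by move=> t ->; rewrite clampI_ge1 ?clampI_le0 ?path_one ?path_zero//; lra.
Qed.

Lemma concat_zero p q : concat_fun p q zero = x.
Proof.
by rewrite /concat_fun ival0 invr_ge0 ler0n mulr0 clampI_le0// path_zero.
Qed.

Lemma concat_one p q : concat_fun p q one = x.
Proof.
rewrite /concat_fun ival1 ifF; last by apply/negP; lra.
by rewrite clampI_ge1 ?path_one//; lra.
Qed.

Definition concat p q : loop :=
  mk_path (@concat_continuous p q) (concat_zero p q) (concat_one p q).

Lemma rev_continuous p : continuous (fun t => p (clampI (1 - ival t))).
Proof.
apply: loop_clamp_continuous.
under eq_fun do rewrite addrC -mulN1r.
exact/affine_continuous/ival_continuous.
Qed.

Lemma rev_zero p : p (clampI (1 - ival zero)) = x.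
Proof. by rewrite ival0 subr0 clampI_ge1// path_one. Qed.

Lemma rev_one p : p (clampI (1 - ival one)) = x.
Proof. by rewrite ival1 subrr clampI_le0// path_zero. Qed.

Definition rev_loop p : loop :=
  mk_path (@rev_continuous p) (rev_zero p) (rev_one p).

Definition cst_loop : loop := cst x.

Definition pi1_one : pi1 := \pi_pi1 cst_loop.
Definition pi1_inv (a : pi1) : pi1 := \pi_pi1 (rev_loop (repr a)).
Definition pi1_mul (a b : pi1) : pi1 := \pi_pi1 (concat (repr a) (repr b)).

Lemma concatE p q t : concat p q t = concat_fun p q t.
Proof. by []. Qed.

Lemma rev_loopE p t : rev_loop p t = p (clampI (1 - ival t)).
Proof. by []. Qed.

Lemma concat_homotopic p p' q q' : path_homotopic p p' ->
  path_homotopic q q' -> path_homotopic (concat p q) (concat p' q').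
Proof.
case=> H [cH H0 H1 Hx] [K [cK K0 K1 Kx]].
exists (fun st => if ival st.2 <= 2^-1 then H (st.1, clampI (2 * ival st.2 + 0))
                  else K (st.1, clampI (2 * ival st.2 + -1))); split => /=.
- apply: (@paste_continuous _ _ _ (fun st : I * I => ival st.2) _
    (fun st => H (st.1, clampI (2 * ival st.2 + 0)))
    (fun st => K (st.1, clampI (2 * ival st.2 + -1)))).
  + exact: comp_continuous (@snd_continuous _ _) ival_continuous.
  + apply: comp_continuous cH; apply: pair_continuous; first exact: fst_continuous.
    exact/clamp_affine_continuous/snd_continuous.
  + apply: comp_continuous cK; apply: pair_continuous; first exact: fst_continuous.
    exact/clamp_affine_continuous/snd_continuous.
  + by move=> st ->; rewrite clampI_ge1 ?clampI_le0 ?(Hx _).2 ?(Kx _).1//; lra.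
- by move=> t; rewrite concatE /concat_fun; rewrite addr0; case: ifP => _; rewrite ?H0 ?K0.
- by move=> t; rewrite concatE /concat_fun; rewrite addr0; case: ifP => _; rewrite ?H1 ?K1.
- move=> s; split.
    by rewrite ival0 invr_ge0 ler0n mulr0 addr0 clampI_le0// (Hx _).1.
  rewrite ival1 ifF; last by apply/negP; lra.
  by rewrite clampI_ge1 ?(Kx _).2//; lra.
Qed.

Lemma reparam_homotopic p q r (f g : R -> R) :
  continuous f -> continuous g -> f 0 = g 0 -> f 1 = g 1 ->
  (forall t, p t = r (clampI (f (ival t)))) ->
  (forall t, q t = r (clampI (g (ival t)))) -> path_homotopic p q.
Proof.
move=> cf cg fg0 fg1 pE qE.
exists (fun st => r (clampI
  ((1 - ival st.1) * f (ival st.2) + ival st.1 * g (ival st.2)))).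
have cI1 : continuous (fun st : I * I => ival st.1).
  exact: comp_continuous (@fst_continuous _ _) ival_continuous.
have cI2 : continuous (fun st : I * I => ival st.2).
  exact: comp_continuous (@snd_continuous _ _) ival_continuous.
split => /=.
- apply: loop_clamp_continuous => st; apply: cvgD; apply: cvgM.
  + by apply: cvgB; [exact: cvg_cst|exact: cI1].
  + exact: (comp_continuous cI2 cf).
  + exact: cI1.
  + exact: (comp_continuous cI2 cg).
- by move=> t; rewrite ival0 subr0 mul1r mul0r addr0 -pE.
- by move=> t; rewrite ival1 subrr mul1r mul0r add0r -qE.
- move=> s; rewrite ival0 ival1 -fg0 -fg1 -!mulrDl subrK !mul1r.
  by have := pE zero; have := pE one; rewrite ival0 ival1 path_zero path_one.
Qed.

Lemma id_continuous : continuous (fun t : R => t).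
Proof. by move=> t; exact: cvg_id. Qed.

Lemma min_continuous (f g : R -> R) : continuous f -> continuous g ->
  continuous (fun t => Num.min (f t) (g t)).
Proof. by move=> cf cg t; apply: (@continuous_min R R f g t); [exact: cf|exact: cg]. Qed.

Lemma concatA_homotopic p q r :
  path_homotopic (concat p (concat q r)) (concat (concat p q) r).
Proof.
apply: (@reparam_homotopic _ _ (concat p (concat q r)) (fun t => t)
  (fun t => Num.min (Num.min (2 * t + 0) (1 * t + 4^-1)) (2^-1 * t + 2^-1))).
- exact: id_continuous.
- by apply: min_continuous; [apply: min_continuous|]; exact/affine_continuous/id_continuous.
- by rewrite !mulr0 !add0r (min_l (_ : 0 <= 4^-1)) ?min_l//; lra.
- by rewrite !mulr1 (min_r (_ : 1 + 4^-1 <= 2 + 0)) ?min_r//; lra.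
- by move=> t; rewrite ivalK.
move=> t; have t0 := ival_ge0 t; have t1 := ival_le1 t.
rewrite [LHS]concatE /concat_fun; case: ifPn => [t2|/negbTE/negbT t2].
- rewrite concatE /concat_fun ival_clampE; last by lra.
  have [t4|t4] := leP (2 * ival t) 2^-1.
  + rewrite [X in Num.min X _]min_l; last by lra.
    rewrite min_l; last by lra.
    rewrite concatE /concat_fun ival_clampE; last by lra.
    by rewrite ifT addr0//; lra.
  + rewrite [X in Num.min X _]min_r; last by lra.
    rewrite min_l; last by lra.
    rewrite concatE /concat_fun ival_clampE; last by lra.
    have [t4'|t4'] := leP (1 * ival t + 4^-1) 2^-1; first by exfalso; lra.
    rewrite concatE /concat_fun ival_clampE; last by lra.
    rewrite ifT; last by lra.
    by congr (q (clampI _)); lra.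
- rewrite -ltNge in t2; rewrite min_r; last by rewrite le_min; lra.
  rewrite concatE /concat_fun ival_clampE; last by lra.
  rewrite ifF; last by apply/negP; lra.
  rewrite concatE /concat_fun ival_clampE; last by lra.
  rewrite ifF; last by apply/negP; lra.
  by congr (r (clampI _)); lra.
Qed.

Lemma concat1p_homotopic p : path_homotopic (concat cst_loop p) p.
Proof.
apply: (@reparam_homotopic _ _ p (fun t => Num.max 0 (2 * t - 1)) (fun t => t)).
- move=> t; apply: (@continuous_max R R (cst 0) (fun t => 2 * t - 1) t).
    exact: cvg_cst.
  exact/affine_continuous/id_continuous.
- exact: id_continuous.
- by rewrite max_l//; lra.
- by rewrite max_r//; lra.
- move=> t; rewrite concatE /concat_fun; case: ifPn => [t2|].
    by rewrite [in RHS]clampI_le0 ?path_zero// ge_max; lra.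
  by rewrite -ltNge => t2; rewrite max_r//; lra.
- by move=> t; rewrite ivalK.
Qed.

Lemma concatp1_homotopic p : path_homotopic (concat p cst_loop) p.
Proof.
apply: (@reparam_homotopic _ _ p (fun t => Num.min 1 (2 * t + 0)) (fun t => t)).
- move=> t; apply: (@continuous_min R R (cst 1) (fun t => 2 * t + 0) t).
    exact: cvg_cst.
  exact/affine_continuous/id_continuous.
- exact: id_continuous.
- by rewrite min_r//; lra.
- by rewrite min_l//; lra.
- move=> t; rewrite concatE /concat_fun; case: ifPn => [t2|].
    by rewrite addr0 min_r//; lra.
  by rewrite -ltNge => t2; rewrite [in RHS]clampI_ge1 ?path_one// le_min; lra.
- by move=> t; rewrite ivalK.
Qed.

Lemma concatpV_homotopic p : path_homotopic (concat p (rev_loop p)) cst_loop.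
Proof.
apply: (@reparam_homotopic _ _ p
  (fun t => Num.min (2 * t + 0) (- 2 * t + 2)) (fun _ => 0)).
- by apply: min_continuous; exact/affine_continuous/id_continuous.
- by move=> t; exact: cvg_cst.
- by rewrite min_l//; lra.
- by rewrite min_r//; lra.
- move=> t; have t0 := ival_ge0 t; have t1 := ival_le1 t.
  rewrite concatE /concat_fun; case: ifPn => [t2|].
    by rewrite addr0 min_l//; lra.
  rewrite -ltNge => t2; rewrite min_r; last by lra.
  rewrite rev_loopE ival_clampE; last by lra.
  by congr (p (clampI _)); lra.
- by move=> t; rewrite clampI_le0// path_zero.
Qed.

Lemma concatVp_homotopic p : path_homotopic (concat (rev_loop p) p) cst_loop.
Proof.
apply: (@reparam_homotopic _ _ p
  (fun t => Num.max (- 2 * t + 1) (2 * t - 1)) (fun _ => 1)).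
- move=> t; apply: (@continuous_max R R (fun t => - 2 * t + 1)
    (fun t => 2 * t - 1) t); exact/affine_continuous/id_continuous.
- by move=> t; exact: cvg_cst.
- by rewrite max_l//; lra.
- by rewrite max_r//; lra.
- move=> t; have t0 := ival_ge0 t; have t1 := ival_le1 t.
  rewrite concatE /concat_fun; case: ifPn => [t2|].
    rewrite max_l; last by lra.
    rewrite rev_loopE ival_clampE; last by lra.
    by congr (p (clampI _)); lra.
  by rewrite -ltNge => t2; rewrite max_r//; lra.
- by move=> t; rewrite clampI_ge1// path_one.
Qed.

Lemma pi1_mulA : associative pi1_mul.
Proof.
move=> a b c; apply/pi1_eq.
apply: (@path_homotopic_trans _ (concat (repr a) (concat (repr b) (repr c)))).
  by apply: concat_homotopic; [exact: path_homotopic_refl|exact: pi1_repr].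
apply: path_homotopic_trans (concatA_homotopic _ _ _) _.
apply: concat_homotopic; last exact: path_homotopic_refl.
exact/path_homotopic_sym/pi1_repr.
Qed.

Lemma pi1_mul1g : left_id pi1_one pi1_mul.
Proof.
move=> a; rewrite -[RHS]reprK; apply/pi1_eq.
apply: path_homotopic_trans (concat1p_homotopic _).
by apply: concat_homotopic; [exact: pi1_repr|exact: path_homotopic_refl].
Qed.

Lemma pi1_mulg1 : right_id pi1_one pi1_mul.
Proof.
move=> a; rewrite -[RHS]reprK; apply/pi1_eq.
apply: path_homotopic_trans (concatp1_homotopic _).
by apply: concat_homotopic; [exact: path_homotopic_refl|exact: pi1_repr].
Qed.

Lemma pi1_mulVg : left_inverse pi1_one pi1_inv pi1_mul.
Proof.
move=> a; apply/pi1_eq; apply: path_homotopic_trans (concatVp_homotopic (repr a)).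
by apply: concat_homotopic; [exact: pi1_repr|exact: path_homotopic_refl].
Qed.

Lemma pi1_mulgV : right_inverse pi1_one pi1_inv pi1_mul.
Proof.
move=> a; apply/pi1_eq; apply: path_homotopic_trans (concatpV_homotopic (repr a)).
by apply: concat_homotopic; [exact: path_homotopic_refl|exact: pi1_repr].
Qed.

HB.instance Definition _ := isGroup.Build pi1
  pi1_mulA pi1_mul1g pi1_mulg1 pi1_mulVg pi1_mulgV.

End fundamental_group.

Arguments pi1 R {T} x.

Section induced_homomorphism.
Context {R : realType} {T U : topologicalType} (f : continuousType T U) (x : T).
Local Notation I := (unit_interval R).

Definition map_loop (p : {path I from x to x}) :
  {path I from f x to f x} := f \o p.

Definition pi1_map (a : pi1 R x) : pi1 R (f x) :=
  \pi_(pi1 R (f x)) (map_loop (repr a)).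

Lemma map_loop_homotopic p q :
  path_homotopic p q -> path_homotopic (map_loop p) (map_loop q).
Proof.
case=> H [cH H0 H1 Hx]; exists (f \o H); split => /= [st|t|t|s].
- by apply: continuous_comp; [exact: cH|exact: cts_fun].
- by rewrite H0.
- by rewrite H1.
- by have [-> ->] := Hx s.
Qed.

Lemma map_loop_concat p q :
  map_loop (concat p q) = concat (map_loop p) (map_loop q).
Proof.
apply/path_eqP => t; rewrite concatE /concat_fun.
by rewrite /map_loop /= -/(concat p q) concatE /concat_fun; case: ifP.
Qed.

Lemma pi1_map_morph : {morph pi1_map : a b / (a * b)%g}.
Proof.
move=> a b; apply/pi1_eq.
have := map_loop_homotopic (pi1_repr (concat (repr a) (repr b))).
move/path_homotopic_trans; apply; rewrite map_loop_concat.
by apply: concat_homotopic; apply/path_homotopic_sym/pi1_repr.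
Qed.

HB.instance Definition _ :=
  isMultiplicative.Build (pi1 R x) (pi1 R (f x)) pi1_map pi1_map_morph.

End induced_homomorphism.

Arguments pi1_map R {T U} f x _.

Lemma subfun_continuous (X : topologicalType) (A B : set X) (AB : A `<=` B) :
  continuous (subfun AB).
Proof. by apply: continuous_comp_initial; exact: initial_continuous. Qed.

HB.instance Definition _ (X : topologicalType) (A B : set X) (AB : A `<=` B) :=
  isContinuous.Build A B (subfun AB) (@subfun_continuous X A B AB).

Definition epimorphism (G H : groupType) (f : {multiplicative G -> H}) :=
  forall b : H, exists a : G, f a = b.

Definition isomorphism (G H : groupType) (f : {multiplicative G -> H}) :=
  bijective f.

Definition pi1_incl (R : realType) (X : topologicalType) (A B : set X)
    (AB : A `<=` B) (x : A) :
    {multiplicative pi1 R x -> pi1 R (subfun AB x)} :=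
  pi1_map R (subfun AB) x.

Section PL.
Context {R : realType}.

Definition conv_hull m (s : seq 'rV[R]_m) : set 'rV[R]_m :=
  [set x | exists w : 'I_(size s) -> R,
    [/\ forall i, 0 <= w i, \sum_i w i = 1 & x = \sum_i w i *: s`_i]].

Definition affine_indep m (s : seq 'rV[R]_m) : Prop :=
  forall w : 'I_(size s) -> R,
    \sum_i w i = 0 -> \sum_i w i *: s`_i = 0 -> forall i, w i = 0.

Definition cells m (K : seq (seq 'rV[R]_m)) : set 'rV[R]_m :=
  \bigcup_(s in [set` K]) conv_hull s.

(* Every manifold in play is compact, so only compact polyhedra are needed. *)
Definition polyhedron m (P : set 'rV[R]_m) : Prop := exists K, P = cells K.

(* The simplices need not meet along faces: subdividing a finite union of
   simplices into a simplicial complex does not change the largest dimension. *)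
Definition polyhedron_dim m (P : set 'rV[R]_m) (d : nat) : Prop :=
  exists K, [/\ P = cells K, forall s, s \in K -> affine_indep s &
                (\max_(s <- K) size s)%N = d.+1].

(* The values of [f] outside [P] are irrelevant, and continuity on [P] is
   automatic, the cells being closed and finite in number. *)
Definition pl_map m n (P : set 'rV[R]_m) (f : 'rV[R]_m -> 'rV[R]_n) : Prop :=
  exists K, P = cells K /\
    forall s, s \in K -> exists (A : 'M[R]_(m, n)) (b : 'rV[R]_n),
      forall x, conv_hull s x -> f x = x *m A + b.

Definition pl_homeo m n (P : set 'rV[R]_m) (Q : set 'rV[R]_n)
    (f : 'rV[R]_m -> 'rV[R]_n) : Prop :=
  [/\ pl_map P f, set_bij P Q f &
      exists g, pl_map Q g /\ forall x, P x -> g (f x) = x].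

Definition cube n : set 'rV[R]_n := [set x | forall i, 0 <= x 0 i <= 1].

Definition chart n m (P : set 'rV[R]_m) (x : 'rV[R]_m) (U : set 'rV[R]_m)
    (f : 'rV[R]_m -> 'rV[R]_n) : Prop :=
  [/\ U `<=` P, within P (nbhs x) U & pl_homeo U (@cube n) f].

(* A compact PL manifold, with possibly empty boundary, is presented as a
   polyhedron in some R^m; every compact PL manifold embeds PL in some R^m. *)
Definition pl_manifold n m (P : set 'rV[R]_m) : Prop :=
  polyhedron P /\ forall x, P x -> exists U (f : _ -> 'rV[R]_n), chart P x U f.

Definition pl_interior n m (P : set 'rV[R]_m) : set 'rV[R]_m :=
  [set x | P x /\ exists U (f : _ -> 'rV[R]_n),
    chart P x U f /\ forall i, 0 < f x 0 i < 1].

Definition pl_boundary n m (P : set 'rV[R]_m) : set 'rV[R]_m :=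
  P `\` pl_interior n P.

Definition closed_pl_manifold n m (P : set 'rV[R]_m) : Prop :=
  pl_manifold n P /\ pl_boundary n P = set0.

Definition connected_space m (P : set 'rV[R]_m) : Prop :=
  P !=set0 /\ connected P.

Definition cube_face n (c : R) : set 'rV[R]_n :=
  [set x | cube x /\ exists i : 'I_n, i = 0%N :> nat /\ x 0 i = c].

(* A 1-handle is a PL copy of [0,1] x [0,1]^(n-1), glued along
   {0,1} x [0,1]^(n-1) to the boundary of what has been built before. *)
Inductive one_handlebody n m : nat -> set 'rV[R]_m -> Prop :=
| OneHandlebody0 (f : 'rV[R]_n -> 'rV[R]_m) (B : set 'rV[R]_m) :
    pl_homeo (@cube n) B f -> one_handlebody n 0 B
| OneHandlebodyS g (P h : set 'rV[R]_m) (f : 'rV[R]_n -> 'rV[R]_m) :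
    one_handlebody n g P -> pl_homeo (@cube n) h f ->
    P `&` h = f @` (cube_face 0 `|` cube_face 1) ->
    P `&` h `<=` pl_boundary n P ->
    one_handlebody n g.+1 (P `|` h).

(* [P] is [Q] with a PL (d+1)-ball attached along a d-ball in its boundary. *)
Definition elementary_collapse m (P Q : set 'rV[R]_m) : Prop :=
  polyhedron P /\ polyhedron Q /\
  exists d B (f : 'rV[R]_d.+1 -> 'rV[R]_m),
    [/\ pl_homeo (@cube d.+1) B f, P = Q `|` B & Q `&` B = f @` cube_face 0].

Definition collapses m : set 'rV[R]_m -> set 'rV[R]_m -> Prop :=
  Relation_Operators.clos_refl_trans _ (@elementary_collapse m).

Definition spine n m (N P : set 'rV[R]_m) : Prop :=
  [/\ pl_manifold n N, pl_boundary n N !=set0, polyhedron P,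
      P `<=` pl_interior n N & collapses N P].

(* Intersecting with [M] only matters for the empty subfamily, whose
   intersection is [M]; it occurs in [k_fold_union] when [k = 0]. *)
Definition handlebody_cap m k (M : set 'rV[R]_m) (H : 'I_k.+1 -> set 'rV[R]_m)
    (S : {set 'I_k.+1}) : set 'rV[R]_m :=
  M `&` \bigcap_(i in [set` S]) H i.

Definition central m k (M : set 'rV[R]_m) (H : 'I_k.+1 -> set 'rV[R]_m) :=
  handlebody_cap M H [set: 'I_k.+1]%SET.

Record multisection n k m (M : set 'rV[R]_m) (H : 'I_k.+1 -> set 'rV[R]_m) :
    Prop := Multisection {
  multisection_manifold : forall i, pl_manifold n (H i);
  multisection_handlebody : forall i, exists g m' (K : set 'rV[R]_m') f,
    one_handlebody n g K /\ pl_homeo (H i) K f;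
  multisection_interiors : forall i j, i != j ->
    pl_interior n (H i) `&` pl_interior n (H j) = set0;
  multisection_cover : M = \bigcup_i H i;
  multisection_proper : forall S : {set 'I_k.+1}, (0 < #|S| <= k)%N ->
    [/\ pl_manifold (n - #|S|).+1 (handlebody_cap M H S),
        connected_space (handlebody_cap M H S) &
        exists P, spine (n - #|S|).+1 (handlebody_cap M H S) P /\
          polyhedron_dim P
            (if (n == k.*2) && (#|S| == k) then #|S|.-1 else #|S|)];
  multisection_central :
    closed_pl_manifold (n - k) (central M H) /\ connected_space (central M H)
}.

Definition k_fold_union m k (M : set 'rV[R]_m) (H : 'I_k.+1 -> set 'rV[R]_m) :=
  \bigcup_(S in [set S : {set 'I_k.+1} | #|S| = k]) handlebody_cap M H S.

Lemma central_sub m k (M : set 'rV[R]_m) (H : 'I_k.+1 -> set 'rV[R]_m) :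
  central M H `<=` M.
Proof. by move=> x []. Qed.

Lemma k_fold_union_sub m k (M : set 'rV[R]_m) (H : 'I_k.+1 -> set 'rV[R]_m) :
  k_fold_union M H `<=` M.
Proof. by move=> x [S _ []]. Qed.

End PL.

(* Main.v *)
Require Import Defs.
From mathcomp Require Import all_boot all_order all_algebra.
From mathcomp Require Import all_classical all_reals all_analysis.
From mathcomp Require Import generic_quotient homotopy.
From mathcomp Require Import ring lra zify.
Set Implicit Arguments.
Unset Strict Implicit.
Unset Printing Implicit Defensive.
Import Order.TTheory GRing.Theory Num.Theory.
Import numFieldNormedType.Exports.
Local Open Scope classical_set_scope.
Local Open Scope ring_scope.
Local Open Scope quotient_scope.

(* Let X_r be the union of the r-fold intersections H_I, |I| = r, so that X_1 = M, X_k is the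
   k-fold union and X_(k+1) the central submanifold.  The boundary of H_I is
   H_I `&` \bigcup_(j notin I) H_j, by invariance of domain for germs of PL embeddings, so
   X_r arises from X_(r+1) by attaching the (n - r + 1)-manifolds H_I along their whole
   boundaries.  The spine of H_I has codimension at least 3 if r < k and at least 2 if r = k.

   Suppose that N, with spine P, is attached to A along its boundary.  If P has codimension
   at least 2, a path of A `|` N with ends in A can be pushed off P, then off N by undoing the
   collapse of N onto P, hence into A; in codimension at least 3 the same holds for
   homotopies.  General position is replaced by a local statement: the complement of a closed
   set can be used to redo small paths or homotopies as soon as it is locally path connected,
   resp. simply connected, at the points to be avoided.  For simplices and for balls swept
   across during a collapse this is a property of the complement of an embedded polyhedral
   cone, proved by induction on the dimension: sweep the cone from a ray, and divide by the
   line through the tangency point at each stage. *)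

(** * Paths and homotopies *)

(** Two obstacles shape the proof. A collapse of [N] starts at the boundary of [N], where [A] is
    attached and the union need not be a manifold. Hence a collar, the product of [0, 1] with the
    intersection of [A] and [N], is inserted between them ([cyl]): every point of [N] then has a
    Euclidean neighbourhood, in which the set to be avoided is an embedded cone in R^d. Moreover a
    ball swept across during a collapse may have full dimension, so no codimension is available. Its
    tangent cone at a front point is instead [pointed], not a linear space, and the image of such a
    cone in R^d has simply connected complement in every codimension; the codimension of the spine
    counts only at interior points of its simplices. The count: H_I with |I| = r has dimension n - r
    + 1 and a spine of dimension r, hence codimension n - 2r + 1. This is at least 3 for r < k and
    equals 2 for n = 2k + 1, r = k; for n = 2k, r = k the smaller spine dimension r - 1 restores
    codimension 2. *)

Definition con (V W : topologicalType) (A : set V) (f : V -> W) :=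
  forall x, A x -> f @ within A (nbhs x) --> f x.

Section continuity_within.
Context {V W U : topologicalType}.
Implicit Types (A : set V) (B : set W) (f : V -> W) (g : W -> U).

Lemma continuous_con A f : continuous f -> con A f.
Proof. by move=> cf x _; apply: cvg_trans (cf x); exact/cvg_app/cvg_within. Qed.

Lemma con_sub A A' f : A `<=` A' -> con A' f -> con A f.
Proof.
move=> AA cf x Ax P /(cf x (AA _ Ax)); rewrite /= !nbhs_simpl /within /=.
by apply: filterS => y /[swap] /AA Ay; apply.
Qed.

Lemma con_comp A B f g : (forall x, A x -> B (f x)) -> con A f -> con B g ->
  con A (fun x => g (f x)).
Proof.
move=> AB cf cg x Ax; have := cg _ (AB _ Ax) => cgx P /cgx /= Pg.
have := cf x Ax _ Pg; rewrite /= /within /= !nbhs_simpl /within /=.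
by apply: filterS => y /[swap] Ay /(_ Ay); apply; exact: AB.
Qed.

Lemma con_setT f : con setT f -> continuous f.
Proof.
by move=> cf x P /(cf x I); rewrite /= !nbhs_simpl /within /=; apply: filterS => y; apply.
Qed.

Lemma con_eq A f f' : (forall x, A x -> f x = f' x) -> con A f -> con A f'.
Proof.
move=> ff cf x Ax P; rewrite -ff// => /(cf x Ax).
by rewrite /= !nbhs_simpl /within /=; apply: filterS => y /[swap] Ay /(_ Ay); rewrite -ff.
Qed.

End continuity_within.

(** Maps between subspaces are total functions, controlled by [con] on the relevant set; this is how
    they act on paths and homotopies, whose values lie in that set throughout. *)
Lemma con_total (V W U : topologicalType) (B : set W) (f : V -> W) (g : W -> U) :
  continuous f -> (forall x, B (f x)) -> con B g -> continuous (fun x => g (f x)).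
Proof.
move=> cf Bf cg; apply: con_setT; apply: con_comp cg => // ; exact: continuous_con.
Qed.

Section paths.
Context {R : realType}.

Definition clamp (t : R) : R := Num.min 1 (Num.max 0 t).

Lemma clamp_in t : 0 <= clamp t <= 1.
Proof. by rewrite le_min ler01 le_max lexx /= ge_min lexx. Qed.

Lemma clampE t : 0 <= t <= 1 -> clamp t = t.
Proof. by case/andP=> t0 t1; rewrite /clamp max_r// min_r. Qed.

Lemma clamp_le0 t : t <= 0 -> clamp t = 0.
Proof. by move=> t0; rewrite /clamp max_l// min_r. Qed.

Lemma clamp_ge1 t : 1 <= t -> clamp t = 1.
Proof. by move=> t1; rewrite /clamp max_r ?min_l// (le_trans ler01). Qed.

Lemma clamp0 : clamp 0 = 0. Proof. exact: clamp_le0. Qed.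
Lemma clamp1 : clamp 1 = 1. Proof. exact: clamp_ge1. Qed.

Lemma clamp_continuous : continuous clamp.
Proof.
move=> r; apply: (@continuous_min R R (cst 1) (cst 0 \max id)); first exact: cst_continuous.
by apply: continuous_max => //; exact: cst_continuous.
Qed.

Lemma affine_cts (a b : R) : continuous (fun t : R => a * t + b).
Proof. exact: affine_continuous (@id_continuous R). Qed.

Lemma mul_cts (a : R) : continuous (fun t : R => a * t).
Proof. by move=> t; apply: cvgM; [exact: cvg_cst|exact: cvg_id]. Qed.

Lemma opp_cts (a : R) : continuous (fun t : R => a - t).
Proof. by move=> t; apply: cvgB; [exact: cvg_cst|exact: cvg_id]. Qed.

Section in_space.
Context {W : topologicalType}.
Implicit Types (Y : set W) (p q r : R -> W).

(** Paths are defined on all of R, with values in [Y] everywhere, so that any continuous real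
    function reparametrizes them; [clamp] confines the argument to [0, 1] where that matters. *)
Definition pth Y p := continuous p /\ forall t, Y (p t).

Definition cat p q (t : R) := if t <= 2^-1 then p (2 * t) else q (2 * t - 1).

Definition rev p (t : R) := p (1 - t).

(** The values lie in [Y] on the whole plane, but the boundary conditions bind only on the unit
    square: paths that agree on [0, 1] are homotopic ([hmt_eq]). *)
Definition hmt Y p q := exists H : R * R -> W,
  [/\ continuous H, forall z, Y (H z),
      forall t, 0 <= t <= 1 -> H (0, t) = p t,
      forall t, 0 <= t <= 1 -> H (1, t) = q t &
      forall s, 0 <= s <= 1 -> H (s, 0) = p 0 /\ H (s, 1) = p 1].

Lemma pth_sub Y Y' p : Y `<=` Y' -> pth Y p -> pth Y' p.
Proof. by move=> YY [cp Yp]; split => // t; exact: YY. Qed.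

Lemma pth_cst Y x : Y x -> pth Y (fun=> x).
Proof. by move=> Yx; split=> // t; exact: cvg_cst. Qed.

Lemma cat0 p q : cat p q 0 = p 0.
Proof. by rewrite /cat invr_ge0 ler0n mulr0. Qed.

Lemma cat1 p q : cat p q 1 = q 1.
Proof. by rewrite /cat ifF ?mulr1; [congr q; lra|apply/negP; lra]. Qed.

Lemma pth_cat Y p q : pth Y p -> pth Y q -> p 1 = q 0 -> pth Y (cat p q).
Proof.
move=> [cp Yp] [cq Yq] pq; split; last by move=> t; rewrite /cat; case: ifP.
apply: (@paste_continuous _ _ _ id _ (fun t => p (2 * t)) (fun t => q (2 * t - 1))).
- exact: id_continuous.
- exact: (comp_continuous (mul_cts (a := 2)) cp).
- exact: comp_continuous (affine_cts (a := 2) (b := -1)) cq.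
- by move=> t ->; rewrite divff// pq; congr q; lra.
Qed.

Lemma pth_comp Y p (a : R -> R) : continuous a -> pth Y p -> pth Y (fun t => p (a t)).
Proof. by move=> ca [cp Yp]; split => //; exact: (comp_continuous ca cp). Qed.

Lemma pth_rev Y p : pth Y p -> pth Y (rev p).
Proof. exact: pth_comp (opp_cts (a := 1)). Qed.

Lemma hmt_sub Y Y' p q : Y `<=` Y' -> hmt Y p q -> hmt Y' p q.
Proof. by move=> YY [H [cH YH]]; exists H; split => // z; exact: YY. Qed.

Lemma hmt_ends Y p q : hmt Y p q -> p 0 = q 0 /\ p 1 = q 1.
Proof.
case=> H [cH YH H0 H1 He]; have i1 : 0 <= (1 : R) <= 1 by rewrite lexx ler01.
have i0 : 0 <= (0 : R) <= 1 by rewrite lexx ler01.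
by have [<- <-] := He 1 i1; rewrite !H1.
Qed.

Lemma hmt_eq Y p q : pth Y p -> (forall t, 0 <= t <= 1 -> p t = q t) -> hmt Y p q.
Proof.
move=> [cp Yp] pq; exists (fun z => p z.2); split => //.
exact: comp_continuous (@snd_continuous _ _) cp.
Qed.

Lemma hmt_refl Y p : pth Y p -> hmt Y p p.
Proof. by move=> Yp; apply: hmt_eq. Qed.

Lemma hmt_sym Y p q : hmt Y p q -> hmt Y q p.
Proof.
move=> pq; have [e0 e1] := hmt_ends pq; case: pq => H [cH YH H0 H1 He].
exists (fun z => H (-1 * z.1 + 1, z.2)); split => //=.
- apply: comp_continuous cH; apply: pair_continuous; last exact: snd_continuous.
  exact: affine_continuous (@fst_continuous _ _).
- by move=> t t01; rewrite mulr0 add0r H1.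
- by move=> t t01; rewrite mulr1 addNr H0.
- by move=> s s01; rewrite -e0 -e1; apply: He; lra.
Qed.

Lemma hmt_trans Y p q r : hmt Y p q -> hmt Y q r -> hmt Y p r.
Proof.
move=> pq; have [e0 e1] := hmt_ends pq; case: pq => H [cH YH H0 H1 He].
case=> K [cK YK K0 K1 Ke].
(* The [clamp] is there for the pasting: along z.1 = 1/2 both maps are known to equal [q] only for
   parameters in [0, 1]. *)
exists (fun z => if z.1 <= 2^-1 then H (2 * z.1 + 0, clamp z.2)
                 else K (2 * z.1 + -1, clamp z.2)); split => /=.
- apply: (@paste_continuous _ _ _ (fun z : R * R => z.1) _
    (fun z => H (2 * z.1 + 0, clamp z.2)) (fun z => K (2 * z.1 + -1, clamp z.2))).
  + exact: fst_continuous.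
  + apply: comp_continuous cH; apply: pair_continuous.
      exact: affine_continuous (@fst_continuous _ _).
    exact: comp_continuous (@snd_continuous _ _) clamp_continuous.
  + apply: comp_continuous cK; apply: pair_continuous.
      exact: affine_continuous (@fst_continuous _ _).
    exact: comp_continuous (@snd_continuous _ _) clamp_continuous.
  + move=> z ->; have -> : 2 * 2^-1 + 0 = 1 :> R by lra.
    have -> : 2 * 2^-1 + -1 = 0 :> R by lra.
    by rewrite H1 ?K0 ?clamp_in.
- by move=> z; case: ifP.
- by move=> t t01; rewrite ifT ?mulr0 ?addr0 ?H0 ?clampE//; lra.
- move=> t t01; rewrite ifF; last by apply/negP; lra.
  by rewrite (_ : 2 * 1 + -1 = 1) ?K1 ?clampE//; lra.
- move=> s s01; rewrite clamp0 clamp1; case: ifPn => [s2|].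
    by apply: He; lra.
  by rewrite -ltNge e0 e1 => s2; apply: Ke; lra.
Qed.

Lemma hmt_cat Y p p' q q' : p 1 = q 0 -> hmt Y p p' -> hmt Y q q' ->
  hmt Y (cat p q) (cat p' q').
Proof.
move=> pq [H [cH YH H0 H1 He]] [K [cK YK K0 K1 Ke]].
exists (fun z => if z.2 <= 2^-1 then H (clamp z.1, 2 * z.2 + 0)
                 else K (clamp z.1, 2 * z.2 + -1)); split => /=.
- apply: (@paste_continuous _ _ _ (fun z : R * R => z.2) _
    (fun z => H (clamp z.1, 2 * z.2 + 0)) (fun z => K (clamp z.1, 2 * z.2 + -1))).
  + exact: snd_continuous.
  + apply: comp_continuous cH; apply: pair_continuous.
      exact: comp_continuous (@fst_continuous _ _) clamp_continuous.
    exact: affine_continuous (@snd_continuous _ _).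
  + apply: comp_continuous cK; apply: pair_continuous.
      exact: comp_continuous (@fst_continuous _ _) clamp_continuous.
    exact: affine_continuous (@snd_continuous _ _).
  + move=> z ->; have -> : 2 * 2^-1 + 0 = 1 :> R by lra.
    have -> : 2 * 2^-1 + -1 = 0 :> R by lra.
    by rewrite (He _ _).2 ?(Ke _ _).1 ?clamp_in.
- by move=> z; case: ifP.
- move=> t t01; rewrite clamp0 /cat addr0; case: ifPn => [t2|].
    by rewrite H0//; lra.
  by rewrite -ltNge => t2; rewrite K0//; lra.
- move=> t t01; rewrite clamp1 /cat addr0; case: ifPn => [t2|].
    by rewrite H1//; lra.
  by rewrite -ltNge => t2; rewrite K1//; lra.
- move=> s s01; rewrite clampE// cat0 cat1; split.
    by rewrite ifT ?mulr0 ?addr0 ?(He _ _).1//; lra.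
  rewrite ifF; last by apply/negP; lra.
  by rewrite (_ : 2 * 1 + -1 = 1) ?(Ke _ _).2//; lra.
Qed.

(* The homotopy is [H] applied to the straight line from [a t] to [b t]. *)
Lemma hmt_conv (U : normedModType R) Y (H : U -> W) (a b : R -> U) :
  continuous H -> (forall u, Y (H u)) -> continuous a -> continuous b ->
  a 0 = b 0 -> a 1 = b 1 -> hmt Y (fun t => H (a t)) (fun t => H (b t)).
Proof.
move=> cH YH ca cb ab0 ab1.
exists (fun z => H ((1 - z.1) *: a z.2 + z.1 *: b z.2)); split => //=.
- apply: comp_continuous cH => z; apply: cvgD; apply: cvgZ.
  + by apply: cvgB; [exact: cvg_cst|exact: fst_continuous].
  + exact: (comp_continuous (@snd_continuous _ _) ca).
  + exact: fst_continuous.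
  + exact: (comp_continuous (@snd_continuous _ _) cb).
- by move=> t _; rewrite subr0 scale1r scale0r addr0.
- by move=> t _; rewrite subrr scale1r scale0r add0r.
- by move=> s _; rewrite -ab0 -ab1 -!scalerDl subrK !scale1r.
Qed.

Lemma hmt_par Y p (a b : R -> R) : pth Y p -> continuous a -> continuous b ->
  a 0 = b 0 -> a 1 = b 1 -> hmt Y (fun t => p (a t)) (fun t => p (b t)).
Proof. by move=> [cp Yp]; exact: (@hmt_conv R). Qed.

Lemma min_cts (f g : R -> R) : continuous f -> continuous g ->
  continuous (fun t => Num.min (f t) (g t)).
Proof. by move=> cf cg t; apply: (@continuous_min R R f g t); [exact: cf|exact: cg]. Qed.

Lemma hmt_catA Y p q r : pth Y p -> pth Y q -> pth Y r -> p 1 = q 0 -> q 1 = r 0 ->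
  hmt Y (cat p (cat q r)) (cat (cat p q) r).
Proof.
move=> Yp Yq Yr pq qr.
(* The piecewise linear change of parameter with b(1/4) = 1/2 and b(1/2) = 3/4, of slopes 2, 1 and
   1/2. *)
pose b (t : R) := Num.min (Num.min (2 * t + 0) (1 * t + 4^-1)) (2^-1 * t + 2^-1).
have -> : cat (cat p q) r = (fun t => cat p (cat q r) (b t)).
  apply/funext => t.
  have [t4|t4] := leP t 4^-1.
    have -> : b t = 2 * t by rewrite /b; case: (leP (2 * t + 0)) => ?; case: leP => ?; lra.
    by rewrite /cat !ifT; [congr p; lra|lra..].
  have [t2|t2] := leP t 2^-1.
    have -> : b t = t + 4^-1 by rewrite /b; case: (leP (2 * t + 0)) => ?; case: leP => ?; lra.
    rewrite /cat ifT// ifF; last by apply/negP; lra.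
    rewrite ifF; last by apply/negP; lra.
    by rewrite ifT; [congr q; lra|lra].
  have -> : b t = 2^-1 * t + 2^-1.
    by rewrite /b; case: (leP (2 * t + 0)) => ?; case: leP => ?; lra.
  rewrite /cat ifF; last by apply/negP; lra.
  rewrite ifF; last by apply/negP; lra.
  rewrite ifF; last by apply/negP; lra.
  by congr r; lra.
apply: (@hmt_par Y (cat p (cat q r)) id).
- by apply: pth_cat => //; [apply: pth_cat|rewrite cat0].
- exact: id_continuous.
- by apply: min_cts; [apply: min_cts|]; exact: affine_cts.
- by rewrite /b !mulr0 !add0r (min_l (_ : 0 <= 4^-1)) ?min_l//; lra.
- by rewrite /b !mulr1 (min_r (_ : 1 + 4^-1 <= 2 + 0)) ?min_r//; lra.
Qed.

Lemma hmt_cat1 Y p x : pth Y p -> p 1 = x -> hmt Y (cat p (fun=> x)) p.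
Proof.
move=> Yp <-; have -> : cat p (fun=> p 1) = (fun t => p (Num.min 1 (2 * t + 0))).
  apply/funext => t; rewrite /cat; case: ifPn => [t2|].
    by rewrite min_r ?addr0//; lra.
  by rewrite -ltNge => t2; rewrite min_l//; lra.
apply: (hmt_par (b := id) Yp).
- by apply: min_cts; [move=> t; exact: cvg_cst|exact: affine_cts].
- exact: id_continuous.
- by rewrite min_r//; lra.
- by rewrite min_l//; lra.
Qed.

Lemma hmt_1cat Y p x : pth Y p -> p 0 = x -> hmt Y (cat (fun=> x) p) p.
Proof.
move=> Yp <-; have -> : cat (fun=> p 0) p = (fun t => p (Num.max 0 (2 * t - 1))).
  apply/funext => t; rewrite /cat; case: ifPn => [t2|].
    by rewrite max_l//; lra.
  by rewrite -ltNge => t2; rewrite max_r//; lra.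
apply: (hmt_par (b := id) Yp).
- move=> t; apply: (@continuous_max R R (cst 0) (fun t => 2 * t - 1) t).
    exact: cvg_cst.
  exact: affine_cts.
- exact: id_continuous.
- by rewrite max_l//; lra.
- by rewrite max_r//; lra.
Qed.

Fixpoint chain (f : nat -> R -> W) n :=
  if n is n'.+1 then cat (chain f n') (f n) else f 0%N.

Lemma chain0 f n : chain f n 0 = f 0%N 0.
Proof. by elim: n => //= n IH; rewrite cat0. Qed.

Lemma chain1 f n : chain f n 1 = f n 1.
Proof. by case: n => //= n; rewrite cat1. Qed.

Lemma pth_chain Y f n : (forall i, (i <= n)%N -> pth Y (f i)) ->
  (forall i, (i < n)%N -> f i 1 = f i.+1 0) -> pth Y (chain f n).
Proof.
elim: n => [|n IH] Yf ff /=; first exact: Yf.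
apply: pth_cat; [|exact: Yf|by rewrite chain1 ff].
by apply: IH => i lt_in; [apply: Yf; exact: leqW|apply: ff; exact: ltnW].
Qed.

Lemma chain_eq f g n : (forall i, (i <= n)%N -> f i = g i) -> chain f n = chain g n.
Proof.
by elim: n => [|n IH] fg /=; rewrite fg ?IH// => i lt_in; apply: fg; exact: leqW.
Qed.

(** Homotopy commutative squares placed side by side: the induction carries the vertical path [v]
    across one square at a time by associativity. *)
Lemma hmt_ladder Y f g v n :
  (forall i, (i <= n)%N -> pth Y (f i) /\ pth Y (g i)) ->
  (forall i, (i <= n.+1)%N -> pth Y (v i)) ->
  (forall i, (i < n)%N -> f i 1 = f i.+1 0 /\ g i 1 = g i.+1 0) ->
  (forall i, (i <= n)%N -> [/\ f i 1 = v i.+1 0, v i 1 = g i 0 &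
     hmt Y (cat (f i) (v i.+1)) (cat (v i) (g i))]) ->
  hmt Y (cat (chain f n) (v n.+1)) (cat (v 0%N) (chain g n)).
Proof.
elim: n => [|n IH] Yfg Yv ff sq /=; first by case: (sq 0%N).
have lt i : (i <= n)%N -> (i <= n.+1)%N by exact: leqW.
have Ycf : pth Y (chain f n).
  by apply: pth_chain => i lt_in; [case: (Yfg i (lt _ lt_in))|case: (ff i (ltnW lt_in))].
have Ycg : pth Y (chain g n).
  by apply: pth_chain => i lt_in; [case: (Yfg i (lt _ lt_in))|case: (ff i (ltnW lt_in))].
have [Yfn Ygn] := Yfg n.+1 (leqnn _).
have [f1 v1 h1] := sq n.+1 (leqnn _).
have [f2 v2 h2] := sq n (leqnSn _).
have [ffn ggn] := ff n (ltnSn _).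
have Yvn := Yv n.+2 (leqnn _); have Yvn1 := Yv n.+1 (leqnSn _).
have Yv0 := Yv 0%N (leq0n _).
have cfn : chain f n 1 = f n.+1 0 by rewrite chain1.
apply: hmt_trans (_ : hmt Y (cat (chain f n) (cat (f n.+1) (v n.+2))) _).
  exact/hmt_sym/hmt_catA.
apply: hmt_trans (_ : hmt Y (cat (chain f n) (cat (v n.+1) (g n.+1))) _).
  by apply: hmt_cat => //; [rewrite cat0|exact: hmt_refl].
apply: hmt_trans (_ : hmt Y (cat (cat (chain f n) (v n.+1)) (g n.+1)) _).
  by apply: hmt_catA => //; rewrite chain1.
apply: hmt_trans (_ : hmt Y (cat (cat (v 0%N) (chain g n)) (g n.+1)) _).
  apply: hmt_cat => //; [by rewrite cat1|apply: IH|exact: hmt_refl].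
  - by move=> i /lt; exact: Yfg.
  - by move=> i ?; apply: Yv; exact: leqW.
  - by move=> i ?; apply: ff; exact: ltnW.
  - by move=> i /lt; exact: sq.
apply/hmt_sym/hmt_catA => //; last by rewrite chain1.
by rewrite chain0; case: (sq 0%N (leq0n _)).
Qed.

End in_space.

Section maps.
Context {W W' : topologicalType}.

Lemma cat_map (F : W -> W') (p q : R -> W) : (fun t => F (cat p q t)) = cat (fun t => F (p t)) (fun t => F (q t)).
Proof. by apply/funext => t; rewrite /cat; case: ifP. Qed.

Lemma pth_map (Y : set W) (Y' : set W') (F : W -> W') (p : R -> W) : con Y F -> (forall x, Y x -> Y' (F x)) ->
  pth Y p -> pth Y' (fun t => F (p t)).
Proof. by move=> cF YF [cp Yp]; split=> [|t]; [exact: con_total cF|exact: YF]. Qed.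

Lemma hmt_map (Y : set W) (Y' : set W') (F : W -> W') (p q : R -> W) : con Y F -> (forall x, Y x -> Y' (F x)) ->
  hmt Y p q -> hmt Y' (fun t => F (p t)) (fun t => F (q t)).
Proof.
move=> cF YF [H [cH YH H0 H1 He]]; exists (fun z => F (H z)); split.
- exact: con_total cF.
- by move=> z; exact: YF.
- by move=> t t01; rewrite H0.
- by move=> t t01; rewrite H1.
- by move=> s s01; have [-> ->] := He s s01.
Qed.

End maps.

Definition conn0 (W : topologicalType) (V : set W) :=
  forall x y, V x -> V y -> exists p : R -> W, [/\ pth V p, p 0 = x & p 1 = y].

(** Simple connectivity of [V] relative to [Y]: the paths run in [V], the homotopy in [Y].
    Connectedness is the separate condition [conn0]. *)
Definition conn1 (W : topologicalType) (V Y : set W) :=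
  forall p q : R -> W, pth V p -> pth V q -> p 0 = q 0 -> p 1 = q 1 -> hmt Y p q.

Section subdivision.
Context {W : topologicalType}.

(** The [clamp] keeps the piece inside the [i]-th of the [n.+1] subintervals for every real t, so
    that bounds on the oscillation hold on all of R. *)
Definition piece (p : R -> W) (n i : nat) (t : R) := p ((i%:R + clamp t) / n.+1%:R).

Lemma pth_piece Y p n i : pth Y p -> pth Y (piece p n i).
Proof.
apply: pth_comp => t; apply: cvgM; last exact: cvg_cst.
by apply: cvgD; [exact: cvg_cst|exact: clamp_continuous].
Qed.

Lemma hmt_pieces Y p n : pth Y p -> hmt Y p (chain (piece p n) n).
Proof.
move=> Yp; have [cp Yp'] := Yp.
(* Induction on the initial stretch of [p] up to (k+1)/(n+1), rescaled to [0, 1]. *)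
suff H k : (k <= n)%N -> hmt Y (fun t => p (t * (k.+1%:R / n.+1%:R))) (chain (piece p n) k).
  have := H n (leqnn _); rewrite divff ?pnatr_eq0//.
  by under [X in hmt _ X _ -> _]eq_fun do rewrite mulr1.
have lin (c : R) : continuous (fun t : R => t * c).
  by move=> t; apply: cvgM; [exact: cvg_id|exact: cvg_cst].
elim: k => [|k IH] kn /=.
  apply: hmt_eq; first exact: pth_comp (lin _) Yp.
  by move=> t t01; rewrite /piece clampE// add0r mul1r.
have Y1 : pth Y (fun t => p (t * (k.+1%:R / n.+1%:R))) by exact: pth_comp (lin _) Yp.
pose a := cat (fun t : R => t * (k.+1%:R / n.+1%:R)) (fun t => (k.+1%:R + clamp t) / n.+1%:R).
apply: hmt_trans (_ : hmt Y (fun t => p (a t)) _).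
  apply: (hmt_par (a := fun t => t * (k.+2%:R / n.+1%:R)) (b := a) Yp); [exact: lin| | |].
  - have T1 : pth setT (fun t : R => t * (k.+1%:R / n.+1%:R)) by split => //; exact: lin.
    have T2 : pth setT (fun t : R => (k.+1%:R + clamp t) / n.+1%:R).
      split => // t; apply: cvgM; last exact: cvg_cst.
      by apply: cvgD; [exact: cvg_cst|exact: clamp_continuous].
    by have := pth_cat T1 T2; rewrite clamp0 addr0 mul1r => /(_ erefl)[].
  - by rewrite /a cat0 !mul0r.
  - by rewrite /a cat1 mul1r clamp1 natr1.
rewrite /a cat_map; apply: hmt_cat.
- by rewrite mul1r clamp0 addr0.
- exact/IH/ltnW.
- exact/hmt_refl/pth_piece.
Qed.

Lemma hmt_clamp Y (p : R -> W) : pth Y p -> hmt Y p (fun t => p (clamp t)).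
Proof. by move=> Yp; apply: hmt_eq => // t t01; rewrite clampE. Qed.

Lemma hmt_clamp2 Y (p q : R -> W) : pth Y p -> pth Y q ->
  hmt Y (fun t => p (clamp t)) (fun t => q (clamp t)) -> hmt Y p q.
Proof.
move=> Yp Yq h; apply: hmt_trans (hmt_clamp Yp) _; apply: hmt_trans h _.
exact/hmt_sym/hmt_clamp.
Qed.

End subdivision.

Section deformations.
Context {W : topologicalType}.
Implicit Types Y : set W.

(** A path is homotopic to the track of its first end under [F], followed by its image at time 1 and
    the reversed track of its last end. The tracks depend on the ends only, hence are common to [p]
    and [q]. *)
Lemma hmt_defo Y (F : R * W -> W) (p q : R -> W) :
  con [set z : R * W | 0 <= z.1 <= 1 /\ Y z.2] F ->
  (forall s x, 0 <= s <= 1 -> Y x -> Y (F (s, x))) ->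
  (forall x, Y x -> F (0, x) = x) ->
  pth Y p -> pth Y q -> p 0 = q 0 -> p 1 = q 1 ->
  hmt Y (fun t => F (1, p t)) (fun t => F (1, q t)) -> hmt Y p q.
Proof.
move=> cF YF F0 Yp Yq pq0 pq1 h.
suff H r : pth Y r -> hmt Y r (cat (fun t => F (clamp t, r 0))
    (cat (fun t => F (1, r t)) (rev (fun t => F (clamp t, r 1))))).
  apply: hmt_trans (H p Yp) _; apply: hmt_trans (hmt_sym (H q Yq)).
  have [cp Yp'] := Yp.
  have side x : Y x -> pth Y (fun t => F (clamp t, x)).
    move=> Yx; split; last by move=> t; apply: YF => //; exact: clamp_in.
    apply: con_total cF; last by move=> t; split => //; exact: clamp_in.
    by apply: pair_continuous; [exact: clamp_continuous|move=> t; exact: cvg_cst].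
  rewrite -pq0 -pq1; apply: hmt_cat; [by rewrite cat0 clamp1| |].
    exact/hmt_refl/side.
  apply: hmt_cat => //; first by rewrite /rev subr0 clamp1.
  exact/hmt_refl/pth_rev/side.
move=> [cr Yr].
pose G (z : R * R) := F (clamp z.1, r z.2).
have cG : continuous G.
  apply: con_total cF; last by move=> z; split => //=; exact: clamp_in.
  apply: pair_continuous.
    exact: comp_continuous (@fst_continuous _ _) clamp_continuous.
  exact: comp_continuous (@snd_continuous _ _) cr.
have YG z : Y (G z) by apply: YF => //; exact: clamp_in.
have gE : r = (fun t => G (0, t)) by apply/funext => t; rewrite /G clamp0 F0.
(* The other three sides of the unit square; as the plane is convex, [hmt_conv] compares them with
   the side (0, t). *)
pose b : R -> (R * R)%type := cat (fun t : R => (t, 0 : R)) (cat (fun t : R => (1 : R, t)) (rev (fun t : R => (t, 1 : R)))).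
have cb : continuous b.
  have Tp (u : R -> (R * R)%type) : continuous u -> pth setT u by move=> cu; split.
  have c1 : continuous (fun t : R => (t, 0 : R)).
    by apply: pair_continuous; [exact: id_continuous|move=> t; exact: cvg_cst].
  have c2 : continuous (fun t : R => (1 : R, t)).
    by apply: pair_continuous; [move=> t; exact: cvg_cst|exact: id_continuous].
  have c3 : continuous (fun t : R => (t, 1 : R)).
    by apply: pair_continuous; [exact: id_continuous|move=> t; exact: cvg_cst].
  have := pth_cat (Tp _ c2) (pth_rev (Tp _ c3)); rewrite {1}/rev subr0 => /(_ erefl) T2.
  by have := pth_cat (Tp _ c1) T2; rewrite cat0 => /(_ erefl)[].
have -> : cat (fun t => F (clamp t, r 0))
    (cat (fun t => F (1, r t)) (rev (fun t => F (clamp t, r 1)))) = (fun t => G (b t)).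
  rewrite /b !cat_map; congr cat; congr cat.
  by apply/funext => t; rewrite /G clamp1.
rewrite [X in hmt _ X _]gE.
apply: (@hmt_conv _ (R * R)%type Y G (fun t => (0, t)) b) => //.
- by apply: pair_continuous; [move=> t; exact: cvg_cst|exact: id_continuous].
- by rewrite /b cat0.
- by rewrite /b !cat1 /rev subrr.
Qed.

End deformations.

End paths.

(** * Replacing homotopies over locally simply connected points *)

Section metric.
Context {R : realType}.

Lemma nbhs_dist (V : normedModType R) (x : V) (P : set V) :
  nbhs x P <-> exists2 e : R, 0 < e & forall y, `|y - x| < e -> P y.
Proof.
split=> [/nbhs_ballP[e /= e0 eP]|[e e0 eP]].
  by exists e => // y yx; apply: eP; rewrite -ball_normE /= distrC.
by apply/nbhs_ballP; exists e => // y; rewrite -ball_normE /= distrC => /eP.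
Qed.

Lemma con_distP (V W : normedModType R) (A : set V) (f : V -> W) :
  con A f <-> forall x, A x -> forall e : R, 0 < e -> exists2 d : R, 0 < d &
    forall y, A y -> `|y - x| < d -> `|f y - f x| < e.
Proof.
split=> [cf x Ax e e0|cf x Ax].
  have /nbhs_dist[d d0 dP] : nbhs x [set y | A y -> `|f y - f x| < e].
    apply: (cf x Ax [set z | `|z - f x| < e]).
    by apply/nbhs_dist; exists e.
  by exists d => // y Ay yx; exact: dP.
move=> P /nbhs_dist[e e0 eP]; have [d d0 dP] := cf x Ax e e0.
rewrite /= nbhs_simpl /= /within /=; apply/nbhs_dist; exists d => // y yx Ay.
exact/eP/dP.
Qed.

Lemma con_within (V W : topologicalType) (A : set V) (f : V -> W) :
  con A f <-> {within A, continuous f}.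
Proof. by split => [cf|cf]; [apply/subspace_continuousP|move/subspace_continuousP : cf]. Qed.

(** A Lebesgue number in abstract form: monotonicity in the radius lets locally uniform bounds be
    merged by compactness. *)
Lemma compact_radius (V : normedModType R) (Z : set V) (P : V -> R -> Prop) :
  compact Z ->
  (forall z e e', 0 < e' -> e' <= e -> P z e -> P z e') ->
  (forall z, Z z -> exists2 e : R, 0 < e & forall z', Z z' -> `|z' - z| < e -> P z' e) ->
  exists2 e : R, 0 < e & forall z, Z z -> P z e.
Proof.
move=> /compact_near_coveringP cZ mP loc.
have := cZ R (0^'+) (fun e z => Z z -> 0 < e -> P z e).
case.
  move=> z Zz; have [e e0 eP] := loc z Zz.
  exists ([set z' | `|z' - z| < e], [set e' : R | e' < e]).
    split; first by apply/nbhs_dist; exists e.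
    exact: nbhs_right_lt.
  move=> [z' e'] /= [z'z e'e] Zz' e'0.
  exact: (mP _ e) (ltW e'e) (eP _ Zz' z'z).
move=> d d0 dP; exists (d / 2); first exact: divr_gt0.
move=> z Zz; apply: (dP (d / 2)) => //=; last exact: divr_gt0.
  by rewrite sub0r normrN gtr0_norm ?divr_gt0// ltr_pdivrMr// ltr_pMr// ltr1n.
exact: divr_gt0.
Qed.

Lemma compact_unif_con (V W : normedModType R) (K : set V) (f : V -> W) (e : R) :
  compact K -> continuous f -> 0 < e -> exists2 d : R, 0 < d &
    forall x, K x -> forall y, `|y - x| < d -> `|f y - f x| < e.
Proof.
move=> cK cf e0.
apply: (compact_radius (P := fun x d => forall y, `|y - x| < d -> `|f y - f x| < e) cK).
  by move=> z d d' _ dd H y yz; apply: H; exact: lt_le_trans dd.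
move=> x Kx; have e2 : 0 < e / 2 by exact: divr_gt0.
have /con_distP cf' : con setT f by exact: continuous_con.
have [d d0 dP] := cf' x I _ e2.
have d2 : 0 < d / 2 by exact: divr_gt0.
exists (d / 2) => // x' _ x'x y yx'.
have h1 : `|f y - f x| < e / 2.
  apply: dP => //; rewrite (_ : y - x = (y - x') + (x' - x)); last by rewrite addrA subrK.
  by rewrite (le_lt_trans (ler_normD _ _))// [ltRHS]splitr ltrD.
have h2 : `|f x' - f x| < e / 2.
  by apply: dP => //; rewrite (lt_le_trans x'x)// ler_pdivrMr// ler_pMr// ler1n.
rewrite (_ : f y - f x' = (f y - f x) - (f x' - f x)); last first.
  by rewrite opprB addrA subrK.
by rewrite (le_lt_trans (ler_normB _ _))// [ltRHS]splitr ltrD.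
Qed.

Lemma dist_trans (V : normedModType R) (x y z : V) (a b : R) :
  `|x - y| < a -> `|y - z| < b -> `|x - z| < a + b.
Proof.
move=> xa yb; rewrite (_ : x - z = (x - y) + (y - z)); last by rewrite addrA subrK.
by rewrite (le_lt_trans (ler_normD _ _))// ltrD.
Qed.

Lemma grid_in (n i : nat) (t : R) : (i <= n)%N -> 0 <= (i%:R + clamp t) / n.+1%:R <= 1.
Proof.
move=> i_n; have /andP[c0 c1] := clamp_in t.
have i0 : 0 <= i%:R :> R by [].
have i1 : i%:R <= n%:R :> R by rewrite ler_nat.
have N0 : 0 < n.+1%:R :> R by rewrite ltr0n.
rewrite divr_ge0 ?addr_ge0//= ler_pdivrMr// mul1r -natr1; lra.
Qed.

Lemma fine_grid (V : normedModType R) (h : R * R -> V) (e : R) :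
  continuous h -> 0 < e -> exists n : nat, forall i j, (i <= n)%N -> (j <= n)%N ->
    forall s t s' t', `|h ((j%:R + clamp s) / n.+1%:R, (i%:R + clamp t) / n.+1%:R) -
      h ((j%:R + clamp s') / n.+1%:R, (i%:R + clamp t') / n.+1%:R)| < e.
Proof.
move=> ch e0.
have cK : compact (`[(0 : R), 1] `*` `[(0 : R), 1]).
  by apply: compact_setX; exact: segment_compact.
have [d d0 dP] := @compact_unif_con (R * R)%type V _ h e cK ch e0.
have [n /= _ nd] := near_infty_natSinv_lt (PosNum d0).
exists n => i j i_n j_n s t s' t'.
have N0 : 0 < n.+1%:R :> R by rewrite ltr0n.
have cl a b : (`|(a - b) / n.+1%:R| < d)%R \/ `|a - b| > 1.
  have [|] := ltrP 1 `|a - b|; first by right.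
  move=> ab; left; rewrite normrM [X in _ * X]gtr0_norm ?invr_gt0//.
  by rewrite (le_lt_trans _ (nd n (leqnn n)))// ler_piMl// invr_ge0 ltW.
have sm (a b : R) k : `|(k%:R + clamp a) / n.+1%:R - (k%:R + clamp b) / n.+1%:R| < d.
  rewrite -mulrBl; have := cl (k%:R + clamp a) (k%:R + clamp b).
  case=> //; have /andP[] := clamp_in a; have /andP[] := clamp_in b => ? ? ? ?.
  by rewrite ltNge; case/negP; rewrite ler_norml; lra.
apply: dP.
  by split => /=; rewrite in_itv /= grid_in.
by rewrite prod_normE /= gt_max !sm.
Qed.

End metric.

Section local_to_global.
Context {R : realType} {V W : normedModType R}.
Implicit Types (X A Z : set V) (Y : set W) (io : V -> W) (pi : W -> V).

(** [pi] places [Y] over [V]: it is the identity for subsets of [V] and the first projection for a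
    cylinder. *)
Definition over Y pi z (e : R) : set W := [set y | Y y /\ `|pi y - z| < e].

(* [Y] is nonempty, locally path connected and, if [b], locally simply connected over the
   points of [Z], uniformly in [Z]; these points need not be images of points of [Y]. *)
Definition lcc (b : bool) Y pi Z := forall e : R, 0 < e -> exists2 d : R, 0 < d &
  forall z, Z z -> [/\ over Y pi z e !=set0,
    forall x y, over Y pi z d x -> over Y pi z d y ->
      exists p : R -> W, [/\ pth (over Y pi z e) p, p 0 = x & p 1 = y] &
    b -> conn1 (R := R) (over Y pi z d) (over Y pi z e)].

Lemma over_le Y pi z (e e' : R) : e' <= e -> over Y pi z e' `<=` over Y pi z e.
Proof. by move=> ee y [Yy ye]; split => //; exact: lt_le_trans ee. Qed.

Lemma over_near Y pi z z' (e d : R) : `|z' - z| < d ->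
  over Y pi z e `<=` over Y pi z' (e + d).
Proof. by move=> zz y [Yy ye]; split => //; apply: dist_trans ye _; rewrite distrC. Qed.

Lemma conn1_sub (T : topologicalType) (U U' Y Y' : set T) : U' `<=` U -> Y `<=` Y' ->
  conn1 (R := R) U Y -> conn1 (R := R) U' Y'.
Proof.
move=> UU YY c p q Up Uq pq0 pq1; apply: (hmt_sub YY).
by apply: c => //; [exact: pth_sub Up|exact: pth_sub Uq].
Qed.

(** Moving the center from g q to a nearby g q' costs at most half of each radius, so the condition
    at single points is locally uniform, and compactness of [Q] makes it uniform. The hypothesis on
    [S] says that it is relatively closed in [Q]. *)
Lemma lcc_image b Y pi (U : normedModType R) (Q S : set U) (g : U -> V) :
  compact Q -> con Q g ->
  (forall q, Q q -> ~ S q -> exists2 e : R, 0 < e &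
     forall q', Q q' -> `|q' - q| < e -> ~ S q') ->
  (forall q, Q q -> S q -> lcc b Y pi [set g q]) -> lcc b Y pi (g @` (Q `&` S)).
Proof.
move=> cQ /con_distP cg openS loc e e0.
pose e2 := e / 2; have e20 : 0 < e2 by exact: divr_gt0.
pose P z (d : R) := [/\ over Y pi z e !=set0,
    forall x y, over Y pi z d x -> over Y pi z d y ->
      exists p : R -> W, [/\ pth (over Y pi z e) p, p 0 = x & p 1 = y] &
    b -> conn1 (R := R) (over Y pi z d) (over Y pi z e)].
have [||d d0 dP] := @compact_radius _ _ _ (fun q d => S q -> P (g q) d) cQ; last first.
- by exists d => // _ [q [Qq Sq] <-]; exact: dP.
- move=> q Qq; have [Sq|nSq] := pselect (S q); last first.
    have [d d0 dP] := openS q Qq nSq.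
    by exists d => // q' Qq' q'q Sq'; case: (dP q' Qq' q'q).
  have [d d0 /(_ _ erefl)[[w ow] h2 h3]] := loc q Qq Sq e2 e20.
  pose r := Num.min (d / 2) e2; have r0 : 0 < r by rewrite lt_min divr_gt0.
  have rd : r <= d / 2 by rewrite ge_min lexx.
  have re : r <= e2 by rewrite ge_min lexx orbT.
  have e2E : e2 + e2 = e by rewrite /e2 -splitr.
  have dE : d / 2 + d / 2 = d by rewrite -splitr.
  have [r' r'0 r'P] := cg q Qq r r0.
  exists (Num.min r' r); first by rewrite lt_min r'0.
  move=> q' Qq'; rewrite lt_min => /andP[/(r'P q' Qq') zz' _] _.
  have zz : `|g q - g q'| < r by rewrite distrC.
  have mr : Num.min r' r <= r by rewrite ge_min lexx orbT.
  have sub1 : over Y pi (g q) e2 `<=` over Y pi (g q') e.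
    by move=> y /(over_near zz'); apply: over_le; lra.
  have sub2 : over Y pi (g q') (Num.min r' r) `<=` over Y pi (g q) d.
    by move=> y /(over_near zz); apply: over_le; lra.
  split.
  + by exists w; exact: sub1.
  + move=> x y /sub2 ox /sub2 oy; have [p [op p0 p1]] := h2 _ _ ox oy.
    by exists p; split => //; exact: pth_sub op.
  + by move=> /h3; exact: conn1_sub.
- move=> q d d' d'0 dd H /H[h1 h2 h3]; split=> // [x y ox oy|/h3].
    by apply: h2; exact: over_le dd _ _.
  by apply: conn1_sub => //; exact: over_le.
Qed.

(** One lift is fixed for every vertex and every edge of a grid, whichever square it is viewed from,
    so that lifts over adjacent squares fit together. Edges inside [A] are lifted by [io], other
    short edges near [Z] by local path connectivity of [Y]. *)
Lemma edge_lifts b A Z Y io pi (d2 : R) : 0 < d2 -> lcc b Y pi Z -> con A io ->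
  (forall x, A x -> Y (io x) /\ pi (io x) = x) ->
  exists2 eta0 : R, 0 < eta0 & forall eta, 0 < eta -> eta <= eta0 ->
  exists (nu : V -> W) (L : (R -> V) -> (R -> W)),
  [/\ forall x, A x -> nu x = io x,
      forall x z, Z z -> `|x - z| < eta -> Y (nu x) /\ `|pi (nu x) - z| < d2 &
      forall s : R -> V, continuous s ->
       (forall t, A (s t)) \/ (exists2 z, Z z & forall t, `|s t - z| < eta) ->
      [/\ pth Y (L s), L s 0 = nu (s 0), L s 1 = nu (s 1),
          (forall t, A (s t)) -> L s = io \o s &
          forall z, Z z -> (forall t, `|s t - z| < eta) ->
            forall t, `|pi (L s t) - z| < d2]].
Proof.
move=> d20 lY cio Aio.
have [d d0 dP] := lY (d2 / 2) (divr_gt0 d20 (ltr0n _ 2)).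
(* A vertex lift lies within 3 eta of every nearby [z], which has to fit into the [d]-ball; an edge
   lift stays within d2 / 2 of one [z0], and any other nearby [z] is at distance less than 2 eta
   from it. *)
pose eta0 := Num.min (d / 3) (d2 / 4).
have eta00 : 0 < eta0 by rewrite lt_min !divr_gt0.
exists eta0 => // eta e0 ee.
have ed : eta <= d / 3 by apply: le_trans ee _; rewrite ge_min lexx.
have ed2 : eta <= d2 / 4 by apply: le_trans ee _; rewrite ge_min lexx orbT.
have [de de0 deP] := lY eta e0.
have /choice[nu nuP] : forall x, exists y, [/\ A x -> y = io x &
    ~ A x -> forall z, Z z -> `|x - z| < eta -> Y y /\ `|pi y - z| < 3 * eta].
  move=> x.
  have [Ax|nAx] := pselect (A x); first by exists (io x).
  have [[z0 Zz0 xz0]|nz] := pselect (exists2 z, Z z & `|x - z| < eta).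
    have [[w [Yw wz]] _ _] := deP z0 Zz0; exists w; split=> // _ z Zz xz.
    split => //; have z0x : `|z0 - x| < eta by rewrite distrC.
    by have := dist_trans (dist_trans wz z0x) xz; rewrite (_ : 3 * eta = eta + eta + eta)//; lra.
  by exists (io x); split=> // _ z Zz xz; case: nz; exists z.
have nuZ x z : Z z -> `|x - z| < eta -> Y (nu x) /\ `|pi (nu x) - z| < 3 * eta.
  move=> Zz xz; have [nu1 nu2] := nuP x.
  have [Ax|nAx] := pselect (A x); last exact: nu2.
  rewrite nu1//; have [Yx ->] := Aio x Ax; split=> //; lra.
pose good (s : R -> V) (l : R -> W) := continuous s ->
       (forall t, A (s t)) \/ (exists2 z, Z z & forall t, `|s t - z| < eta) ->
      [/\ pth Y l, l 0 = nu (s 0), l 1 = nu (s 1),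
          (forall t, A (s t)) -> l = io \o s &
          forall z, Z z -> (forall t, `|s t - z| < eta) ->
            forall t, `|pi (l t) - z| < d2].
have /choice[L LP] : forall s, exists l, good s l.
  move=> s; rewrite /good.
  have [As|nAs] := pselect (forall t, A (s t)).
    exists (io \o s) => cs _; split => //.
    - by split=> [|t]; [exact: con_total cio|have [] := Aio _ (As t)].
    - by rewrite (nuP _).1.
    - by rewrite (nuP _).1.
    - by move=> z Zz sz t /=; have [_ ->] := Aio _ (As t); have := sz t; lra.
  have [[z0 Zz0 sz0]|nz] := pselect (exists2 z, Z z & forall t, `|s t - z| < eta); last first.
    by exists (io \o s) => cs [].
  have on t : over Y pi z0 d (nu (s t)).
    by have [Yn nz] := nuZ _ z0 Zz0 (sz0 t); split => //; lra.
  have [_ pP _] := dP z0 Zz0; have [p [[cp op] p0 p1]] := pP _ _ (on 0) (on 1).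
  exists p => cs _; split => //; first by split => // t; case: (op t).
  move=> z Zz sz t; have [_ pz0] := op t.
  have z0s : `|z0 - s t| < eta by rewrite distrC.
  by have := dist_trans (dist_trans pz0 z0s) (sz t); lra.
exists nu, L; split.
- by move=> x Ax; rewrite (nuP x).1.
- by move=> x z Zz xz; have [Yn nz] := nuZ _ _ Zz xz; split=> //; lra.
- by move=> s; exact: LP.
Qed.

(* A homotopy is redone square by square on a fine grid: a square inside [A] is
   kept (through [io]), any other one lies close to a point of [Z] over which [Y]
   is locally simply connected. *)
Lemma hmt_local_to_global A Z Y io pi : lcc true Y pi Z -> con A io ->
  (forall x, A x -> Y (io x) /\ pi (io x) = x) ->
  exists2 eta : R, 0 < eta & forall h : R * R -> V, continuous h ->
    (forall s t, 0 <= s <= 1 -> 0 <= t <= 1 ->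
       A (h (s, t)) \/ exists2 z, Z z & `|h (s, t) - z| < eta) ->
    (forall s, 0 <= s <= 1 -> h (s, 0) = h (0, 0) /\ h (s, 1) = h (0, 1)) ->
    (forall t, 0 <= t <= 1 -> A (h (0, t)) /\ A (h (1, t))) ->
    hmt Y (fun t => io (h (0, clamp t))) (fun t => io (h (1, clamp t))).
Proof.
move=> lY cio Aio; have [d2 d20 d2P] := lY 1 ltr01.
have [e0 e00 lifts] := edge_lifts d20 lY cio Aio.
have [nu [L [nuA nuZ LP]]] := lifts e0 e00 (lexx _).
(* Half of [e0] for the distance to [Z] at one point, half for the oscillation of [h] on a grid
   square. *)
exists (e0 / 2); first exact: divr_gt0.
move=> h ch hAZ hs hA.
have [n nP] := fine_grid ch (divr_gt0 e00 (ltr0n _ 2)).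
pose N : R := n.+1%:R; have N0 : N != 0 by rewrite pnatr_eq0.
pose g j i (z : R * R) := h ((j%:R + clamp z.1) / N, (i%:R + clamp z.2) / N).
have cg j i : continuous (g j i).
  apply: comp_continuous ch; apply: pair_continuous => z; apply: cvgM;
    (try exact: cvg_cst); apply: cvgD; (try exact: cvg_cst).
    exact: (comp_continuous (@fst_continuous _ _) clamp_continuous).
  exact: (comp_continuous (@snd_continuous _ _) clamp_continuous).
have sq j i : (j <= n)%N -> (i <= n)%N ->
    (forall z, A (g j i z)) \/ (exists2 z, Z z & forall u, `|g j i u - z| < e0).
  move=> jn i_n; have [|/existsNP[u nAu]] := pselect (forall z, A (g j i z)); first by left.
  right; have := hAZ _ _ (grid_in u.1 jn) (grid_in u.2 i_n); case=> // -[z Zz uz].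
  exists z => // u'; have := nP i j i_n jn u'.1 u'.2 u.1 u.2 => /dist_trans - /(_ _ _ uz).
  by rewrite -splitr.
(* [row j i] is an edge in the path direction at homotopy time j / N, [col j i] an edge in the
   homotopy direction. *)
pose row j i (t : R) := h (j%:R / N, (i%:R + clamp t) / N).
pose col j i (s : R) := h ((j%:R + clamp s) / N, i%:R / N).
have row0 j i : row j i = (fun t => g j i (0, t)).
  by apply/funext => t; rewrite /g /= clamp0 addr0.
have row1 j i : row j.+1 i = (fun t => g j i (1, t)).
  by apply/funext => t; rewrite /g /= clamp1 natr1.
have col0 j i : col j i = (fun t => g j i (t, 0)).
  by apply/funext => t; rewrite /g /= clamp0 addr0.
have col1 j i : col j i.+1 = (fun t => g j i (t, 1)).
  by apply/funext => t; rewrite /g /= clamp1 natr1.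
have cpr (x : R) : continuous (fun t : R => (x, t)).
  by apply: pair_continuous; [move=> t; exact: cvg_cst|exact: id_continuous].
have cpl (x : R) : continuous (fun t : R => (t, x)).
  by apply: pair_continuous; [exact: id_continuous|move=> t; exact: cvg_cst].
pose ok (s : R -> V) := continuous s /\ ((forall t, A (s t)) \/
  (exists2 z, Z z & forall t, `|s t - z| < e0)).
have okg j i (a : R -> R * R) : (j <= n)%N -> (i <= n)%N -> continuous a ->
    ok (fun t => g j i (a t)).
  move=> jn i_n ca; split; first exact: (comp_continuous ca (cg j i)).
  by have [Ag|[z Zz gz]] := sq j i jn i_n; [left|right; exists z].
have okrow j i : (j <= n.+1)%N -> (i <= n)%N -> ok (row j i).
  move=> + i_n; rewrite leq_eqVlt => /orP[/eqP ->|jn].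
    by rewrite row1; exact: okg.
  by rewrite row0; exact: okg.
have okcol j i : (j <= n)%N -> (i <= n.+1)%N -> ok (col j i).
  move=> jn; rewrite leq_eqVlt => /orP[/eqP ->|i_n].
    by rewrite col1; exact: okg.
  by rewrite col0; exact: okg.
have Lok s : ok s -> pth Y (L s) by case=> cs /(LP _ cs)[].
have L0 s : ok s -> L s 0 = nu (s 0) by case=> cs /(LP _ cs)[].
have L1 s : ok s -> L s 1 = nu (s 1) by case=> cs /(LP _ cs)[].
have LA s : ok s -> (forall t, A (s t)) -> L s = io \o s by case=> cs /(LP _ cs)[].
have square j i : (j <= n)%N -> (i <= n)%N ->
    hmt Y (cat (L (row j i)) (L (col j i.+1))) (cat (L (col j i)) (L (row j.+1 i))).
  move=> jn i_n.
  have ok1 : ok (row j i) by apply: okrow => //; exact: leqW.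
  have ok2 : ok (col j i.+1) by exact: okcol.
  have ok3 : ok (col j i) by apply: okcol => //; exact: leqW.
  have ok4 : ok (row j.+1 i) by exact: okrow.
  have [Ag|[z Zz gz]] := sq j i jn i_n.
    have -> : L (row j i) = io \o row j i by apply: LA => // t; rewrite row0; exact: Ag.
    have -> : L (col j i.+1) = io \o col j i.+1 by apply: LA => // t; rewrite col1; exact: Ag.
    have -> : L (col j i) = io \o col j i by apply: LA => // t; rewrite col0; exact: Ag.
    have -> : L (row j.+1 i) = io \o row j.+1 i by apply: LA => // t; rewrite row1; exact: Ag.
    rewrite row1 col1 (row0 j i) (col0 j i) /comp.
    pose G z := io (g j i z).
    rewrite -[X in hmt _ X _]/(cat (fun t => G (0, t)) (fun t => G (t, 1))).
    rewrite -[X in hmt _ _ X]/(cat (fun t => G (t, 0)) (fun t => G (1, t))).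
    rewrite -(cat_map G (fun t => (0, t)) (fun t => (t, 1))).
    rewrite -(cat_map G (fun t => (t, 0)) (fun t => (1, t))).
    have T (a : R -> (R * R)%type) : continuous a -> pth setT a by move=> ca; split.
    apply: (@hmt_conv _ _ (R * R)%type Y G).
    - by apply: con_total (cg j i) _ cio => z; exact: Ag.
    - by move=> u; case: (Aio _ (Ag u)).
    - by case: (pth_cat (T _ (cpr 0)) (T _ (cpl 1)) erefl).
    - by case: (pth_cat (T _ (cpl 0)) (T _ (cpr 1)) erefl).
    - by rewrite !cat0.
    - by rewrite !cat1.
  have near s : ok s -> (forall t, `|s t - z| < e0) -> pth (over Y pi z d2) (L s).
    move=> oks sz; have [cL YL] := Lok s oks; split=> // t; split => //.
    by case: oks => cs /(LP _ cs)[_ _ _ _ /(_ z Zz sz)].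
  have n1 : pth (over Y pi z d2) (L (row j i)) by apply: near => // t; rewrite row0; exact: gz.
  have n2 : pth (over Y pi z d2) (L (col j i.+1)) by apply: near => // t; rewrite col1; exact: gz.
  have n3 : pth (over Y pi z d2) (L (col j i)) by apply: near => // t; rewrite col0; exact: gz.
  have n4 : pth (over Y pi z d2) (L (row j.+1 i)) by apply: near => // t; rewrite row1; exact: gz.
  have [_ _ /(_ isT) c1] := d2P z Zz.
  apply: (hmt_sub (Y := over Y pi z 1)); first by move=> y [].
  apply: c1.
  - by apply: pth_cat => //; rewrite L1// L0// row0 col1.
  - by apply: pth_cat => //; rewrite L1// L0// col0 row1.
  - by rewrite !cat0 !L0// row0 col0.
  - by rewrite !cat1 !L1// row1 col1.
(* [h] fixes the ends of the path, so the outer edges in the homotopy direction are constant with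
   value in [A]. *)
have side j i : (j <= n)%N -> i = 0%N \/ i = n.+1 -> L (col j i) = (fun=> io (h (0, i%:R / N))).
  move=> jn iE.
  have cE : col j i = (fun=> h (0, i%:R / N)).
    apply/funext => s; rewrite /col; have [h0 h1] := hs _ (grid_in s jn).
    by case: iE => ->; [rewrite mul0r|rewrite /N divff].
  have ij : (i <= n.+1)%N by case: iE => ->.
  rewrite LA; [by rewrite cE|exact: okcol|].
  move=> s; rewrite cE; suff [] : A (h (0, i%:R / N)) /\ A (h (1, i%:R / N)) by [].
  by apply: hA; case: iE => ->; [rewrite mul0r lexx ler01|rewrite divff// lexx ler01].
have pc j : (j <= n.+1)%N -> pth Y (chain (fun i => L (row j i)) n).
  move=> jn; apply: pth_chain => i i_n; first exact/Lok/okrow.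
  rewrite L1; last exact/okrow/ltnW.
  by rewrite L0; [rewrite /row clamp0 clamp1 addr0 natr1|exact: okrow].
have gjn j : (j <= n.+1)%N -> 0 <= j%:R / N <= 1.
  move=> jn; rewrite divr_ge0//= ler_pdivrMr ?mul1r ?ler_nat//; lra.
have end0 j : (j <= n.+1)%N -> row j 0%N 0 = h (0, 0).
  by move=> /gjn /hs[+ _]; rewrite /row clamp0 addr0 mul0r.
have end1 j : (j <= n.+1)%N -> row j n 1 = h (0, 1).
  by move=> /gjn /hs[_]; rewrite /row clamp1 natr1 divff.
have Ah0 : A (h (0, 0)) by have [] := hA 0; rewrite ?lexx ?ler01.
have Ah1 : A (h (0, 1)) by have [] := hA 1; rewrite ?lexx ?ler01.
have step j : (j <= n)%N ->
    hmt Y (chain (fun i => L (row j i)) n) (chain (fun i => L (row j.+1 i)) n).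
  move=> jn; have jn1 := leqW jn.
  have : hmt Y (cat (chain (fun i => L (row j i)) n) (L (col j n.+1)))
      (cat (L (col j 0)) (chain (fun i => L (row j.+1 i)) n)).
    apply: (hmt_ladder (v := fun i => L (col j i))).
    - by move=> i i_n; split; exact/Lok/okrow.
    - by move=> i i_n; exact/Lok/okcol.
    - move=> i i_n; have i_n1 := ltnW i_n.
      rewrite !L1 ?L0; [|exact: okrow..].
      by rewrite /row clamp0 clamp1 addr0 natr1.
    - move=> i i_n; split; last exact: square.
        rewrite L1 ?L0; [|exact: okcol|exact: okrow].
        by rewrite /row /col clamp0 clamp1 addr0 natr1.
      rewrite L1 ?L0; [|exact: okrow|exact/okcol/leqW].
      by rewrite /row /col clamp0 clamp1 addr0 natr1.
  rewrite (side j n.+1 jn (or_intror erefl)) (side j 0%N jn (or_introl erefl)) mul0r /N divff// => HH.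
  apply: hmt_trans (hmt_sym (hmt_cat1 (pc j jn1) _)) (hmt_trans HH (hmt_1cat (pc _ _) _)) => //.
    by rewrite chain1 L1; [rewrite end1// nuA|exact: okrow].
  by rewrite chain0 L0; [rewrite end0// nuA|exact: okrow].
have whole : hmt Y (chain (fun i => L (row 0 i)) n) (chain (fun i => L (row n.+1 i)) n).
  suff H j : (j <= n.+1)%N -> hmt Y (chain (fun i => L (row 0 i)) n) (chain (fun i => L (row j i)) n).
    exact: H.
  elim: j => [|j IH] jn; first exact/hmt_refl/pc.
  by apply: hmt_trans (IH (ltnW jn)) (step j _).
have edge j (x : R) : j%:R / N = x -> (j <= n.+1)%N -> (forall t, 0 <= t <= 1 -> A (h (x, t))) ->
    hmt Y (fun t => io (h (x, clamp t))) (chain (fun i => L (row j i)) n).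
  move=> jx jn Ax.
  have Yp : pth Y (fun t => io (h (x, clamp t))).
    split=> [|t]; last by case: (Aio _ (Ax _ (clamp_in t))).
    apply: (con_total _ _ cio); last by move=> t; apply: Ax; exact: clamp_in.
    exact: (comp_continuous (comp_continuous clamp_continuous (cpr x)) ch).
  rewrite -(_ : chain (piece (fun t => io (h (x, clamp t))) n) n = chain (fun i => L (row j i)) n).
    exact: hmt_pieces.
  apply: chain_eq => i i_n; rewrite LA; [|exact: okrow|]; last first.
    by move=> t; rewrite /row jx; apply: Ax; exact: grid_in.
  by apply/funext => t; rewrite /piece /row /= jx clampE// grid_in.
apply: hmt_trans (edge 0%N 0 _ _ _) (hmt_trans whole (hmt_sym (edge n.+1 1 _ _ _))) => //.
- by rewrite mul0r.
- by move=> t /hA[].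
- by rewrite divff.
- by move=> t /hA[].
Qed.

End local_to_global.

(** * Replacing paths up to homotopy in a larger space *)

Section path_lifting.
Context {R : realType} {V W : normedModType R}.
Implicit Types (X A Z : set V) (Y : set W) (io : V -> W) (pi : W -> V).

Lemma chain_map (T T' : topologicalType) (F : T -> T') (f : nat -> R -> T) n :
  (fun t => F (chain f n t)) = chain (fun i t => F (f i t)) n.
Proof. by elim: n => //= n IH; rewrite cat_map IH. Qed.

(** The new path lives in [Y], which for [b = false] is only locally path connected over [Z]; the
    homotopy from the old path lives in [X], where small loops contract. Short paths [C x] from the
    old vertices to the projected new ones are the rungs of a ladder. *)
Lemma pth_local_to_global b A X Z Y io pi :
  lcc true X id Z -> lcc b Y pi Z -> con A io -> con Y pi ->
  (forall y, Y y -> X (pi y)) -> (forall x, A x -> Y (io x) /\ pi (io x) = x) ->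
  exists2 eta : R, 0 < eta & forall c : R -> V, pth X c ->
    (forall t, 0 <= t <= 1 -> A (c t) \/ exists2 z, Z z & `|c t - z| < eta) ->
    A (c 0) -> A (c 1) -> exists c' : R -> W,
      [/\ pth Y c', c' 0 = io (c 0), c' 1 = io (c 1) & hmt X c (fun t => pi (c' t))].
Proof.
move=> lX lY cio cpi YX Aio.
(* Three scales: paths over [x2]-balls with common ends are homotopic in [X], points over [x1]-balls
   are joined within x2 / 2, and [d2], which bounds the lifted edges, is the smaller of both. *)
have [x2 x20 x2P] := lX 1 ltr01.
have [x1 x10 x1P] := lX (x2 / 2) (divr_gt0 x20 (ltr0n _ 2)).
pose d2 := Num.min x1 x2; have d20 : 0 < d2 by rewrite lt_min x10.
have d2x1 : d2 <= x1 by rewrite ge_min lexx.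
have d2x2 : d2 <= x2 by rewrite ge_min lexx orbT.
have [e0 e00 lifts] := edge_lifts d20 lY cio Aio.
pose eta := Num.min e0 (d2 / 4).
have eta0 : 0 < eta by rewrite lt_min e00 divr_gt0.
have etad : eta <= d2 / 4 by rewrite ge_min lexx orbT.
have etae : eta <= e0 by rewrite ge_min lexx.
have [nu [L [nuA nuZ LP]]] := lifts eta eta0 etae.
exists (eta / 2); first exact: divr_gt0.
move=> c Xc cAZ A0 A1; have [cc Xc'] := Xc.
pose good (x : V) (a : R -> V) := X x -> A x \/ (exists2 z, Z z & `|x - z| < eta) ->
  [/\ pth X a, a 0 = x, a 1 = pi (nu x), A x -> a = (fun=> x) &
      forall z, Z z -> `|x - z| < eta -> forall t, `|a t - z| < x2].
have /choice[C CP] : forall x, exists a, good x a.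
  move=> x; rewrite /good.
  have [Ax|nAx] := pselect (A x).
    exists (fun=> x) => Xx _; split => //; first exact: pth_cst.
      by rewrite nuA//; case: (Aio x Ax).
    move=> z Zz xz t; lra.
  have [[z0 Zz0 xz0]|nz] := pselect (exists2 z, Z z & `|x - z| < eta); last first.
    by exists (fun=> x) => Xx [].
  have [Xx|nXx] := pselect (X x); last by exists (fun=> x).
  have [Ynu nuz0] := nuZ x z0 Zz0 xz0.
  have [_ H _] := x1P z0 Zz0.
  have [||a [[ca Xa] a0 a1]] := H x (pi (nu x)).
  - by split => //=; lra.
  - by split; [exact: YX|rewrite /=; lra].
  exists a => _ _; split => //; first by split => // t; case: (Xa t).
  move=> z Zz xz t; have [_ /= az0] := Xa t.
  have z0x : `|z0 - x| < eta by rewrite distrC.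
  by have := dist_trans (dist_trans az0 z0x) xz; lra.
have [||n nP] := @fine_grid R V (fun z => c z.2) (eta / 2).
- exact: comp_continuous (@snd_continuous _ _) cc.
- exact: divr_gt0.
pose N : R := n.+1%:R; have N0 : N != 0 by rewrite pnatr_eq0.
pose f i := piece c n i; pose g i := L (f i).
have fi i : (i <= n)%N -> (forall t, A (f i t)) \/
    (exists2 z, Z z & forall t, `|f i t - z| < eta).
  move=> i_n; have [|/existsNP[u nAu]] := pselect (forall t, A (f i t)); first by left.
  right; have := cAZ _ (grid_in u i_n); case=> // -[z Zz uz].
  exists z => // t; have := nP i i i_n i_n 0 t 0 u => /dist_trans - /(_ _ _ uz).
  by rewrite -splitr.
have Xf i : pth X (f i) by exact: pth_piece.
have cf i : continuous (f i) by case: (Xf i).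
have Lf i : (i <= n)%N -> _ := fun i_n => LP (f i) (cf i) (fi i i_n).
pose x_ i := c (i%:R / N).
have f0 i : f i 0 = x_ i by rewrite /f /piece clamp0 addr0.
have f1 i : f i 1 = x_ i.+1 by rewrite /f /piece clamp1 natr1.
have xi i : (i <= n.+1)%N -> A (x_ i) \/ (exists2 z, Z z & `|x_ i - z| < eta).
  move=> i_n; have [||] := cAZ (i%:R / N).
  - by rewrite divr_ge0//= ler_pdivrMr ?ltr0n// mul1r ler_nat.
  - by left.
  - by case=> z Zz xz; right; exists z => //; lra.
pose v i := C (x_ i).
have Cv i : (i <= n.+1)%N -> _ := fun i_n => CP (x_ i) (Xc' _) (xi i i_n).
have v1 i : (i <= n.+1)%N -> v i 1 = pi (nu (x_ i)) by move=> /Cv[].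
have v0 i : (i <= n.+1)%N -> v i 0 = x_ i by move=> /Cv[].
have g0 i : (i <= n)%N -> g i 0 = nu (x_ i) by move=> /Lf[_]; rewrite f0.
have g1 i : (i <= n)%N -> g i 1 = nu (x_ i.+1) by move=> /Lf[_ _]; rewrite f1.
have Xv i : (i <= n.+1)%N -> pth X (v i) by move=> /Cv[].
have Yg i : (i <= n)%N -> pth Y (g i) by move=> /Lf[].
have Xg i : (i <= n)%N -> pth X (fun t => pi (g i t)).
  by move=> /Yg; exact: pth_map.
have Yc' : pth Y (chain g n).
  by apply: pth_chain => // i i_n; rewrite g1 ?g0//; exact: ltnW.
have x0E : x_ 0%N = c 0 by rewrite /x_ mul0r.
have xNE : x_ n.+1 = c 1 by rewrite /x_ divff.
exists (chain g n); split => //.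
- by rewrite chain0 g0// x0E nuA.
- by rewrite chain1 g1// xNE nuA.
apply: hmt_trans (hmt_pieces n Xc) _; rewrite chain_map.
have vcst i : (i <= n.+1)%N -> A (x_ i) -> v i = (fun=> x_ i).
  by move=> /Cv[_ _ _ H _] /H.
have : hmt X (cat (chain f n) (v n.+1)) (cat (v 0%N) (chain (fun i t => pi (g i t)) n)).
  apply: hmt_ladder.
  - by move=> i i_n; split => //; exact: Xg.
  - by [].
  - move=> i i_n; split; first by rewrite f0 f1.
    by rewrite g1 ?g0//; exact: ltnW.
  - move=> i i_n; have i_n' := leqW i_n; split.
    + by rewrite f1 v0.
    + by rewrite v1// g0.
    have [_ _ _ Lio Lz] := Lf i i_n.
    have [Af|[z Zz fz]] := fi i i_n.
      rewrite !vcst//; [|by rewrite -f0|by rewrite -f1].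
      rewrite (_ : (fun t => pi (g i t)) = f i).
        apply: hmt_trans (hmt_cat1 _ _) (hmt_sym (hmt_1cat _ _)) => //.
      by apply/funext => t; rewrite /g Lio//=; case: (Aio _ (Af t)).
    have [_ _ /(_ isT) c1] := x2P z Zz.
    apply: (hmt_sub (Y := over X id z 1)); first by move=> y [].
    have [_ _ _ _ Cz0] := Cv i i_n'.
    have [_ _ _ _ Cz1] := Cv i.+1 i_n.
    have nf : pth (over X id z x2) (f i).
      by split => // t; split; [case: (Xf i)|rewrite /=; have := fz t; lra].
    have nv0 : pth (over X id z x2) (v i).
      have [cv Xv'] := Xv i i_n'; split => // t; split => //=.
      by apply: Cz0 => //; rewrite -f0.
    have nv1 : pth (over X id z x2) (v i.+1).
      have [cv Xv'] := Xv i.+1 i_n; split => // t; split => //=.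
      by apply: Cz1 => //; rewrite -f1.
    have ng : pth (over X id z x2) (fun t => pi (g i t)).
      have [cv Xv'] := Xg i i_n; split => // t; split => //=.
      by have := Lz z Zz fz t; rewrite -/(g i); lra.
    apply: c1.
    - by apply: pth_cat => //; rewrite f1 v0.
    - by apply: pth_cat => //; rewrite v1// g0.
    - by rewrite !cat0 f0 v0.
    - by rewrite !cat1 v1// g1.
rewrite !vcst//; [|by rewrite x0E|by rewrite xNE] => HH.
have Xcf : pth X (chain f n) by apply: pth_chain => // i i_n; rewrite f0 f1.
have Xcg : pth X (chain (fun i t => pi (g i t)) n).
  by apply: pth_chain => // i i_n; rewrite g1 ?g0//; exact: ltnW.
apply: hmt_trans (hmt_sym (hmt_cat1 Xcf _)) (hmt_trans HH (hmt_1cat Xcg _)).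
- by rewrite chain1 f1.
- by rewrite chain0 g0// x0E nuA//; case: (Aio _ A0).
Qed.

End path_lifting.

(** The supremum of the times in [0, 1] at which [P] holds satisfies [P] by the last hypothesis, and
    is not below 1 by the third. *)
Lemma real_induction (R : realType) (P : R -> Prop) :
  P 0 -> (forall s t, 0 <= s -> s <= t -> P t -> P s) ->
  (forall t, 0 <= t -> t < 1 -> P t -> exists2 s, t < s & P s) ->
  (forall t, 0 < t -> t <= 1 -> (forall s, 0 <= s -> s < t -> P s) -> P t) -> P 1.
Proof.
move=> P0 Pd Po Pc.
pose S := [set t : R | 0 <= t <= 1 /\ P t].
have S0 : S 0 by split; rewrite ?lexx ?ler01.
have supS : has_sup S by split; [exists 0|exists 1 => t [/andP[]]].
have m0 : 0 <= sup S by exact: sup_upper_bound.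
have m1 : sup S <= 1 by apply: sup_le_ub; [exists 0|move=> t [/andP[]]].
have Ps s : 0 <= s -> s < sup S -> P s.
  move=> s0 sm; have ms : 0 < sup S - s by rewrite subr_gt0.
  have [t [_ Pt] st] := sup_adherent ms supS.
  by apply: (Pd s t) => //; lra.
have Pm : P (sup S).
  have [m00|m00] := leP (sup S) 0; last exact: Pc.
  by rewrite (_ : sup S = 0)//; apply: le_anti; rewrite m00.
have [m11|m11] := leP 1 (sup S).
  by rewrite (_ : 1 = sup S)//; apply: le_anti; rewrite m11.
have [s ms Psg] := Po _ m0 m11 Pm.
have /(sup_upper_bound supS) : S (Num.min s 1).
  split; last by apply: (Pd _ s) => //; rewrite ?ge_min ?lexx// le_min ler01 andbT; lra.
  by rewrite ge_min lexx orbT andbT le_min ler01 andbT; lra.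
by rewrite ge_min; lra.
Qed.

(** * Sweeping a compact set through a space *)

Section compact_images.
Context {R : realType} {V : normedModType R}.

Lemma closed_image (K : set (R * R)%type) (h : R * R -> V) : compact K -> continuous h ->
  closed (h @` K).
Proof.
move=> cK ch; apply: compact_closed; first exact: norm_hausdorff.
by apply: continuous_compact => //; apply/con_within/continuous_con.
Qed.

Lemma compact_square : compact (`[(0 : R), 1] `*` `[(0 : R), 1]).
Proof. by apply: compact_setX; exact: segment_compact. Qed.

Lemma hmt_compact (Y : set V) (p q : R -> V) : hmt Y p q ->
  exists C, [/\ compact C, closed C, C `<=` Y & hmt C p q].
Proof.
case=> H [cH YH H0 H1 He]; exists (H @` (`[(0 : R), 1] `*` `[(0 : R), 1])); split.
- by apply: continuous_compact compact_square; apply/con_within/continuous_con.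
- exact: closed_image compact_square cH.
- by move=> _ [z _ <-].
have i0 : 0 <= (0 : R) <= 1 by rewrite lexx ler01.
have i1 : 0 <= (1 : R) <= 1 by rewrite lexx ler01.
exists (fun z => H (clamp z.1, clamp z.2)); split => /=.
- apply: comp_continuous cH; apply: pair_continuous.
    exact: (comp_continuous (@fst_continuous _ _) clamp_continuous).
  exact: (comp_continuous (@snd_continuous _ _) clamp_continuous).
- by move=> z; exists (clamp z.1, clamp z.2) => //; split; rewrite /= in_itv /= clamp_in.
- by move=> t t01; rewrite !clampE// H0.
- by move=> t t01; rewrite !clampE// H1.
- by move=> s s01; rewrite !clampE//; exact: He.
Qed.

Lemma pth_compact (Y : set V) (p : R -> V) : pth Y p ->
  exists C, [/\ compact C, closed C, C `<=` Y & pth C (fun t => p (clamp t))].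
Proof.
move=> [cp Yp]; exists ((fun z => p z.2) @` (`[(0 : R), 1] `*` `[(0 : R), 1])); split.
- apply: continuous_compact compact_square; apply/con_within/continuous_con.
  exact: (comp_continuous (@snd_continuous _ _) cp).
- apply: closed_image compact_square _.
  exact: (comp_continuous (@snd_continuous _ _) cp).
- by move=> _ [z _ <-].
split; first exact: (comp_continuous clamp_continuous cp).
by move=> t; exists (0, clamp t) => //; split; rewrite /= in_itv /= ?clamp_in// lexx ler01.
Qed.

End compact_images.

Section sweeping.
Context {R : realType} {U V : normedModType R}.
Context (X Kb : set V) (Q : set U) (g : U -> V) (al be : U -> R).
Context (cQ : compact Q) (cg : con Q g) (cal : con Q al) (cbe : con Q be)
  (be0 : forall q, Q q -> 0 <= be q).
Implicit Types (s t : R) (C : set V).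

(** [Q] is ordered by the ratio al / be, written without division. By time t the part of ratio at
    most t has been swept; [front t] is the part where equality holds. *)
Definition swept t : set V := Kb `|` g @` [set q | Q q /\ al q <= t * be q].

Definition front t : set V := g @` (Q `&` [set q | al q = t * be q]).

Lemma swept_le s t : s <= t -> swept s `<=` swept t.
Proof.
move=> st x [Kx|[q [Qq aq] <-]]; first by left.
right; exists q => //; split => //; apply: le_trans aq _.
exact: ler_wpM2r (be0 Qq) _ _ st.
Qed.

Let level_con t : con Q (fun q => al q - t * be q).
Proof.
move=> q Qq; apply: cvgB; first exact: cal.
by apply: cvgM; [exact: cvg_cst|exact: cbe].
Qed.

Let slack q t : Q q -> al q < t * be q -> exists2 e : R, 0 < e &
  forall q', Q q' -> `|q' - q| < e -> al q' < (t - e) * be q'.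
Proof.
move=> Qq aq; pose m := t * be q - al q; have m0 : 0 < m by rewrite subr_gt0.
have [d d0 dP] := (con_distP _ _).1 (@level_con t) q Qq (m / 2) (divr_gt0 m0 (ltr0n _ 2)).
have [r r0 rP] := (con_distP _ _).1 cbe q Qq 1 ltr01.
have b0 := be0 Qq.
(* Near q one has be q' < be q + 1, so a change of t by at most [k] alters t * be q' by at most m /
   2, half of the slack. *)
pose k := m / 2 / (be q + 1); have k0 : 0 < k by rewrite !divr_gt0//; lra.
have kE : k * (be q + 1) = m / 2 by rewrite /k divfK//; apply/eqP => h; lra.
exists (Num.min (Num.min d r) k); first by rewrite !lt_min d0 r0.
move=> q' Qq'; rewrite !lt_min -andbA => /and3P[/(dP _ Qq') /= + /(rP _ Qq') /= + _].
rewrite !ltr_norml => /andP[h1 h2] /andP[h3 h4].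
set e := Num.min _ _; have ek : e <= k by rewrite ge_min lexx orbT.
have e0 : 0 < e by rewrite /e !lt_min d0 r0.
have : e * be q' <= k * (be q + 1).
  by apply: ler_pM => //; [exact: ltW|exact: be0|lra].
by rewrite kE mulrBl /m in h2 *; lra.
Qed.

Let gap q t : Q q -> t * be q < al q -> exists2 e : R, 0 < e &
  forall q', Q q' -> `|q' - q| < e -> (t + e) * be q' < al q'.
Proof.
move=> Qq aq; pose m := al q - t * be q; have m0 : 0 < m by rewrite subr_gt0.
have [d d0 dP] := (con_distP _ _).1 (@level_con t) q Qq (m / 2) (divr_gt0 m0 (ltr0n _ 2)).
have [r r0 rP] := (con_distP _ _).1 cbe q Qq 1 ltr01.
have b0 := be0 Qq.
pose k := m / 2 / (be q + 1); have k0 : 0 < k by rewrite !divr_gt0//; lra.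
have kE : k * (be q + 1) = m / 2 by rewrite /k divfK//; apply/eqP => h; lra.
exists (Num.min (Num.min d r) k); first by rewrite !lt_min d0 r0.
move=> q' Qq'; rewrite !lt_min -andbA => /and3P[/(dP _ Qq') /= + /(rP _ Qq') /= + _].
rewrite !ltr_norml => /andP[h1 h2] /andP[h3 h4].
set e := Num.min _ _; have ek : e <= k by rewrite ge_min lexx orbT.
have e0 : 0 < e by rewrite /e !lt_min d0 r0.
have : e * be q' <= k * (be q + 1).
  by apply: ler_pM => //; [exact: ltW|exact: be0|lra].
by rewrite kE mulrDl /m in h1 *; lra.
Qed.

(** Where [g] meets [C] the inequality t * be < al is strict and survives a small increase of t;
    elsewhere [g] stays off the closed set [C] locally. Compactness of [Q] gives one increase for
    all points. *)
Lemma swept_open C t : closed C -> C `&` swept t = set0 ->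
  exists2 s, t < s & C `&` swept s = set0.
Proof.
move=> clC Ct.
have [||e e0 eP] := @compact_radius _ _ Q (fun q e => Q q -> (t + e) * be q < al q \/ ~ C (g q)) cQ.
- move=> q e e' e'0 ee h Qq; have [{}h|] := h Qq; [left|by right].
  by apply: le_lt_trans h; apply: ler_wpM2r; [exact: be0|lra].
- move=> q Qq; have [Cq|nCq] := pselect (C (g q)).
    have : t * be q < al q.
      rewrite ltNge; apply/negP => aq.
      by have : (C `&` swept t) (g q); [split => //; right; exists q|rewrite Ct].
    by move=> /(gap Qq)[e e0 eP]; exists e => // q' Qq' q'q; left; exact: eP.
  have : nbhs (g q) (~` C) by apply: open_nbhs_nbhs; split => //; rewrite openC.
  move=> /(cg Qq); rewrite /= nbhs_simpl /= /within /= => /nbhs_dist[e e0 eP].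
  by exists e => // q' Qq' q'q _; right; exact: eP.
exists (t + e); first by lra.
apply/seteqP; split => // x [Cx [Kx|[q [Qq aq] gq]]].
  by have : (C `&` swept t) x; [split => //; left|rewrite Ct].
have [|] := eP q Qq Qq; first by lra.
by rewrite gq.
Qed.

(** A point of [Q] off the front is either swept strictly before t or not yet swept at t; by
    compactness some [s] before t is so late that only points near the front are new. *)
Lemma swept_near t eta : 0 < t -> 0 < eta -> exists2 s, 0 <= s /\ s < t &
  forall x, swept t x -> swept s x \/ exists2 z, front t z & `|x - z| < eta.
Proof.
move=> t0 eta0.
have [||e e0 eP] := @compact_radius _ _ Q (fun q e => Q q -> al q <= t * be q ->
    al q <= (t - e) * be q \/ exists2 z, front t z & `|g q - z| < eta) cQ.
- move=> q e e' e'0 ee h Qq aq; have [{}h|] := h Qq aq; [left|by right].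
  by apply: le_trans h _; apply: ler_wpM2r; [exact: be0|lra].
- move=> q Qq; have [aq|aq|aq] := ltgtP (al q) (t * be q).
  + by have [e e0 eP] := slack Qq aq; exists e => // q' Qq' q'q; left; exact/ltW/eP.
  + have [e e0 eP] := gap Qq aq; exists e => // q' Qq' q'q _ aq'.
    have := eP q' Qq' q'q; have : 0 <= e * be q' by rewrite mulr_ge0 ?be0// ltW.
    by rewrite mulrDl; lra.
  + have [e e0 eP] := (con_distP _ _).1 cg q Qq eta eta0.
    exists e => // q' Qq' q'q _ _; right; exists (g q); last exact: eP.
    by exists q.
exists (Num.max 0 (t - e)).
  by split; [rewrite le_max lexx|rewrite gt_max; lra].
move=> x [Kx|[q [Qq aq] <-]]; first by left; left.
have [aq'|] := eP q Qq Qq aq; last by right.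
left; right; exists q => //; split => //; apply: le_trans aq' _.
by apply: ler_wpM2r; [exact: be0|rewrite le_max lexx orbT].
Qed.

Lemma lcc_front b (Y : set V) t : (forall z, front t z -> lcc b Y id [set z]) ->
  lcc b Y id (front t).
Proof.
move=> loc; apply: lcc_image => //; last by move=> q Qq aq; apply: loc; exists q.
move=> q Qq /= /eqP; rewrite neq_lt => /orP[aq|aq].
  have [e e0 eP] := slack Qq aq; exists e => // q' Qq' /(eP q' Qq') + aq'.
  by have : 0 <= e * be q'; [rewrite mulr_ge0 ?be0// ltW|rewrite aq' mulrBl; lra].
have [e e0 eP] := gap Qq aq; exists e => // q' Qq' /(eP q' Qq') + aq'.
by have : 0 <= e * be q'; [rewrite mulr_ge0 ?be0// ltW|rewrite aq' mulrDl; lra].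
Qed.

Context (b : bool).

Lemma sweep_nonempty :
  (forall t, 0 < t -> t <= 1 -> forall z, front t z -> lcc b (X `\` swept t) id [set z]) ->
  (X `\` swept 0) !=set0 -> (X `\` swept 1) !=set0.
Proof.
move=> loc X0; apply: (@real_induction R (fun t => (X `\` swept t) !=set0)) => //.
- by move=> s t s0 st [x [Xx nx]]; exists x; split => // /(swept_le st).
- move=> t t0 t1 [x [Xx nx]]; have [||s ts xs] := @swept_open [set x] t.
  + by apply: compact_closed; [exact: norm_hausdorff|exact: compact_set1].
  + by apply/seteqP; split => // y [-> ?].
  exists s => //; exists x; split => // xs'.
  by have : ([set x] `&` swept s) x; [split|rewrite xs].
- move=> t t0 t1 IH; have [s [s0 st] sP] := swept_near t0 ltr01.
  have [x [Xx nx]] := IH s s0 st; have [xt|] := pselect (swept t x); last by exists x.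
  have [//|[z fz _]] := sP x xt.
  by have [d d0 /(_ z erefl)[[y [? _]] _ _]] := loc t t0 t1 z fz 1 ltr01; exists y.
Qed.

(** Real induction on time. The compact trace of the homotopy stays disjoint from what is swept
    slightly after t. At a limit time, the homotopy found for an earlier s meets the newly swept
    part only near the front, where [hmt_local_to_global] repairs it and keeps [p] and [q], which
    avoid the final set. *)
Lemma sweep_hmt :
  (forall t, 0 < t -> t <= 1 -> forall z, front t z -> lcc true (X `\` swept t) id [set z]) ->
  forall p q : R -> V, pth (X `\` swept 1) p -> pth (X `\` swept 1) q ->
  hmt (X `\` swept 0) p q -> hmt (X `\` swept 1) p q.
Proof.
move=> loc p q Yp Yq h; apply: (@real_induction R (fun t => hmt (X `\` swept t) p q)) => //.
- by move=> s t s0 st; apply: hmt_sub => x [Xx nx]; split => // /(swept_le st).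
- move=> t t0 t1 /hmt_compact.
  case=> C [_ clC CX hC].
  have [|s ts Cs] := @swept_open C t clC.
    by apply/seteqP; split => // y [/CX[]].
  exists s => //; apply: hmt_sub hC => x Cx; split; first by case: (CX x Cx).
  by move=> xs; have : (C `&` swept s) x; [split|rewrite Cs].
- move=> t t0 t1 IH; pose Y := X `\` swept t.
  have idY x : Y x -> Y x /\ x = x by [].
  have [eta eta0 etaP] := hmt_local_to_global (lcc_front (loc t t0 t1))
    (continuous_con (A := Y) (fun x => @cvg_id _ (nbhs x))) idY.
  have [s [s0 st] sP] := swept_near t0 eta0.
  have [C [_ _ CX [H [cH CH H0 H1 He]]]] := hmt_compact (IH s s0 st).
  have in0 : 0 <= (0 : R) <= 1 by rewrite lexx ler01.
  have [e0 e1] := hmt_ends (IH s s0 st).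
  have Y1 x : (X `\` swept 1) x -> Y x.
    by move=> [Xx nx]; split => // /(swept_le t1).
  have Yp' := pth_sub Y1 Yp; have Yq' := pth_sub Y1 Yq.
  apply: hmt_clamp2 => //.
  have := etaP H cH; rewrite (_ : (fun u => H (0, clamp u)) = (fun u => p (clamp u))); last first.
    by apply/funext => u; rewrite H0// clamp_in.
  rewrite (_ : (fun u => H (1, clamp u)) = (fun u => q (clamp u))); last first.
    by apply/funext => u; rewrite H1// clamp_in.
  apply.
  + move=> u v _ _; have [Xh nh] := CX _ (CH (u, v)).
    have [ht|] := pselect (swept t (H (u, v))); last by left.
    by have [//|] := sP _ ht; right.
  + by move=> u u01; have [-> ->] := He u u01; have [-> ->] := He 0 in0.
  + by move=> u u01; rewrite H0// H1//; split; [case: Yp'|case: Yq'].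
Qed.

(** As for homotopies, but each repair changes the path. The accumulated change is a homotopy in
    [X'], which is locally simply connected at the front even when [b] is false. *)
Lemma sweep_pth (X' : set V) : X `<=` X' ->
  (forall t, 0 < t -> t <= 1 -> forall z, front t z ->
     lcc b (X `\` swept t) id [set z] /\ lcc true X' id [set z]) ->
  forall p : R -> V, pth (X `\` swept 0) p -> (X `\` swept 1) (p 0) -> (X `\` swept 1) (p 1) ->
  exists p', [/\ pth (X `\` swept 1) p', p' 0 = p 0, p' 1 = p 1 & hmt X' p p'].
Proof.
move=> XX loc p Yp p0 p1.
apply: (@real_induction R (fun t => exists p',
  [/\ pth (X `\` swept t) p', p' 0 = p 0, p' 1 = p 1 & hmt X' p p'])).
- exists p; split => //; apply: hmt_refl; apply: pth_sub Yp => x [Xx _]; exact: XX.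
- move=> s t s0 st [p' [Yp' e0 e1 h]]; exists p'; split => //.
  by apply: pth_sub Yp' => x [Xx nx]; split => // /(swept_le st).
- move=> t t0 t1 [p' [Yp' e0 e1 h]]; have [C [_ clC CX hC]] := pth_compact Yp'.
  have [|s ts Cs] := @swept_open C t clC.
    by apply/seteqP; split => // y [/CX[]].
  exists s => //; exists (fun u => p' (clamp u)); split; rewrite ?clamp0 ?clamp1//.
    apply: pth_sub hC => x Cx; split; first by case: (CX x Cx).
    by move=> xs; have : (C `&` swept s) x; [split|rewrite Cs].
  apply: hmt_trans h _; apply: hmt_clamp.
  by apply: pth_sub Yp' => x [Xx _]; exact: XX.
- move=> t t0 t1 IH; pose Y := X `\` swept t.
  have idY x : Y x -> Y x /\ x = x by [].
  have cid (A : set V) : con A id by apply: continuous_con => x; exact: cvg_id.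
  have YX' x : Y x -> X' x by move=> [Xx _]; exact: XX.
  have l1 : lcc b Y id (front t) by apply: lcc_front => z /(loc t t0 t1)[].
  have l2 : lcc true X' id (front t) by apply: lcc_front => z /(loc t t0 t1)[].
  have [eta eta0 etaP] := pth_local_to_global l2 l1 (cid Y) (cid Y) YX' idY.
  have [s [s0 st] sP] := swept_near t0 eta0.
  have [p' [Yp' e0 e1 h]] := IH s s0 st.
  have Y1 x : (X `\` swept 1) x -> Y x.
    by move=> [Xx nx]; split => // /(swept_le t1).
  have [||||c' [Yc c0 c1 hc]] := etaP p'.
  + by apply: pth_sub Yp' => x [Xx _]; exact: XX.
  + move=> u _; case: Yp' => _ /(_ u)[Xh nh].
    have [ht|] := pselect (swept t (p' u)); last by left.
    by have [//|] := sP _ ht; right.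
  + by rewrite e0; exact: Y1.
  + by rewrite e1; exact: Y1.
  exists c'; split => //; [by rewrite c0|by rewrite c1|exact: hmt_trans hc].
Qed.

End sweeping.

(** * Polyhedral cones and tangent cones *)

Section polyhedral_maps.
Context {R : realType} {V W : normedModType R}.
Implicit Types (D : set V) (g h : V -> W) (q v : V) (r l : R).

(** Membership passes from a shorter multiple of [v] to [v]; together with convexity, [D] agrees
    near [q] with its tangent cone. *)
Definition conic_at D q r := forall v l, `|v| < r -> 0 < l -> l <= 1 ->
  D (q + l *: v) -> D (q + v).

(** The features of a convex polyhedron that are used, in a form inherited by tangent cones and
    quotients without a list of inequalities. *)
Definition polyh D := [/\ closed D,
  forall x y l, D x -> D y -> 0 <= l -> l <= 1 -> D (x + l *: (y - x)) &
  forall q, D q -> exists2 r, 0 < r & conic_at D q r].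

Definition radial_at D g q r := forall v l, `|v| < r -> D (q + v) -> 0 <= l -> l <= 1 ->
  g (q + l *: v) = g q + l *: (g (q + v) - g q).

(* Being radial near every point replaces piecewise linearity, so that no triangulation has to
   be carried along. *)
Definition embed D g := [/\ con D g,
  forall x y, D x -> D y -> g x = g y -> x = y &
  forall q, D q -> exists2 r, 0 < r & radial_at D g q r].

Definition cone D := D 0 /\ forall k x, 0 <= k -> D x -> D (k *: x).

Definition homog D g := forall k x, 0 <= k -> D x -> g (k *: x) = k *: g x.

(** The tangent cone. No closure is taken: as a [polyh] set is conical near [q], this union of
    dilates is already closed. *)
Definition tan D q : set V := [set v | exists2 l, 0 < l & D (q + l *: v)].

Lemma embed_sub D D' g : D' `<=` D -> embed D g -> embed D' g.
Proof.
move=> DD [cg ig rg]; split; first exact: con_sub cg.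
  by move=> x y /DD Dx /DD Dy; exact: ig.
move=> q /DD Dq; have [r r0 rP] := rg q Dq; exists r => // v l vr /DD Dv.
exact: rP.
Qed.

Lemma homog0 D g : cone D -> homog D g -> g 0 = 0.
Proof. by move=> [D0 _] hg; have := hg 0 0 (lexx _) D0; rewrite !scale0r. Qed.

Lemma cone_add D x y : polyh D -> cone D -> D x -> D y -> D (x + y).
Proof.
move=> [_ cD _] [_ sD] Dx Dy.
have /(sD 2 _ (ler0n _ _)) : D (x + 2^-1 *: (y - x)) by apply: cD => //; lra.
rewrite scalerDr scalerA divff// scale1r scaler_nat mulr2n.
by rewrite (_ : x + x + (y - x) = x + y)// addrACA subrr addr0 // addrA subrK addrC.
Qed.

Lemma homog_embed0 D g x : cone D -> homog D g -> embed D g -> D x -> g x = 0 -> x = 0.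
Proof.
by move=> cD hg [_ ig _] Dx gx; apply: ig => //; [case: cD|rewrite gx (homog0 cD hg)].
Qed.

Lemma polyhI D D' : polyh D -> polyh D' -> polyh (D `&` D').
Proof.
move=> [cD vD nD] [cD' vD' nD']; split; first exact: closedI.
  by move=> x y l [? ?] [? ?] ? ?; split; [exact: vD|exact: vD'].
move=> q [Dq Dq']; have [r r0 rP] := nD q Dq; have [r' r0' rP'] := nD' q Dq'.
exists (Num.min r r'); first by rewrite lt_min r0.
move=> v l; rewrite lt_min => /andP[vr vr'] l0 l1 [? ?].
by split; [exact: rP l0 l1 _|exact: rP' l0 l1 _].
Qed.

Section derivative.
Context (D : set V) (g : V -> W) (q : V) (r : R) (r0 : 0 < r).
Context (pD : polyh D) (eg : embed D g) (Dq : D q).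
Context (cr : conic_at D q r) (rr : radial_at D g q r).

(** A positive scale, continuous in [v], that brings [v] into the ball of radius [r]. It makes [der]
    continuous by its formula; since [g] is radial at [q], any other small scale gives the same
    value ([derE]). *)
Let sc v : R := (r / 2) / (1 + `|v|).

Let n1 v : 0 < 1 + `|v|. Proof. by rewrite ltr_wpDr. Qed.

Let sc0 v : 0 < sc v. Proof. by rewrite !divr_gt0. Qed.

Let scr v : `|sc v *: v| < r.
Proof.
rewrite normrZ gtr0_norm// /sc mulrAC ltr_pdivrMr//.
have : 0 <= r * `|v| by rewrite mulr_ge0// ltW.
by rewrite mulrDr mulr1 mulrAC; move: (r * `|v|) r0 => m; lra.
Qed.

Let sc_cts : continuous sc.
Proof.
move=> v; apply: cvgM; first exact: cvg_cst.
apply: cvgV; first by rewrite gt_eqF.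
by apply: cvgD; [exact: cvg_cst|exact: norm_continuous].
Qed.

Let move_cts : continuous (fun v => q + sc v *: v).
Proof. by move=> v; apply: cvgD; [exact: cvg_cst|apply: cvgZ; [exact: sc_cts|exact: cvg_id]]. Qed.

Definition der v : W := (sc v)^-1 *: (g (q + sc v *: v) - g q).

Let small v v' : exists2 c : R, 0 < c & `|c *: v| < r /\ `|c *: v'| < r.
Proof.
exists (Num.min (sc v) (sc v')); first by rewrite lt_min !sc0.
have m0 : 0 < Num.min (sc v) (sc v') by rewrite lt_min !sc0.
split.
  apply: le_lt_trans (scr v); rewrite !normrZ ler_wpM2r//.
  by rewrite !gtr0_norm// ge_min lexx.
apply: le_lt_trans (scr v'); rewrite !normrZ ler_wpM2r//.
by rewrite !gtr0_norm// ge_min lexx orbT.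
Qed.

Lemma tanE v : `|v| < r -> tan D q v <-> D (q + v).
Proof.
move=> vr; split=> [[l l0 Dl]|Dv]; last by exists 1; rewrite ?scale1r.
have [l1|l1] := leP l 1; first exact: cr l0 l1 Dl.
have [_ vD _] := pD.
have := vD q _ l^-1 Dq Dl; rewrite invr_ge0 ltW// invf_le1// ltW// => /(_ isT isT).
by rewrite addrAC subrr add0r scalerA mulVf ?gt_eqF// scale1r.
Qed.

Lemma tanZ k v : 0 < k -> tan D q (k *: v) <-> tan D q v.
Proof.
move=> k0; split=> -[l l0 Dl].
  by exists (l * k); [rewrite mulr_gt0|rewrite -scalerA].
exists (l / k); first by rewrite divr_gt0.
by rewrite scalerA divfK ?gt_eqF.
Qed.

Let tanP c v : 0 < c -> `|c *: v| < r -> tan D q v <-> D (q + c *: v).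
Proof. by move=> c0 cv; rewrite -(tanE cv) tanZ. Qed.

Lemma cone_tan : cone (tan D q).
Proof.
have T0 : tan D q 0 by exists 1 => //; rewrite scaler0 addr0.
split=> // k x; rewrite le_eqVlt => /orP[/eqP <-|k0] Tx; first by rewrite scale0r.
by rewrite tanZ.
Qed.

Lemma polyh_tan : polyh (tan D q).
Proof.
have [cD vD nD] := pD; split.
- rewrite (_ : tan D q = (fun v => q + sc v *: v) @^-1` D); last first.
    by apply/seteqP; split => v /=; rewrite (tanP (sc0 v) (scr v)).
  by apply: closed_comp cD => v _; exact: move_cts.
- move=> x y l Tx Ty l0 l1; have [c c0 [cx cy]] := small x y.
  rewrite -(tanZ _ c0); rewrite scalerDr scalerA mulrC -scalerA scalerBr.
  have := vD _ _ l ((tanP c0 cx).1 Tx) ((tanP c0 cy).1 Ty) l0 l1.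
  rewrite opprD addrACA subrr add0r -addrA => Dl.
  by exists 1 => //; rewrite scale1r.
- move=> v0 Tv0; have [c c0 [cv _]] := small v0 v0.
  have [s s0 sP] := nD _ ((tanP c0 cv).1 Tv0).
  pose m := Num.min s (r - `|c *: v0|).
  have m0 : 0 < m by rewrite lt_min s0 subr_gt0.
  exists (m / c); first by rewrite divr_gt0.
  move=> v l vm l0 l1 Tl; exists c => //.
  have cvm : `|c *: v| < m by rewrite normrZ gtr0_norm// mulrC -ltr_pdivlMr.
  have /andP[cvs cvr] : (`|c *: v| < s) && (`|c *: v| < r - `|c *: v0|) by rewrite -lt_min.
  rewrite scalerDr addrA; apply: (sP _ l) => //.
  have cl : `|c *: (v0 + l *: v)| < r.
    rewrite scalerDr (le_lt_trans (ler_normD _ _))//.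
    have : `|c *: (l *: v)| <= `|c *: v|.
      by rewrite !normrZ (gtr0_norm l0) ler_wpM2l// ler_piMl.
    by lra.
  by have := (tanP c0 cl).1 Tl; rewrite scalerDr scalerA (mulrC c) -scalerA addrA.
Qed.

Lemma derE c v : 0 < c -> `|c *: v| < r -> tan D q v ->
  der v = c^-1 *: (g (q + c *: v) - g q).
Proof.
have H c1 c2 : 0 < c1 -> c1 <= c2 -> `|c2 *: v| < r -> tan D q v ->
    c1^-1 *: (g (q + c1 *: v) - g q) = c2^-1 *: (g (q + c2 *: v) - g q).
  move=> c10 c12 c2r Tv; have c20 : 0 < c2 by exact: lt_le_trans c12.
  have k0 : 0 <= c1 / c2 by rewrite divr_ge0// ltW.
  have k1 : c1 / c2 <= 1 by rewrite ler_pdivrMr// mul1r.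
  have := rr c2r ((tanP c20 c2r).1 Tv) k0 k1.
  rewrite scalerA divfK ?gt_eqF// => ->.
  by rewrite addrAC subrr add0r scalerA mulrA mulVf ?gt_eqF// mul1r.
move=> c0 cvr Tv; have [cs|/ltW sc'] := leP c (sc v).
  by rewrite /der -(H c)//; exact: scr.
by rewrite /der (H _ c).
Qed.

Lemma der_eq v : D (q + v) -> `|v| < r -> g (q + v) = g q + der v.
Proof.
move=> Dv vr; rewrite (@derE 1)//; last 2 first.
- by rewrite scale1r.
- exact/(tanE vr).
by rewrite invr1 !scale1r [RHS]addrC subrK.
Qed.

Lemma der_homog : homog (tan D q) der.
Proof.
move=> k x; rewrite le_eqVlt => /orP[/eqP <-|k0] Tx.
  by rewrite !scale0r /der scaler0 addr0 subrr scaler0.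
have [c c0 [cx ckx]] := small x (k *: x).
rewrite (derE c0 ckx); last by rewrite tanZ.
have ck : 0 < c * k by rewrite mulr_gt0.
rewrite (derE ck)//; last by rewrite -scalerA.
rewrite [RHS]scalerA (_ : k * (c * k)^-1 = c^-1) ?[c *: (k *: x)]scalerA//.
by rewrite invfM mulrCA divff ?gt_eqF// mulr1.
Qed.

Lemma embed_der : embed (tan D q) der.
Proof.
have [cg ig rg] := eg; split.
- move=> v Tv; apply: cvgZ.
    apply: cvgV; first by rewrite gt_eqF.
    exact: (continuous_con sc_cts).
  apply: cvgB; last exact: cvg_cst.
  apply: (con_comp (B := D) _ _ cg (x := v)) => //.
    by move=> x; rewrite (tanP (sc0 x) (scr x)).
  exact: continuous_con.
- move=> x y Tx Ty; have [c c0 [cx cy]] := small x y.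
  rewrite (derE c0 cx)// (derE c0 cy)// => /(congr1 (fun w => c *: w)).
  rewrite !scalerA divff ?gt_eqF// !scale1r => /addIr /ig.
  move=> /(_ ((tanP c0 cx).1 Tx) ((tanP c0 cy).1 Ty)) /addrI /(congr1 (fun w => c^-1 *: w)).
  by rewrite !scalerA mulVf ?gt_eqF// !scale1r.
- move=> v0 Tv0; have [c c0 [cv _]] := small v0 v0.
  have D0 := (tanP c0 cv).1 Tv0.
  have [s s0 sP] := rg _ D0.
  pose m := Num.min s (r - `|c *: v0|).
  have m0 : 0 < m by rewrite lt_min s0 subr_gt0.
  exists (m / c); first by rewrite divr_gt0.
  move=> v l vm Tv l0 l1.
  have cvm : `|c *: v| < m by rewrite normrZ gtr0_norm// mulrC -ltr_pdivlMr.
  have /andP[cvs cvr] : (`|c *: v| < s) && (`|c *: v| < r - `|c *: v0|) by rewrite -lt_min.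
  have lv k : 0 <= k -> k <= 1 -> `|c *: (v0 + k *: v)| < r.
    move=> k0 k1; rewrite scalerDr (le_lt_trans (ler_normD _ _))//.
    have : `|c *: (k *: v)| <= `|c *: v|.
      by rewrite !normrZ (ger0_norm k0) ler_wpM2l// ler_piMl.
    by lra.
  have l1' : `|c *: (v0 + v)| < r by have := lv 1; rewrite scale1r; apply; rewrite ?ler01.
  have Tl : tan D q (v0 + l *: v).
    have [_ vT _] := polyh_tan; have := vT _ _ _ Tv0 Tv l0 l1.
    by rewrite addrAC subrr add0r.
  rewrite (derE c0 (lv l l0 l1))// (derE c0 cv)// (derE c0 l1')//.
  have E1 : q + c *: (v0 + l *: v) = (q + c *: v0) + l *: (c *: v).
    by rewrite scalerDr scalerA (mulrC c) -scalerA addrA.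
  have E2 : q + c *: (v0 + v) = (q + c *: v0) + c *: v by rewrite scalerDr addrA.
  have := (tanP c0 l1').1 Tv; rewrite E1 E2 => Dcv; rewrite (sP _ l)//.
  rewrite -scalerBr opprB addrA subrK scalerA (mulrC l) -scalerA -scalerDr.
  by congr (_ *: _); rewrite addrAC.
Qed.

End derivative.

Lemma tangent D g q : polyh D -> embed D g -> D q -> exists (h : V -> W) r,
  [/\ 0 < r, polyh (tan D q) /\ cone (tan D q), embed (tan D q) h, homog (tan D q) h &
   forall v, `|v| < r -> (tan D q v <-> D (q + v)) /\ (D (q + v) -> g (q + v) = g q + h v)].
Proof.
move=> pD eg Dq; have [_ _ nD] := pD; have [_ _ rg] := eg.
have [r1 r10 c1] := nD q Dq; have [r2 r20 c2] := rg q Dq.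
pose r := Num.min r1 r2; have r0 : 0 < r by rewrite lt_min r10.
have cr : conic_at D q r by move=> v l; rewrite lt_min => /andP[v1 _]; exact: c1.
have rr : radial_at D g q r by move=> v l; rewrite lt_min => /andP[_ v1]; exact: c2.
exists (der g q r), r; split=> //.
- by split; [apply: (polyh_tan r0)|apply: cone_tan].
- exact: embed_der.
- exact: der_homog.
- move=> v vr; split; first exact: tanE cr _ vr.
  by move=> Dv; apply: (der_eq r0 pD Dq cr rr).
Qed.

End polyhedral_maps.

Section linear_maps.
Context {R : realType}.

Definition lin (V W : normedModType R) (f : V -> W) :=
  forall k x y, f (k *: x + y) = k *: f x + f y.

Context {V W : normedModType R} (f : V -> W) (lf : lin f).

Lemma lin0 : f 0 = 0.
Proof. by have := lf (-1) 0 0; rewrite scaler0 addr0 scaleN1r addNr. Qed.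

Lemma linD x y : f (x + y) = f x + f y.
Proof. by have := lf 1 x y; rewrite !scale1r. Qed.

Lemma linZ k x : f (k *: x) = k *: f x.
Proof. by have := lf k x 0; rewrite !addr0 lin0 addr0. Qed.

Lemma linB x y : f (x - y) = f x - f y.
Proof. by rewrite -scaleN1r linD linZ scaleN1r. Qed.

End linear_maps.

Section rows.
Context {R : realType}.

Lemma scaleRE (k x : R) : k *: (x : (R : normedModType R)) = k * x.
Proof. by []. Qed.

Lemma coord_cts n (i : 'I_n) : continuous (fun x : 'rV[R]_n => x 0 i).
Proof. by move=> x; exact: coord_continuous. Qed.

Lemma scale_cts (T : topologicalType) (W : normedModType R) (k : T -> R) (f : T -> W) :
  continuous k -> continuous f -> continuous (fun x => k x *: f x).
Proof. by move=> ck cf x; apply: cvgZ; [exact: ck|exact: cf]. Qed.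

Lemma add_cts (T : topologicalType) (W : normedModType R) (f g : T -> W) :
  continuous f -> continuous g -> continuous (fun x => f x + g x).
Proof. by move=> cf cg x; apply: cvgD; [exact: cf|exact: cg]. Qed.

Lemma sub_cts (T : topologicalType) (W : normedModType R) (f g : T -> W) :
  continuous f -> continuous g -> continuous (fun x => f x - g x).
Proof. by move=> cf cg x; apply: cvgB; [exact: cf|exact: cg]. Qed.

Lemma sum_cts (T : topologicalType) (W : normedModType R) (I : Type) (s : seq I)
    (F : I -> T -> W) :
  (forall i, continuous (F i)) -> continuous (fun x => \sum_(i <- s) F i x).
Proof.
move=> cF; elim: s => [|i s IH].
  have -> : (fun x => \sum_(i <- [::]) F i x) = (fun=> 0).
    by apply/funext => x; rewrite big_nil.
  exact: cst_continuous.
have -> : (fun x => \sum_(i <- i :: s) F i x) = (fun x => F i x + \sum_(i <- s) F i x).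
  by apply/funext => x; rewrite big_cons.
exact: add_cts.
Qed.

Lemma lin_cts n (W : normedModType R) (f : 'rV[R]_n -> W) : lin f -> continuous f.
Proof.
move=> lf; have -> : f = (fun x => \sum_(i < n) x 0 i *: f (delta_mx 0 i)).
  apply/funext => x; rewrite {1}(row_sum_delta x).
  elim/big_rec2: _ => [|i y z _ <-]; first exact: lin0.
  by rewrite lf.
apply: (sum_cts (F := fun i (x : 'rV[R]_n) => x 0 i *: f (delta_mx 0 i))) => i.
by apply: scale_cts; [exact: coord_cts|exact: cst_continuous].
Qed.

Lemma compact_rows n (A : set 'rV[R]_n) (M : R) : closed A ->
  (forall x, A x -> `|x| <= M) -> compact A.
Proof.
move=> cA bA; apply: bounded_closed_compact => //.
exists M; split; first exact: num_real.
by move=> N MN x /bA /le_trans; apply; exact: ltW.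
Qed.

Lemma closed_norm (V : normedModType R) (r : R) : closed [set x : V | `|x| <= r].
Proof.
rewrite (_ : [set x | _] = (fun x => `|x|) @^-1` [set y | y <= r])//.
by apply: closed_comp; [move=> x _; exact: norm_continuous|exact: closed_le].
Qed.

Lemma closed_sphere (V : normedModType R) (r : R) : closed [set x : V | `|x| = r].
Proof.
rewrite (_ : [set x | _] = (fun x => `|x|) @^-1` [set y | y = r])//.
by apply: closed_comp; [move=> x _; exact: norm_continuous|exact: closed_eq].
Qed.

Lemma closed_far (V : normedModType R) (q : V) (r : R) : closed [set x : V | r <= `|x - q|].
Proof.
rewrite (_ : [set x | _] = (fun x => `|x - q|) @^-1` [set y | r <= y])//.
apply: closed_comp; last exact: closed_ge.
move=> x _; apply: (continuous_comp (f := fun x => x - q)); last exact: norm_continuous.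
by apply: cvgB; [exact: cvg_id|exact: cvg_cst].
Qed.

Lemma compact_con_image (V W : normedModType R) (K : set V) (g : V -> W) :
  compact K -> con K g -> compact (g @` K).
Proof. by move=> cK cg; apply: continuous_compact => //; exact/con_within. Qed.

Lemma compact_closed_image (V W : normedModType R) (K : set V) (g : V -> W) :
  compact K -> con K g -> closed (g @` K).
Proof.
by move=> cK cg; apply: compact_closed; [exact: norm_hausdorff|exact: compact_con_image].
Qed.

(** Continuity of the inverse at g q: the part of [K] at distance at least [r] from [q] has a
    compact image, which misses g q. *)
Lemma proper_compact (V W : normedModType R) (K : set V) (g : V -> W) q (r : R) :
  compact K -> con K g -> (forall x y, K x -> K y -> g x = g y -> x = y) -> K q -> 0 < r ->
  exists2 r' : R, 0 < r' & forall x, K x -> `|g x - g q| < r' -> `|x - q| < r.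
Proof.
move=> cK cg ig Kq r0; pose K' := K `&` [set x | r <= `|x - q|].
have cK' : compact K' by apply: compact_closedI => //; exact: closed_far.
have clK' : closed (g @` K').
  by apply: compact_closed_image => //; apply: con_sub cg => x [].
have : nbhs (g q) (~` (g @` K')).
  apply: open_nbhs_nbhs; split; first by rewrite openC.
  move=> [x [Kx /= rx] gx]; have /(ig _ _ Kx Kq) xq := gx.
  by move: rx; rewrite xq subrr normr0 leNgt r0.
move=> /nbhs_dist[e e0 eP]; exists e => // x Kx /eP nx.
by rewrite ltNge; apply/negP => rx; apply: nx; exists x.
Qed.

Section cones.
Context {n : nat} {W : normedModType R} {T : set 'rV[R]_n} {h : 'rV[R]_n -> W}.
Context (pT : polyh T) (cT : cone T) (eh : embed T h) (hh : homog T h).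

(** [c] is the minimum of |h| over the unit vectors of [T], positive by injectivity; homogeneity
    extends the bound. *)
Lemma cone_lower : exists2 c : R, 0 < c & forall x, T x -> c * `|x| <= `|h x|.
Proof.
have [clT _ _] := pT; have [ch ih _] := eh; have [T0 sT] := cT.
pose S := T `&` [set x | `|x| = 1].
have cS : compact S.
  by apply: (@compact_rows _ _ 1) => [|x [_ /= ->]//]; apply: closedI => //; exact: closed_sphere.
have nrm x : T x -> x != 0 -> S (`|x|^-1 *: x).
  move=> Tx x0; split; first by apply: sT; rewrite ?invr_ge0.
  by rewrite /= normrZ normfV normr_id mulVf// normr_eq0.
have [S0|/set0P S0] := eqVneq S set0.
  exists 1 => // x Tx; rewrite mul1r; have [->|x0] := eqVneq x 0; first by rewrite normr0.
  by have := nrm x Tx x0; rewrite S0.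
have [|c] := @compact_EVT_min _ _ (fun x => `|h x|) S S0 cS.
  apply/con_within; apply: (con_comp (B := setT)) => //.
    by apply: con_sub ch => x [].
  exact/continuous_con/norm_continuous.
rewrite inE => -[Tc /= c1] cmin.
exists `|h c|.
  rewrite normr_gt0; apply/eqP => hc.
  by move: c1; rewrite (homog_embed0 cT hh eh Tc hc) normr0 => /esym/eqP; rewrite oner_eq0.
move=> x Tx; have [->|x0] := eqVneq x 0; first by rewrite normr0 mulr0.
have xp : 0 < `|x| by rewrite normr_gt0.
have := cmin (`|x|^-1 *: x); rewrite inE => /(_ (nrm x Tx x0)).
by rewrite hh ?invr_ge0// normrZ normfV normr_id mulrC ler_pdivlMr.
Qed.

Let bounded_preimage (M : R) : exists r : R, forall x, T x -> `|h x| <= M -> `|x| <= r.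
Proof.
have [c c0 cP] := cone_lower; exists (M / c) => x Tx hx.
by rewrite ler_pdivlMr// mulrC (le_trans (cP x Tx)).
Qed.

Let compact_part (r : R) : compact (T `&` [set x | `|x| <= r]).
Proof.
have [clT _ _] := pT.
by apply: (@compact_rows _ _ r) => [|x []//]; apply: closedI => //; exact: closed_norm.
Qed.

(** By [cone_lower] only a compact part of [T] is mapped near [y]. *)
Lemma cone_image_closed : closed (h @` T).
Proof.
move=> y cy; have [r rP] := bounded_preimage (`|y| + 1).
have [ch ih _] := eh.
have : closed (h @` (T `&` [set x | `|x| <= r])).
  by apply: compact_closed_image => //; apply: con_sub ch => x [].
move=> /(_ y); case; last by move=> x [Tx _] <-; exists x.
move=> B By; have /cy [_ [[x Tx <-] [Bx yx]]] : nbhs y (B `&` [set z | `|z - y| < 1]).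
  by apply: filterI => //; apply/nbhs_dist; exists 1.
exists (h x); split => //; exists x => //; split => //=; apply: rP => //.
rewrite -[h x](subrK y) (le_trans (ler_normD _ _))// addrC lerD2l.
exact: ltW.
Qed.

Lemma proper_cone q (r : R) : T q -> 0 < r ->
  exists2 r' : R, 0 < r' & forall x, T x -> `|h x - h q| < r' -> `|x - q| < r.
Proof.
move=> Tq r0; have [M MP] := bounded_preimage (`|h q| + 1).
have [ch ih _] := eh.
have [|||e e0 eP] := @proper_compact _ _ (T `&` [set x | `|x| <= M]) h q r (@compact_part M) _ _ _ r0.
- by apply: con_sub ch => x [].
- by move=> x y [Tx _] [Ty _]; exact: ih.
- by split => //=; apply: MP => //; rewrite lerDl.
exists (Num.min e 1); first by rewrite lt_min e0 ltr01.
move=> x Tx; rewrite lt_min => /andP[xe x1]; apply: eP => //; split => //=.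
apply: MP => //; rewrite -[h x](subrK (h q)) (le_trans (ler_normD _ _))// addrC lerD2l.
exact: ltW.
Qed.

End cones.

(** Properness excludes points of [D] far from [q] whose values are close to g q, so the image of
    [D] near g q is that of the tangent cone under the derivative. *)
Lemma germ n (W : normedModType R) (D : set 'rV[R]_n) (g : 'rV[R]_n -> W) q :
  polyh D -> embed D g -> D q ->
  (forall r : R, 0 < r -> exists2 r' : R, 0 < r' &
     forall x, D x -> `|g x - g q| < r' -> `|x - q| < r) ->
  exists h (r : R), [/\ 0 < r, polyh (tan D q) /\ cone (tan D q),
    embed (tan D q) h /\ homog (tan D q) h,
    forall v, `|v| < r -> (tan D q v <-> D (q + v)) /\ (D (q + v) -> g (q + v) = g q + h v) &
    forall y, `|y| < r -> (g @` D) (g q + y) <-> (h @` tan D q) y].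
Proof.
move=> pD eg Dq prop; have [h [r [r0 [pT cT] eh hh hP]]] := tangent pD eg Dq.
have [c c0 cP] := cone_lower pT cT eh hh.
have [r' r'0 r'P] := prop r r0.
(* [r] is where the expansion of [g] holds, [r'] forces preimages close to [q], and c * r makes a
   tangent vector short when its image is. *)
pose m := Num.min r (Num.min r' (c * r)).
have m0 : 0 < m by rewrite !lt_min r0 r'0 mulr_gt0.
have mr : m <= r by rewrite ge_min lexx.
have mr' : m <= r' by rewrite !ge_min lexx orbT.
have mc : m <= c * r by rewrite !ge_min lexx !orbT.
exists h, m; split => //; first by move=> v vm; apply: hP; exact: lt_le_trans mr.
move=> y ym; split=> [[x Dx gx]|[v Tv hv]].
  have xq : `|x - q| < r by apply: r'P => //; rewrite gx addrC addKr; exact: lt_le_trans mr'.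
  exists (x - q).
    by apply/(hP _ xq).1; rewrite addrC subrK.
  have := (hP _ xq).2; rewrite addrC subrK => /(_ Dx).
  by rewrite gx => /addrI.
have vr : `|v| < r.
  have := cP v Tv; rewrite hv => cv; rewrite -(ltr_pM2l c0).
  by apply: le_lt_trans cv _; exact: lt_le_trans mc.
exists (q + v); first by apply/(hP _ vr).1.
by rewrite (hP _ vr).2 ?hv//; apply/(hP _ vr).1.
Qed.

End rows.

Section complements.
Context {R : realType}.

Definition star (V : normedModType R) (Y : set V) z := Y z /\
  forall x (s : R), Y x -> 0 <= s -> s <= 1 -> Y (x + s *: (z - x)).

Lemma star_conn (V : normedModType R) (Y : set V) z : star Y z ->
  conn0 (R := R) Y /\ conn1 (R := R) Y Y.
Proof.
move=> [Yz sY].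
have cF : continuous (fun w : R * V => w.2 + w.1 *: (z - w.2)).
  move=> w; apply: cvgD; first exact: snd_continuous.
  apply: cvgZ; first exact: fst_continuous.
  by apply: cvgB; [exact: cvg_cst|exact: snd_continuous].
split=> [x y Yx Yy|p q Yp Yq pq0 pq1].
  have seg w : Y w -> pth Y (fun t : R => w + clamp t *: (z - w)).
    move=> Yw; split; last by move=> t; have /andP[] := clamp_in t; exact: sY.
    move=> t; apply: cvgD; first exact: cvg_cst.
    by apply: cvgZ; [exact: clamp_continuous|exact: cvg_cst].
  exists (cat (fun t : R => x + clamp t *: (z - x)) (rev (fun t : R => y + clamp t *: (z - y)))).
  split; first apply: pth_cat; [exact: seg|exact/pth_rev/seg|..].
  - by rewrite /rev subr0 clamp1 !scale1r !(addrC _ (z - _)) !subrK.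
  - by rewrite cat0 clamp0 scale0r addr0.
  - by rewrite cat1 /rev subrr clamp0 scale0r addr0.
apply: (hmt_defo (F := fun w => w.2 + w.1 *: (z - w.2))) => //=.
- exact: continuous_con.
- by move=> s x /andP[s0 s1] Yx; exact: sY.
- by move=> x _; rewrite scale0r addr0.
rewrite (_ : (fun t => q t + _) = (fun t => p t + 1 *: (z - p t))).
  apply: hmt_refl; split; last by move=> t; apply: sY; rewrite ?ler01//; case: Yp.
  case: Yp => cp _; move=> t; apply: cvgD; first exact: cp.
  apply: cvgZ; first exact: cvg_cst.
  by apply: cvgB; [exact: cvg_cst|exact: cp].
by apply/funext => t; rewrite !scale1r !(addrC _ (z - _)) !subrK.
Qed.

Lemma star_ball (V : normedModType R) (z : V) (r : R) : 0 < r ->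
  star [set x | `|x - z| < r] z.
Proof.
move=> r0; split=> [|x s /= xr s0 s1]; first by rewrite /= subrr normr0.
rewrite addrAC -(opprB x z) scalerN -[x - z in X in X - _]scale1r -scalerBl normrZ.
rewrite ger0_norm ?subr_ge0// (le_lt_trans _ xr)// ler_piMl//; lra.
Qed.

Lemma lcc_open (V : normedModType R) (X : set V) z : open X -> X z -> lcc true X id [set z].
Proof.
move=> oX Xz e e0; have /nbhs_dist[d d0 dX] : nbhs z X by exact: open_nbhs_nbhs.
pose r := Num.min e d; have r0 : 0 < r by rewrite lt_min e0.
have [c0 c1] := star_conn (star_ball z r0).
have sub : [set x | `|x - z| < r] `<=` over X id z e.
  by move=> x /=; rewrite lt_min => /andP[xe xd]; split => //; exact: dX.
exists r => // _ ->; split.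
- by exists z; apply: sub; rewrite /= subrr normr0.
- move=> x y [_ xr] [_ yr]; have [p [pp p0 p1]] := c0 x y xr yr.
  by exists p; split=> //; exact: pth_sub pp.
- by move=> _; apply: conn1_sub c1 => // x [].
Qed.

Definition scaling (V : normedModType R) (C : set V) := forall (k : R) x, 0 < k -> C x -> C (k *: x).

Definition cc (b : bool) (V : normedModType R) (C : set V) :=
  [/\ (~` C) !=set0, conn0 (R := R) (~` C) & b -> conn1 (R := R) (~` C) (~` C)].

Lemma scalingC (V : normedModType R) (C : set V) : scaling C ->
  forall (k : R) x, 0 < k -> ~ C x -> ~ C (k *: x).
Proof.
move=> sC k x k0 nC Ck; apply: nC.
by have /(sC _ _ _) := Ck => /(_ k^-1); rewrite invr_gt0 scalerA mulVf ?gt_eqF// scale1r; apply.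
Qed.

(** [F] is the identity, up to translation, on the [d]-ball and pushes everything else radially onto
    its sphere. It preserves the complement of the scaling set [C], so paths and homotopies anywhere
    in that complement are brought close to [p]. *)
Lemma lcc_germ b (V : normedModType R) (K C : set V) p (r : R) : 0 < r -> scaling C ->
  (forall y, `|y| < r -> K (p + y) <-> C y) -> cc b C -> lcc b (~` K) id [set p].
Proof.
move=> r0 sC KC [[y0 ny0] c0 c1] e e0.
pose d := Num.min e r / 2; have m0 : 0 < Num.min e r by rewrite lt_min e0.
have d0 : 0 < d by rewrite divr_gt0.
have dm : d < Num.min e r by rewrite /d; lra.
have /andP[de dr] : (d < e) && (d < r) by rewrite -lt_min.
pose k (y : V) : R := d / Num.max d `|y|.
have mx y : 0 < Num.max d `|y| by rewrite lt_max d0.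
have k0 y : 0 < k y by rewrite divr_gt0.
have k1 y : `|y| < d -> k y = 1 by move=> yd; rewrite /k max_l ?divff ?gt_eqF// ltW.
pose F y := p + k y *: y.
have kd y : `|k y *: y| <= d.
  rewrite normrZ gtr0_norm// /k mulrAC ler_pdivrMr//.
  by apply: ler_wpM2l; [exact: ltW|rewrite le_max lexx orbT].
have cF : continuous F.
  move=> y; apply: cvgD; first exact: cvg_cst.
  apply: cvgZ; last exact: cvg_id.
  apply: cvgM; first exact: cvg_cst.
  apply: cvgV; first by rewrite gt_eqF.
  apply: (@continuous_max _ _ (cst d) (fun y => `|y|)); first exact: cst_continuous.
  exact: norm_continuous.
have FC y : ~ C y -> over (~` K) id p e (F y).
  move=> nC; split; last by rewrite /= /F addrC addKr; exact: le_lt_trans (kd y) de.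
  by move=> /(KC _ (le_lt_trans (kd y) dr)); exact: scalingC.
have back x : over (~` K) id p d x -> ~ C (x - p) /\ F (x - p) = x.
  move=> [nK xd]; split; last by rewrite /F k1// scale1r addrC subrK.
  have xr : `|x - p| < r by exact: lt_trans dr.
  by move=> /(KC _ xr); rewrite addrC subrK.
have pback (a : R -> V) : pth (over (~` K) id p d) a -> pth (~` C) (fun t => a t - p).
  move=> [ca oa]; split; last by move=> t; case: (back _ (oa t)).
  by move=> t; apply: cvgB; [exact: ca|exact: cvg_cst].
exists d => // _ ->; split.
- by exists (F y0); exact: FC.
- move=> x y /back[nx Fx] /back[ny Fy].
  have [a [aC a0 a1]] := c0 _ _ nx ny.
  exists (fun t => F (a t)); split; [|by rewrite a0|by rewrite a1].
  by apply: pth_map aC; [exact: continuous_con|exact: FC].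
- move=> /c1{}c1 a a' oa oa' aa0 aa1.
  have := hmt_map (continuous_con cF) FC
    (c1 _ _ (pback a oa) (pback a' oa') (congr1 (fun x => x - p) aa0) (congr1 (fun x => x - p) aa1)).
  rewrite (_ : (fun t => F (a t - p)) = a); last first.
    by apply/funext => t; case: oa => _ /(_ t)/back[].
  rewrite (_ : (fun t => F (a' t - p)) = a')//.
  by apply/funext => t; case: oa' => _ /(_ t)/back[].
Qed.

End complements.

(** * Tangent cones modulo a line *)

Section quotient_by_a_line.
Context {R : realType}.

(** Pivot on a nonzero coordinate of [p]; [se] embeds R^d as the hyperplane where that coordinate
    vanishes. *)
Lemma line_split d (p : 'rV[R]_d.+1) : p != 0 ->
  exists (pr : 'rV[R]_d.+1 -> 'rV[R]_d) (se : 'rV[R]_d -> 'rV[R]_d.+1)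
    (co : 'rV[R]_d.+1 -> R), [/\ lin pr, lin se & lin co] /\
  [/\ forall z, pr (se z) = z, forall z, co (se z) = 0, pr p = 0, co p = 1 &
      forall y, y = se (pr y) + co y *: p].
Proof.
move=> /rV0Pn[i pi0].
pose co (y : 'rV[R]_d.+1) : R := y 0 i / p 0 i.
pose pr (y : 'rV[R]_d.+1) : 'rV[R]_d := \row_j (y 0 (lift i j) - co y * p 0 (lift i j)).
pose se (z : 'rV[R]_d) : 'rV[R]_d.+1 := \row_k oapp (fun j => z 0 j) 0 (unlift i k).
have sei z : se z 0 i = 0 by rewrite mxE unlift_none.
have sel z j : se z 0 (lift i j) = z 0 j by rewrite mxE liftK.
exists pr, se, co; split; split.
- by move=> k x y; apply/rowP => j; rewrite !mxE /co !mxE; field.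
- move=> k x y; apply/rowP => j; rewrite !mxE; case: (unlift i j) => [j'|] /=.
    by rewrite !mxE.
  by rewrite mulr0 addr0.
- by move=> k x y; rewrite /co !mxE mulrDl -mulrA.
- by move=> z; apply/rowP => j; rewrite mxE /co sei mul0r mul0r subr0 sel.
- by move=> z; rewrite /co sei mul0r.
- by apply/rowP => j; rewrite !mxE /co divff// mul1r subrr.
- by rewrite /co divff.
- move=> y; apply/rowP => k; rewrite [RHS]mxE [X in _ = _ + X]mxE.
  case: (unliftP i k) => [j ->|->]; first by rewrite sel mxE subrK.
  by rewrite sei add0r /co divfK.
Qed.

(** [T] is the product of [T'] with the line through [q], and its image is the preimage under [pr]
    of the image of [T']. The complements differ by a factor R and have the same connectivity. *)
Lemma quotient a d (T : set 'rV[R]_a.+1) (h : 'rV[R]_a.+1 -> 'rV[R]_d.+1) q p :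
  polyh T -> cone T -> embed T h -> homog T h -> q != 0 -> p != 0 ->
  (forall v l, T v -> T (v + l *: q) /\ h (v + l *: q) = h v + l *: p) ->
  exists (T' : set 'rV[R]_a) (h' : 'rV[R]_a -> 'rV[R]_d)
    (se : 'rV[R]_a -> 'rV[R]_a.+1) (pr : 'rV[R]_d.+1 -> 'rV[R]_d),
  [/\ polyh T' /\ cone T', embed T' h' /\ homog T' h',
      [/\ lin se, forall z, T' z <-> T (se z) &
          forall v, exists z l, v = se z + l *: q],
      forall y, (h @` T) y <-> (h' @` T') (pr y) &
      forall b, cc b (h' @` T') -> cc b (h @` T)].
Proof.
move=> pT cT eh hh q0 p0 line.
have [prq [seq [coq [[lprq lseq lcoq] [prseq coseq prqq coqq splitq]]]]] := line_split q0.
have [pr [se [co [[lpr lse lco] [prse cose prp cop split]]]]] := line_split p0.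
have cse := lin_cts lse; have cpr := lin_cts lpr; have cco := lin_cts lco.
have cseq := lin_cts lseq.
have [clT vT nT] := pT; have [ch ih rh] := eh; have [T0 sT] := cT.
pose T' := [set z | T (seq z)]; pose h' z := pr (h (seq z)).
have small (r : R) : 0 < r -> exists2 r' : R, 0 < r' & forall v, `|v| < r' -> `|seq v| < r.
  move=> r0; have /con_distP/(_ 0 I r r0)[e e0 eP] := @continuous_con _ _ setT _ cseq.
  by exists e => // v ve; have := eP v I; rewrite (lin0 lseq) !subr0; apply.
have img y : (h @` T) y <-> (h' @` T') (pr y).
  split=> [[v Tv <-]|[z Tz hz]].
    have [Tz hz] := line v (- coq v) Tv.
    have E : v + - coq v *: q = seq (prq v) by rewrite {1}(splitq v) scaleNr addrK.
    exists (prq v); first by rewrite /T' /= -E.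
    by rewrite /h' -E hz (linD lpr) (linZ lpr) prp scaler0 addr0.
  exists (seq z + (co y - co (h (seq z))) *: q); first by case: (line _ (co y - co (h (seq z))) Tz).
  rewrite (line _ _ Tz).2 (split y) -hz {1}(split (h (seq z))) -/(h' z).
  rewrite (linD lco) (linZ lco) cose cop add0r [_ *: 1]mulr1.
  by rewrite -addrA -scalerDl [co y - _]addrC addrA subrr add0r.
exists T', h', seq, pr; split.
- split; last first.
    split; first by rewrite /T' /= (lin0 lseq).
    by move=> k x k0 Tx; rewrite /T' /= (linZ lseq); exact: sT.
  split.
  + by apply: closed_comp clT => z _; exact: cseq.
  + move=> x y l Tx Ty l0 l1; rewrite /T' /= (linD lseq) (linZ lseq) (linB lseq).
    exact: vT.
  + move=> z Tz; have [r r0 rP] := nT _ Tz; have [r' r'0 r'P] := small r r0.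
    exists r' => // v l /r'P vr l0 l1; rewrite /T' /= !(linD lseq) (linZ lseq).
    exact: rP.
- split.
    split.
    + have : con T' (fun z => h (seq z)).
        by apply: (con_comp _ _ ch) => //; exact: continuous_con.
      move=> c; apply: (con_comp _ c (continuous_con (A := setT) cpr)) => //.
    + move=> x y Tx Ty hxy.
      pose l := co (h (seq x)) - co (h (seq y)).
      have E : h (seq x) = h (seq y + l *: q).
        rewrite (line _ _ Ty).2 (split (h (seq x))) [in RHS](split (h (seq y))).
        rewrite -/(h' x) -/(h' y) hxy -addrA -scalerDl /l.
        by rewrite [co (h (seq y)) + _]addrC subrK.
      have := ih _ _ Tx (line _ l Ty).1 E.
      move=> /[dup] /(congr1 coq); rewrite (linD lcoq) (linZ lcoq) !coseq coqq add0r [_ *: 1]mulr1.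
      by move=> <-; rewrite scale0r addr0 => /(congr1 prq); rewrite !prseq.
    + move=> z Tz; have [r r0 rP] := rh _ Tz; have [r' r'0 r'P] := small r r0.
      exists r' => // v l /r'P vr; rewrite /T' /= /h' !(linD lseq) (linZ lseq) => Tzv l0 l1.
      by rewrite (rP _ l)// (linD lpr) (linZ lpr) (linB lpr).
  by move=> k x k0 Tx; rewrite /h' linZ// hh// linZ.
- split => // v; exists (prq v), (coq v); exact: splitq.
- exact: img.
move=> b [[z0 nz0] c0 c1].
have nimg y : (~` (h @` T)) y <-> (~` (h' @` T')) (pr y).
  by split; apply: contra_not => /img.
split.
- by exists (se z0); apply/nimg; rewrite prse.
- move=> x y /nimg nx /nimg ny; have [g [[cg gC] g0 g1]] := c0 _ _ nx ny.
  (* The lift of a quotient path by [se], with the coefficient of [p] interpolated linearly between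
     its end values. *)
  exists (fun t => se (g t) + ((1 - t) * co x + t * co y) *: p); split.
  + split; last by move=> t; apply/nimg; rewrite (linD lpr) (linZ lpr) prp scaler0 addr0 prse.
    apply: add_cts; first exact: (comp_continuous cg cse).
    apply: scale_cts; last exact: cst_continuous.
    apply: add_cts => t; apply: cvgM; try exact: cvg_cst; try exact: cvg_id.
    by apply: cvgB; [exact: cvg_cst|exact: cvg_id].
  + by rewrite g0 subr0 mul1r mul0r addr0 -split.
  + by rewrite g1 subrr mul1r mul0r add0r -split.
- move=> /c1{}c1 g g' [cg gC] [cg' gC'] g0 g1.
  have prpath (u : R -> 'rV[R]_d.+1) : continuous u -> (forall t, (~` (h @` T)) (u t)) ->
      pth (~` (h' @` T')) (fun t => pr (u t)).
    by move=> ca aC; split; [exact: (comp_continuous ca cpr)|move=> t; exact/nimg].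
  have [H [cH HC H0 H1 He]] := c1 _ _ (prpath _ cg gC) (prpath _ cg' gC')
    (congr1 pr g0) (congr1 pr g1).
  exists (fun z => se (H z) + ((1 - z.1) * co (g z.2) + z.1 * co (g' z.2)) *: p).
  split => /=.
  + apply: add_cts; first exact: (comp_continuous cH cse).
    apply: scale_cts; last exact: cst_continuous.
    have cf := @fst_continuous R R; have cs := @snd_continuous R R.
    apply: add_cts => z; apply: cvgM.
    * by apply: cvgB; [exact: cvg_cst|exact: cf].
    * exact: (comp_continuous (comp_continuous cs cg) cco).
    * exact: cf.
    * exact: (comp_continuous (comp_continuous cs cg') cco).
  + by move=> z; apply/nimg; rewrite (linD lpr) (linZ lpr) prp scaler0 addr0 prse.
  + by move=> t t01; rewrite H0// subr0 mul1r mul0r addr0 -split.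
  + by move=> t t01; rewrite H1// subrr mul1r mul0r add0r -split.
  + move=> s s01; have [-> ->] := He s s01.
    by rewrite -g0 -g1 -!mulrDl subrK !mul1r -!split.
Qed.

(** Scaling q + c v by k = 1 / (1 - c l) gives q + c k (v + l q). Invariance of [D] under scaling
    transfers membership from v to v + l q, and homogeneity of [g] transfers the values of [h]. *)
Lemma tan_line a (W : normedModType R) (D : set 'rV[R]_a) (g h : 'rV[R]_a -> W) q (r : R) :
  cone D -> homog D g -> homog (tan D q) h -> 0 < r ->
  (forall v, `|v| < r -> (tan D q v <-> D (q + v)) /\ (D (q + v) -> g (q + v) = g q + h v)) ->
  D q ->
  forall v l, tan D q v -> tan D q (v + l *: q) /\ h (v + l *: q) = h v + l *: g q.
Proof.
move=> [_ sD] hg hh r0 hP Dq v l Tv.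
pose w := v + l *: q.
(* With c = m / S, the products of c with |v|, |w| and |l| are at most m <= 1/4; hence k <= 2, and
   both increments stay in the [r]-ball. *)
pose m : R := Num.min r 1 / 4.
have m1 : 0 < Num.min r 1 by rewrite lt_min r0 ltr01.
have m0 : 0 < m by rewrite divr_gt0.
have mr : 4 * m <= r by rewrite /m mulrC divfK// ge_min lexx.
have mm1 : 4 * m <= 1 by rewrite /m mulrC divfK// ge_min lexx orbT.
pose S : R := 1 + `|v| + `|w| + `|l|.
have S0 : 0 < S by rewrite /S -!addrA ltr_pwDl// !addr_ge0.
pose c := m / S; have c0 : 0 < c by rewrite divr_gt0.
have cS x : 0 <= x -> x <= S -> c * x <= m.
  move=> x0 xS; rewrite /c mulrAC ler_pdivrMr//; apply: ler_wpM2l => //; exact: ltW.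
have nv : 0 <= `|v| by []. 
have nw : 0 <= `|w| by []. 
have nl : 0 <= `|l| by [].
have cv : c * `|v| <= m by apply: cS => //; rewrite /S; lra.
have cw : c * `|w| <= m by apply: cS => //; rewrite /S; lra.
have cl : c * `|l| <= m by apply: cS => //; rewrite /S; lra.
have cl' : c * l <= m by apply: le_trans cl; apply: ler_wpM2l; [exact: ltW|exact: ler_norm].
pose k := (1 - c * l)^-1.
have d0 : 0 < 1 - c * l by lra.
have k0 : 0 < k by rewrite invr_gt0.
have k2 : k <= 2 by rewrite /k -[leRHS]invrK lef_pV2 ?posrE//; lra.
have kE : k * (1 - c * l) = 1 by rewrite mulVf// gt_eqF.
pose c' := c * k; have c'0 : 0 < c' by rewrite mulr_gt0.
have cvr : `|c *: v| < r by rewrite normrZ gtr0_norm//; lra.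
have cwr : `|c' *: w| < r.
  rewrite normrZ gtr0_norm// /c' mulrAC.
  have : c * `|w| * k <= m * 2 by apply: ler_pM => //; [rewrite mulr_ge0// ltW|exact: ltW].
  by lra.
have E : q + c' *: w = k *: (q + c *: v).
  have kk : 1 + c' * l = k by rewrite /c'; have := kE; move: (k) => k'; lra.
  rewrite /w !scalerDr !scalerA (mulrC k c) -/c' -kk scalerDl scale1r.
  by rewrite -!addrA; congr (_ + _); rewrite addrC.
have Tcv : tan D q (c *: v).
  by have [l' l'0 Dl'] := Tv; exists (l' / c); [rewrite divr_gt0|rewrite scalerA divfK ?gt_eqF].
have Dcv : D (q + c *: v) by apply/(hP _ cvr).1.
have Dcw : D (q + c' *: w) by rewrite E; apply: sD => //; exact: ltW.
have Tw : tan D q w by exists c'.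
split => //; rewrite -/w.
have /(congr1 (fun x => c'^-1 *: x)) : c' *: h w = c' *: (h v + l *: g q).
  have e1 : g (q + c' *: w) = k *: (g q + c *: h v).
    by rewrite E (hg _ _ (ltW k0) Dcv) (hP _ cvr).2// (hh _ _ (ltW c0) Tv).
  have e2 : h (c' *: w) = g (q + c' *: w) - g q.
    by rewrite (hP _ cwr).2// addrC addKr.
  rewrite -(hh _ _ (ltW c'0) Tw) e2 e1 !scalerDr !scalerA (mulrC k c) -/c' addrAC addrC.
  congr (_ + _); rewrite -[g q in X in _ - X]scale1r -scalerBl; congr (_ *: _).
  by rewrite /c'; have := kE; move: (k) => k'; lra.
by rewrite !scalerA mulVf ?gt_eqF// !scale1r.
Qed.

(** The induction step on dimension: at a point other than the apex, dividing by the line through it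
    lowers source and target dimension by one, and local connectivity of the complement at g q
    becomes connectivity of the complement of the quotient cone. *)
Lemma lcc_reduce a d (D : set 'rV[R]_a.+1) (g : 'rV[R]_a.+1 -> 'rV[R]_d.+1) q :
  polyh D -> cone D -> embed D g -> homog D g -> D q -> q != 0 ->
  exists (T' : set 'rV[R]_a) (h' : 'rV[R]_a -> 'rV[R]_d) (se : 'rV[R]_a -> 'rV[R]_a.+1),
  [/\ polyh T' /\ cone T', embed T' h' /\ homog T' h',
      [/\ lin se, forall z, T' z <-> tan D q (se z) &
          forall v, exists z l, v = se z + l *: q],
      (forall z, (h' @` T') z) -> nbhs (g q) (g @` D) &
      forall b, cc b (h' @` T') -> lcc b (~` (g @` D)) id [set g q]].
Proof.
move=> pD cD eg hg Dq q0.
have prop (r : R) : 0 < r -> _ := fun r0 => proper_cone pD cD eg hg Dq r0.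
have [h [r [r0 [pT cT] [eh hh] hP img]]] := germ pD eg Dq prop.
have gq0 : g q != 0.
  by apply: contra_neq q0 => gq; exact: homog_embed0 cD hg eg Dq gq.
have line := tan_line cD hg hh r0 hP Dq.
have [T' [h' [se [pr [pT' eT' sT' iT' ccT']]]]] := quotient pT cT eh hh q0 gq0 line.
exists T', h', se; split=> //.
- move=> full; apply/nbhs_dist; exists r => // y yr.
  rewrite -(subrK (g q) y) addrC; apply/(img _ yr)/iT'; exact: full.
- move=> b /ccT'; apply: lcc_germ r0 _ img.
  move=> k _ k0 [x Tx <-]; exists (k *: x); last by rewrite hh// ltW.
  by case: cT => _; apply => //; exact: ltW.
Qed.

End quotient_by_a_line.

(** * Complements of cones and the unit sphere *)

Section sphere.
Context {R : realType} {V : normedModType R}.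
Implicit Types (C : set V).

Definition sphere : set V := [set x | `|x| = 1].

Definition unitv (x : V) : V := `|x|^-1 *: x.

Lemma unitv_con : con [set x : V | x != 0] unitv.
Proof.
move=> x /= x0; apply: cvgZ; last exact: cvg_within.
apply: cvgV; first by rewrite normr_eq0.
exact: (continuous_con (@norm_continuous _ V)).
Qed.

Lemma unitvE x : sphere x -> unitv x = x.
Proof. by rewrite /sphere /unitv /= => ->; rewrite invr1 scale1r. Qed.

Lemma norm_unitv x : x != 0 -> sphere (unitv x).
Proof. by move=> x0; rewrite /sphere /= normrZ normfV normr_id mulVf// normr_eq0. Qed.

Lemma sphere_neq0 x : sphere x -> x != 0.
Proof. by rewrite /sphere /= => x1; rewrite -normr_eq0 x1 oner_eq0. Qed.

Lemma unitv_out C x : scaling C -> x != 0 -> ~ C x -> (sphere `\` C) (unitv x).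
Proof.
move=> sC x0 nC; split; first exact: norm_unitv.
by apply: scalingC => //; rewrite invr_gt0 normr_gt0.
Qed.

(** [unitv] retracts a neighbourhood of [p] to the sphere along rays, hence preserves the complement
    of [C]; the bound 1/2 keeps that neighbourhood away from the origin. *)
Lemma lcc_sphere b C p : scaling C -> sphere p -> lcc b (~` C) id [set p] ->
  lcc b (sphere `\` C) id [set p].
Proof.
move=> sC Sp l e e0.
have [d0 d00 dP] := (con_distP _ _).1 unitv_con p (sphere_neq0 Sp) e e0.
pose e1 := Num.min d0 2^-1; have e10 : 0 < e1 by rewrite lt_min d00 invr_gt0 ltr0n.
have far y : `|y - p| < e1 -> y != 0.
  rewrite lt_min => /andP[_ yp]; apply/eqP => y0; move: yp.
  by rewrite y0 sub0r normrN Sp; lra.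
have uP y : over (~` C) id p e1 y -> over (sphere `\` C) id p e (unitv y).
  move=> [nC /= ye]; have y0 := far y ye; split; first exact: unitv_out.
  have := dP y y0; rewrite (unitvE Sp); apply.
  by apply: lt_le_trans ye _; rewrite ge_min lexx.
have uc : con (over (~` C) id p e1) unitv.
  by apply: con_sub unitv_con => y [_ /far].
have [d d'0 /(_ p erefl)[[y0 oy0] c0 c1]] := l e1 e10.
have sub y : over (sphere `\` C) id p d y -> over (~` C) id p d y by move=> [[_ nC] yd].
exists d => // _ ->; split.
- by exists (unitv y0); exact: uP.
- move=> x y ox oy; have [a [oa a0 a1]] := c0 x y (sub _ ox) (sub _ oy).
  exists (fun t => unitv (a t)); split; first exact: pth_map uP oa.
    by rewrite a0 unitvE//; case: ox => -[].
  by rewrite a1 unitvE//; case: oy => -[].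
- move=> /c1{}c1 a a' oa oa' aa0 aa1.
  have := hmt_map uc uP (c1 _ _ (pth_sub sub oa) (pth_sub sub oa') aa0 aa1).
  rewrite (_ : (fun t => unitv (a t)) = a); last first.
    by apply/funext => t; rewrite unitvE//; case: oa => _ /(_ t)[[]].
  rewrite (_ : (fun t => unitv (a' t)) = a')//.
  by apply/funext => t; rewrite unitvE//; case: oa' => _ /(_ t)[[]].
Qed.

Section cone_complement.
Context (C : set V) (sC : scaling C) (C0 : C 0).

Let nz x : ~ C x -> x != 0. Proof. by move=> nC; apply/eqP => x0; rewrite x0 in nC. Qed.

Let uc : con (~` C) unitv. Proof. by apply: con_sub unitv_con => x /nz. Qed.

Lemma cone_sphere : cc true C -> [/\ (sphere `\` C) !=set0,
  conn0 (R := R) (sphere `\` C) & conn1 (R := R) (sphere `\` C) (sphere `\` C)].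
Proof.
move=> [[y0 ny0] c0 /(_ isT) c1].
have uP y : ~ C y -> (sphere `\` C) (unitv y).
  by move=> nC; apply: unitv_out => //; exact: nz.
have sub y : (sphere `\` C) y -> (~` C) y by case.
split.
- by exists (unitv y0); exact: uP.
- move=> x y ox oy; have [a [oa a0 a1]] := c0 x y (sub _ ox) (sub _ oy).
  exists (fun t => unitv (a t)); split; first exact: pth_map uP oa.
    by rewrite a0 unitvE//; case: ox.
  by rewrite a1 unitvE//; case: oy.
- move=> a a' oa oa' aa0 aa1.
  have := hmt_map uc uP (c1 _ _ (pth_sub sub oa) (pth_sub sub oa') aa0 aa1).
  rewrite (_ : (fun t => unitv (a t)) = a); last first.
    by apply/funext => t; rewrite unitvE//; case: oa => _ /(_ t)[].
  rewrite (_ : (fun t => unitv (a' t)) = a')//.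
  by apply/funext => t; rewrite unitvE//; case: oa' => _ /(_ t)[].
Qed.

(** Motion along rays deforms the complement of [C], which misses the origin, onto its part in the
    unit sphere. Working in the sphere gives the sweep of a cone a compact domain away from the
    apex. *)
Lemma sphere_cone : [/\ (sphere `\` C) !=set0,
  conn0 (R := R) (sphere `\` C) & conn1 (R := R) (sphere `\` C) (sphere `\` C)] -> cc true C.
Proof.
move=> [[y0 [Sy0 ny0]] c0 c1].
have uP y : ~ C y -> (sphere `\` C) (unitv y).
  by move=> nC; apply: unitv_out => //; exact: nz.
have sub y : (sphere `\` C) y -> (~` C) y by case.
pose F (w : R * V) := (1 - w.1 + w.1 * `|w.2|^-1) *: w.2.
have cF : con [set w : R * V | 0 <= w.1 <= 1 /\ (~` C) w.2] F.
  move=> [s x] [/= s01 /nz x0]; set A := [set w | _].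
  have wc (T : topologicalType) (f : R * V -> T) : continuous f ->
      f @ within A (nbhs (s, x)) --> f (s, x).
    by move=> cf; apply: cvg_trans (cf _); exact/cvg_app/cvg_within.
  have c1' := wc _ _ (@fst_continuous R V); have c2' := wc _ _ (@snd_continuous R V).
  apply: cvgZ => //; apply: cvgD; first by apply: cvgB => //; exact: cvg_cst.
  apply: cvgM => //; apply: cvgV; first by rewrite normr_eq0.
  exact: (wc _ _ (comp_continuous (@snd_continuous _ _) (@norm_continuous _ V))).
have FC s x : 0 <= s <= 1 -> (~` C) x -> (~` C) (F (s, x)).
  move=> /andP[s0 s1] nC; apply: scalingC => //=.
  have i0 : 0 < `|x|^-1 by rewrite invr_gt0 normr_gt0 nz.
  have [s1'|s1'] := ltrP s 1.
    by rewrite ltr_pwDl ?subr_gt0// mulr_ge0// ltW.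
  by rewrite (_ : s = 1) ?subrr ?add0r ?mul1r//; apply: le_anti; rewrite s1.
have F1 x : F (1, x) = unitv x by rewrite /F /= subrr add0r mul1r.
have F0 x : F (0, x) = x by rewrite /F /= subr0 mul0r addr0 scale1r.
split.
- by exists y0.
- move=> x y nx ny.
  have seg w : ~ C w -> pth (~` C) (fun t : R => F (clamp t, w)).
    move=> nw; split; last by move=> t; apply: FC => //; exact: clamp_in.
    apply: (con_total (g := F)) cF; last by move=> t; split => //; exact: clamp_in.
    by apply: pair_continuous; [exact: clamp_continuous|exact: cst_continuous].
  have [a [oa a0 a1]] := c0 _ _ (uP _ nx) (uP _ ny).
  exists (cat (fun t : R => F (clamp t, x)) (cat a (rev (fun t : R => F (clamp t, y))))).
  split; last 2 first.
  + by rewrite cat0 clamp0 F0.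
  + by rewrite !cat1 /rev subrr clamp0 F0.
  apply: pth_cat; [exact: seg|apply: pth_cat|].
  + exact: pth_sub oa.
  + exact/pth_rev/seg.
  + by rewrite a1 /rev subr0 clamp1 F1.
  + by rewrite cat0 a0 clamp1 F1.
- move=> _ a a' oa oa' aa0 aa1.
  apply: (hmt_defo cF FC (fun x _ => F0 x)) => //.
  apply: (@hmt_sub _ _ (sphere `\` C) _ _ _ sub).
  rewrite (_ : (fun t => F (1, a t)) = (fun t => unitv (a t))); last by apply/funext => t; exact: F1.
  rewrite (_ : (fun t => F (1, a' t)) = (fun t => unitv (a' t))); last by apply/funext => t; exact: F1.
  by apply: c1; [exact: pth_map uP oa|exact: pth_map uP oa'|rewrite aa0|rewrite aa1].
Qed.

End cone_complement.

Definition ray (w : V) : set V := [set y | exists2 k : R, 0 <= k & y = k *: w].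

Lemma star_ray w : w != 0 -> star (~` ray w) (- w).
Proof.
move=> w0; have nw : ~ ray w (- w).
  move=> [k k0 /eqP]; rewrite -subr_eq0 -opprD oppr_eq0 -{1}[w]scale1r -scalerDl scaler_eq0.
  by rewrite (negbTE w0) orbF; apply/negP; lra.
split=> // x s nx s0 s1 [k k0 E].
have [s1'|s1'] := ltrP s 1; last first.
  by apply: nw; exists k => //; rewrite -E (_ : s = 1) ?scale1r 1?addrC ?subrK//; apply: le_anti; rewrite s1.
apply: nx; exists ((k + s) / (1 - s)); first by rewrite divr_ge0 ?subr_ge0// addr_ge0.
have E' : (1 - s) *: x = (k + s) *: w.
  rewrite [RHS]scalerDl -E scalerBr scalerBl scale1r scalerN -!addrA; congr (_ + _).
  by rewrite addrCA addNr addr0.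
by rewrite mulrC -scalerA -E' scalerA mulVf ?scale1r//; lra.
Qed.

Lemma cc_ray w : w != 0 -> cc true (ray w).
Proof.
move=> w0; have sw := star_ray w0; have [c0 c1] := star_conn sw.
by split => //; exists (- w); case: sw.
Qed.

End sphere.

Section row_norm.
Context {R : realType}.

Lemma coord_le n (y : 'rV[R]_n) i : `|y 0 i| <= `|y|.
Proof.
rewrite [leRHS]/Num.norm /= mx_normrE; apply/bigmax_geP; right => /=.
by exists (0, i).
Qed.

Lemma coord_max n (y : 'rV[R]_n.+1) : exists i, `|y| = `|y 0 i|.
Proof.
have [->|y0] := eqVneq y 0; first by exists ord0; rewrite normr0 mxE normr0.
have [[i j] ij] : exists i, mx_norm y = `|y i.1 i.2|.
  by apply: mx_norm_neq0; rewrite -[mx_norm y]/(`|y|) normr_eq0.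
by exists j; rewrite -[`|y|]/(mx_norm y) ij (ord1 i).
Qed.

(** Near [q] the inequalities strict at [q] stay strict, and those tight at [q] are homogeneous in
    the increment. *)
Lemma polyh_affine n (I : finType) (f : I -> 'rV[R]_n -> R) (c : I -> R) :
  (forall i, lin (f i)) -> polyh [set x | forall i, 0 <= c i + f i x].
Proof.
move=> lf; have cf i : continuous (fun x => c i + f i x).
  by apply: add_cts; [exact: cst_continuous|exact: lin_cts].
split.
- rewrite (_ : [set x | _] = \bigcap_(i in setT) ((fun x => c i + f i x) @^-1` [set y | 0 <= y])); last first.
    by apply/seteqP; split => [x fx i _|x fx i]; [exact: fx|exact: (fx i Logic.I)].
  apply: closed_bigI => i _; apply: closed_comp; last exact: closed_ge.
  by move=> x _; exact: cf.
- move=> x y l fx fy l0 l1 i; rewrite (linD (lf i)) (linZ (lf i)) (linB (lf i)).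
  have fxi := fx i; have fyi := fy i.
  rewrite [l *: _]mulrBr.
  have : 0 <= (1 - l) * (c i + f i x) by rewrite mulr_ge0// subr_ge0.
  have : 0 <= l * (c i + f i y) by rewrite mulr_ge0.
  by rewrite mulrBl !mulrDr mul1r; lra.
- move=> q fq.
  have : \forall y \near q, forall i, 0 < c i + f i q -> 0 < c i + f i y.
    apply: (@filter_forall _ _ (fun i => [set y | 0 < c i + f i q -> 0 < c i + f i y]) _ (nbhs_filter q)) => i.
    have [fq0|fq0] := ltrP 0 (c i + f i q); last first.
      by apply: filterE.
    have [e e0 eP] := (con_distP setT _).1 (continuous_con (cf i)) q Logic.I _ fq0.
    apply/nbhs_dist; exists e => // y /(eP y Logic.I) + _.
    by rewrite ltr_norml; lra.
  move=> /nbhs_dist[r r0 rP]; exists r => // v l vr l0 l1 fl i.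
  have qv : `|q + v - q| < r by rewrite addrC addKr.
  have [fq0|fq0] := ltrP 0 (c i + f i q); first exact/ltW/(rP _ qv).
  have := fl i; rewrite (linD (lf i)) (linZ (lf i)) (linD (lf i)) !addrA.
  have -> : c i + f i q = 0 by apply: le_anti; rewrite fq0 fq.
  by rewrite !add0r [_ *: _]/(l * _) pmulr_rge0.
Qed.

Lemma polyh_forms n (I : finType) (f : I -> 'rV[R]_n -> R) : (forall i, lin (f i)) ->
  polyh [set x | forall i, 0 <= f i x] /\ cone [set x | forall i, 0 <= f i x].
Proof.
move=> lf; split; last first.
  split=> [i|k x k0 fx i]; first by rewrite (lin0 (lf i)).
  by rewrite (linZ (lf i)); apply: mulr_ge0.
have := polyh_affine (fun=> 0) lf.
rewrite (_ : [set x | forall i, 0 <= 0 + f i x] = [set x | forall i, 0 <= f i x])//.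
by apply/seteqP; split => x fx i; have := fx i; rewrite add0r.
Qed.

Lemma polyh_box n (q : 'rV[R]_n) (r : R) : 0 <= r -> polyh [set y | `|y - q| <= r].
Proof.
move=> r0; pose f (j : 'I_n * bool) (y : 'rV[R]_n) : R := (-1) ^+ j.2 * y 0 j.1.
have lf j : lin (f j).
  by move=> k x y; rewrite /f !mxE scaleRE; set s := (-1) ^+ _; ring.
have := polyh_affine (fun j => r - f j q) lf.
congr polyh; apply/seteqP; split => y; last first.
  move=> /= yq j; have : f j (q - y) <= r.
    apply: le_trans (ler_norm _) _; rewrite /f normrM normrX normrN1 expr1n mul1r.
    by apply: le_trans (coord_le _ _) _; rewrite distrC.
  by rewrite (linB (lf j)); lra.
move=> /= fy; case: n q y @f lf fy => [|n] q y f lf fy.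
  by rewrite [y - q]thinmx0 normr0.
have [i ->] := coord_max (y - q).
have := fy (i, true); have := fy (i, false).
rewrite /f /= expr0 expr1 !mul1r !mxE !mulN1r ler_norml; lra.
Qed.

End row_norm.

Section pointed_cones.
Context {R : realType}.

(** Weaker than the absence of lines: the form may vanish on lines of [D]. What is excluded is that
    [D] is a linear space. *)
Definition pointed n (D : set 'rV[R]_n) := exists (l : 'rV[R]_n -> R) u,
  [/\ lin l, D u, 0 < l u & forall v, D v -> 0 <= l v].

End pointed_cones.

(** * Complements of embedded cones *)

Section complements_of_pointed_cones.
Context {R : realType}.

Lemma scaling_image a d (D : set 'rV[R]_a) (h : 'rV[R]_a -> 'rV[R]_d) :
  cone D -> homog D h -> scaling (h @` D) /\ (h @` D) 0.
Proof.
move=> cD hh; have [D0 sD] := cD; split; last by exists 0 => //; exact: homog0 hh.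
move=> k _ k0 [x Dx <-]; exists (k *: x); first exact: sD (ltW k0) Dx.
by rewrite hh// ltW.
Qed.

Section sweep_cone.
Context {a d : nat} {D : set 'rV[R]_a.+1} {h : 'rV[R]_a.+1 -> 'rV[R]_d.+1}.
Context {l : 'rV[R]_a.+1 -> R} {u : 'rV[R]_a.+1}.
Context (pD : polyh D) (cD : cone D) (eh : embed D h) (hh : homog D h).
Context (ll : lin l) (Du : D u) (lu : l u = 1) (lD : forall v, D v -> 0 <= l v).
Context (IH : forall (T : set 'rV[R]_a) (g : 'rV[R]_a -> 'rV[R]_d),
  polyh T -> cone T -> embed T g -> homog T g -> pointed T -> cc true (g @` T)).

Let dev (x : 'rV[R]_a.+1) := x - l x *: u.

(* [narrow t] is the cone of the [x] in [D] with [(1 - t) `|dev x| <= t * l x]; it grows from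
   the ray through [u] at [t = 0] to [D] at [t = 1]. *)
Let form t (j : 'I_a.+1 * bool) x : R := t * l x - (1 - t) * ((-1) ^+ j.2 * dev x 0 j.1).

Let narrow t := D `&` [set x | forall j, 0 <= form t j x].

(** With these, al x <= t * be x is the inequality (1 - t) * al x <= t * l x of [narrow t], in the
    shape required by [swept]. *)
Let al x := `|dev x|.
Let be x := al x + l x.

Let lin_form t j : lin (form t j).
Proof.
move=> k x y; rewrite /form /dev ll !mxE !scaleRE; set s := (-1) ^+ _; ring.
Qed.

Let narrowP t x : 0 <= t <= 1 -> D x -> al x <= t * be x <-> forall j, 0 <= form t j x.
Proof.
move=> /andP[t0 t1] Dx; have t1' : 0 <= 1 - t by rewrite subr_ge0.
split=> [H j|H].
  have : (1 - t) * ((-1) ^+ j.2 * dev x 0 j.1) <= (1 - t) * al x.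
    apply: ler_wpM2l => //; apply: le_trans (coord_le (dev x) j.1).
    by rewrite (le_trans (ler_norm _))// normrM normrX normrN1 expr1n mul1r.
  by rewrite /form; move: H; rewrite /be mulrDr mulrBl mul1r; lra.
have [i iE] := coord_max (dev x).
have := H (i, dev x 0 i < 0); rewrite /form /= -normrEsign -iE -/(al x) /be.
by rewrite mulrDr mulrBl mul1r; lra.
Qed.

Let polyh_narrow t : polyh (narrow t) /\ cone (narrow t).
Proof.
have [pF cF] := polyh_forms (lin_form t).
split; first exact: polyhI.
split; first by split; [case: cD|case: cF].
by move=> k x k0 [Dx Fx]; split; [case: cD => _; exact|case: cF => _; exact].
Qed.

Let narrow_D t : narrow t `<=` D. Proof. by move=> x []. Qed.

Let embed_narrow t : embed (narrow t) h. Proof. exact: embed_sub eh. Qed.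

Let homog_narrow t : homog (narrow t) h.
Proof. by move=> k x k0 [Dx _]; exact: hh. Qed.

Let form_u t j : form t j u = t.
Proof. by rewrite /form /dev lu scale1r subrr mxE mulr0 mulr0 subr0 mulr1. Qed.

(** The sweep takes place in the unit sphere of the target; [Q] is the part of [D] over it, bounded
    by [cone_lower]. *)
Let Q := D `&` [set q | sphere (h q)].

Let cQ : compact Q.
Proof.
have [clD _ _] := pD; have [ch ih _] := eh.
have [c c0 cP] := cone_lower pD cD eh hh.
apply: (@compact_rows _ _ _ c^-1); last first.
  move=> x [Dx /= hx]; have := cP x Dx; rewrite hx.
  by rewrite mulrC -ler_pdivlMr// mul1r.
move=> x cx; have Dx : D x by apply: clD => B /cx [y [[Dy _] By]]; exists y.
split => //; rewrite /sphere /=; apply/eqP; rewrite eq_le; apply: contraPT cx.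
rewrite -eq_le => /eqP ne.
have ch' : con D (fun x => `|h x|).
  by apply: (con_comp (B := setT)) ch _ => //; exact: continuous_con (@norm_continuous _ _).
have e0 : 0 < `| `|h x| - 1| by rewrite normr_gt0 subr_eq0; apply/eqP.
have [e e'0 eP] := (con_distP _ _).1 ch' x Dx _ e0.
move=> /(_ [set y | `|y - x| < e]) []; first by apply/nbhs_dist; exists e.
move=> y [[Dy /= hy] /eP - /(_ Dy)]; rewrite hy distrC ltxx //.
Qed.

Let cal (A : set 'rV[R]_a.+1) : con A al.
Proof.
apply: continuous_con; apply: (@comp_continuous _ _ _ dev) (@norm_continuous _ _).
apply: sub_cts; first by move=> x; exact: cvg_id.
by apply: scale_cts; [exact: lin_cts|exact: cst_continuous].
Qed.

Let cbe (A : set 'rV[R]_a.+1) : con A be.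
Proof.
move=> x Ax; apply: cvgD; first exact: cal.
exact: (continuous_con (lin_cts ll)).
Qed.

Let be0 q : Q q -> 0 <= be q.
Proof. by move=> [Dq _]; apply: addr_ge0; [exact: normr_ge0|exact: lD]. Qed.

Let ch : con Q h.
Proof. by have [ch _ _] := eh; apply: con_sub ch => x []. Qed.

Let swE t : 0 <= t <= 1 ->
  sphere `\` swept set0 Q h al be t = sphere `\` (h @` narrow t).
Proof.
move=> t01; apply/seteqP; split=> x [Sx nx]; split => //.
  move=> [q [Dq Fq] hq]; apply: nx; right; exists q => //.
  by split; [split; rewrite //= hq|apply/(narrowP t01)].
move=> [//|[q [[Dq _] aq] hq]]; apply: nx; exists q => //.
by split => //; apply/(narrowP t01).
Qed.

Let u0 : u != 0.
Proof. by apply/eqP => u0; move: lu; rewrite u0 (lin0 ll) => /esym/eqP; rewrite oner_eq0. Qed.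

Let narrow0 : h @` narrow 0 = ray (h u).
Proof.
apply/seteqP; split=> [_ [x [Dx Fx] <-]|_ [k k0 ->]]; last first.
  exists (k *: u); last by rewrite hh.
  split; first by case: cD => _; exact.
  by move=> j; rewrite (linZ (lin_form 0 j)) form_u [_ *: _]mulr0.
have /(narrowP (x := x)) : 0 <= (0 : R) <= 1 by rewrite lexx ler01.
move=> /(_ Dx)[_ /(_ Fx)]; rewrite mul0r normr_le0 subr_eq0 => /eqP xE.
by exists (l x); [exact: lD|rewrite {1}xE hh// lD].
Qed.

Let narrow1 : h @` narrow 1 = h @` D.
Proof.
congr (_ @` _); apply/seteqP; split => [|x Dx]; first exact: narrow_D.
by split => // j; rewrite /form subrr mul0r subr0 mul1r lD.
Qed.

(** At a front point [q] the form of [narrow t] given by the largest coordinate of [dev q] vanishes.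
    It is nonnegative on [narrow t] and positive at [u]; as it kills [q], it descends to the
    quotient by the line through [q], so the quotient cone is pointed and [IH] applies. *)
Let front_lcc t z : 0 < t -> t <= 1 -> front Q h al be t z ->
  lcc true (sphere `\` swept set0 Q h al be t) id [set z].
Proof.
move=> t0 t1 [q [[Dq Sq] /= aq] <-].
have t01 : 0 <= t <= 1 by rewrite ltW.
rewrite swE//; have [pN cN] := polyh_narrow t.
have Nq : narrow t q by split => //; apply/(narrowP t01) => //; rewrite aq.
have [sC C0] := scaling_image cN (@homog_narrow t).
apply: lcc_sphere => //.
have q0 : q != 0.
  apply/eqP => q0; move: (sphere_neq0 Sq).
  by rewrite q0 (homog0 cD hh) eqxx.
have [T' [g' [se [[pT' cT'] [eT' hT'] [lse T'E dec] _ cc']]]] :=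
  lcc_reduce pN cN (@embed_narrow t) (@homog_narrow t) Nq q0.
apply: cc'; apply: IH => //.
have [i iE] := coord_max (dev q).
pose f := form t (i, dev q 0 i < 0).
have lf : lin f := lin_form t _.
have fq : f q = 0.
  rewrite /f /form /= -normrEsign -iE -/(al q); move: aq; rewrite /be.
  by rewrite mulrDr mulrBl mul1r; lra.
have [w [c uE]] := dec u.
exists (f \o se), w; split.
- by move=> k x y /=; rewrite lse lf.
- apply/T'E; have swE' : se w = u - c *: q by rewrite uE addrK.
  (* This [e] makes the coefficient 1 - e c of [q] in q + e (u - c q) nonnegative, so that the point
     is a sum of two members of the cone. *)
  rewrite swE'; pose e := (1 + `|c|)^-1.
  have e0 : 0 < e by rewrite invr_gt0 ltr_pwDl.
  exists e => //; rewrite scalerBr addrCA.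
  have -> : e *: u + (q - e *: (c *: q)) = e *: u + (1 - e * c) *: q.
    by rewrite scalerBl scale1r scalerA.
  apply: cone_add => //; case: cN => _ sN; apply: sN => //; try exact: ltW.
    by split => // j; rewrite form_u ltW.
  rewrite subr_ge0 (le_trans (ler_norm _))// normrM gtr0_norm// mulrC ler_pdivrMr ?mul1r ?lerDr// ltr_pwDl.
- rewrite /= -[se w](addrK (c *: q)) -uE (linB lf) (linZ lf) fq scaler0 subr0.
  by rewrite /f form_u.
- move=> v /T'E [c' c'0 [_ /(_ (i, dev q 0 i < 0))]]; rewrite -/(f _) (linD lf) (linZ lf) fq add0r.
  by rewrite [_ *: _]/(c' * _) pmulr_rge0.
Qed.

Lemma sweep_cone : cc true (h @` D).
Proof.
have hu0 : h u != 0 by apply: contra_neq u0; exact: homog_embed0 cD hh eh Du.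
have i0 : 0 <= (0 : R) <= 1 by rewrite lexx ler01.
have i1 : 0 <= (1 : R) <= 1 by rewrite lexx ler01.
have [sD D0] := scaling_image cD hh.
have [sR R0] : scaling (ray (h u)) /\ ray (h u) 0.
  by rewrite -narrow0; apply: scaling_image; [case: (polyh_narrow 0)|exact: homog_narrow].
have [n0 c0 c1] := cone_sphere sR R0 (cc_ray hu0).
have loc := fun t t0 t1 z => @front_lcc t z t0 t1.
apply: sphere_cone => //; rewrite -narrow1 -swE//.
have S0 : sphere `\` swept set0 Q h al be 0 = sphere `\` ray (h u) by rewrite swE// narrow0.
split.
- apply: (sweep_nonempty cQ ch (@cal Q) (@cbe Q) be0 (b := true)) => //.
  by rewrite S0.
- move=> x y Yx Yy.
  have sub := swept_le (Kb := set0) (g := h) (al := al) be0 (ler01 : 0 <= 1 :> R).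
  have Y0 z : (sphere `\` swept set0 Q h al be 1) z -> (sphere `\` ray (h u)) z.
    by rewrite -S0 => -[Sz nz]; split => // /sub.
  have [p [pp p0 p1]] := c0 _ _ (Y0 _ Yx) (Y0 _ Yy).
  have XX : sphere `<=` [set: 'rV[R]_d.+1] by [].
  have loc' t : 0 < t -> t <= 1 -> forall z, front Q h al be t z ->
      lcc true (sphere `\` swept set0 Q h al be t) id [set z] /\ lcc true setT id [set z].
    move=> t0 t1 z fz; split; first exact: loc.
    by apply: lcc_open => //; exact: openT.
  have := @sweep_pth _ _ _ _ _ _ _ _ _ cQ ch (@cal Q) (@cbe Q) be0 _ _ XX loc' p.
  rewrite S0 p0 p1 => /(_ pp Yx Yy)[p' [pp' p'0 p'1 _]].
  by exists p'.
- move=> p q Yp Yq pq0 pq1.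
  apply: (sweep_hmt cQ ch (@cal Q) (@cbe Q) be0) => //.
  have sub := swept_le (Kb := set0) (g := h) (al := al) be0 (ler01 : 0 <= 1 :> R).
  have Y0 : sphere `\` swept set0 Q h al be 1 `<=` sphere `\` ray (h u).
    by rewrite -S0 => z [Sz nz]; split => // /sub.
  by rewrite S0; apply: c1 => //; [exact: pth_sub Yp|exact: pth_sub Yq].
Qed.

End sweep_cone.

(** Valid in every codimension. Source and target dimension drop together; once either is 0, the
    vector [u] with l u > 0 would be 0. *)
Lemma pointed_complement d : forall a (D : set 'rV[R]_a) (h : 'rV[R]_a -> 'rV[R]_d),
  polyh D -> cone D -> embed D h -> homog D h -> pointed D -> cc true (h @` D).
Proof.
elim: d => [|d IH] a D h pD cD eh hh [l [u [ll Du lu lD]]].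
  have u0 : u = 0 by apply: homog_embed0 cD hh eh Du _; rewrite [LHS]thinmx0.
  by move: lu; rewrite u0 (lin0 ll) ltxx.
case: a D h pD cD eh hh l u ll Du lu lD => [|a] D h pD cD eh hh l u ll Du lu lD.
  by move: lu; rewrite [u]thinmx0 (lin0 ll) ltxx.
apply: (sweep_cone (l := fun x => (l u)^-1 * l x) (u := u)) => //.
- by move=> k x y; rewrite ll mulrDr [_ *: _ in RHS]/(k * _) mulrCA.
- by rewrite mulVf// gt_eqF.
- by move=> v Dv; rewrite mulr_ge0// ?lD// invr_ge0 ltW.
- by move=> T g; exact: IH.
Qed.

End complements_of_pointed_cones.

(** * Avoiding a closed set all at once *)

Section avoiding_a_closed_set.
Context {R : realType} {V : normedModType R}.
Implicit Types (X K : set V).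

Lemma con_id (W : normedModType R) (X : set W) : con X id.
Proof. by apply: continuous_con => x; exact: cvg_id. Qed.

Lemma lcc_compact (W : normedModType R) b (Y : set W) (pi : W -> V) (Z : set V) : compact Z ->
  (forall z, Z z -> lcc b Y pi [set z]) -> lcc b Y pi Z.
Proof.
move=> cZ loc; have := @lcc_image R V W b Y pi V Z setT id cZ (@con_id _ Z).
by rewrite setIT image_id; apply => [q _ []//|q Zq _]; exact: loc.
Qed.

(** Only the compact part of [K] met by the homotopy matters, and there the local condition is
    uniform; the repair is that of a limit time in a sweep. *)
Lemma hmt_avoid X K (p q : R -> V) : closed K ->
  (forall z, X z -> K z -> lcc true (X `\` K) id [set z]) ->
  pth (X `\` K) p -> pth (X `\` K) q -> hmt X p q -> hmt (X `\` K) p q.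
Proof.
move=> clK loc Yp Yq /hmt_compact[C [cC clC CX [H [cH CH H0 H1 He]]]].
have cZ : compact (C `&` K) by apply: compact_closedI.
have lZ : lcc true (X `\` K) id (C `&` K).
  by apply: lcc_compact => // z [/CX Xz Kz]; exact: loc.
have idY x : (X `\` K) x -> (X `\` K) x /\ x = x by [].
have [eta eta0 etaP] := hmt_local_to_global lZ (@con_id _ (X `\` K)) idY.
apply: hmt_clamp2 => //.
have in0 : 0 <= (0 : R) <= 1 by rewrite lexx ler01.
have := etaP H cH; rewrite (_ : (fun u => H (0, clamp u)) = (fun u => p (clamp u))); last first.
  by apply/funext => u; rewrite H0// clamp_in.
rewrite (_ : (fun u => H (1, clamp u)) = (fun u => q (clamp u))); last first.
  by apply/funext => u; rewrite H1// clamp_in.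
apply.
- move=> u v _ _; have Ch := CH (u, v).
  have [Kh|nK] := pselect (K (H (u, v))); last by left; split => //; exact: CX.
  by right; exists (H (u, v)); [split|rewrite subrr normr0].
- by move=> u u01; have [-> ->] := He u u01; have [-> ->] := He 0 in0.
- by move=> u u01; rewrite H0// H1//; split; [case: Yp|case: Yq].
Qed.

Lemma pth_avoid b X X' K (p : R -> V) : closed K -> X `<=` X' ->
  (forall z, X z -> K z -> lcc b (X `\` K) id [set z] /\ lcc true X' id [set z]) ->
  pth X p -> (X `\` K) (p 0) -> (X `\` K) (p 1) ->
  exists p', [/\ pth (X `\` K) p', p' 0 = p 0, p' 1 = p 1 & hmt X' p p'].
Proof.
move=> clK XX loc Xp p0 p1; have [C [cC clC CX pC]] := pth_compact Xp.
have cZ : compact (C `&` K) by apply: compact_closedI.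
have lZ : lcc b (X `\` K) id (C `&` K).
  by apply: lcc_compact => // z [/CX Xz Kz]; case: (loc z Xz Kz).
have lX : lcc true X' id (C `&` K).
  by apply: lcc_compact => // z [/CX Xz Kz]; case: (loc z Xz Kz).
have idY x : (X `\` K) x -> (X `\` K) x /\ x = x by [].
have YX x : (X `\` K) x -> X' x by move=> [/XX].
have [eta eta0 etaP] := pth_local_to_global lX lZ (@con_id _ _) (@con_id _ _) YX idY.
have [||||c [Yc c0 c1 hc]] := etaP (fun t => p (clamp t)).
- by apply: pth_sub pC => x /CX /XX.
- move=> t _; have Cp : C (p (clamp t)) by case: pC => _ /(_ t).
  have [Kh|nK] := pselect (K (p (clamp t))); last by left; split => //; exact: CX.
  by right; exists (p (clamp t)); [split|rewrite subrr normr0].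
- by rewrite clamp0.
- by rewrite clamp1.
exists c; split => //; [by rewrite c0 clamp0|by rewrite c1 clamp1|].
by apply: hmt_trans hc; apply: hmt_clamp; exact: pth_sub Xp.
Qed.

End avoiding_a_closed_set.

(** * Homogeneous embeddings of whole spaces and invariance of domain *)

Section linear_cones.
Context {R : realType}.

Lemma polyhT (V : normedModType R) : polyh [set: V] /\ cone [set: V].
Proof.
split; last by split.
by split => [|x y l|q _]; [exact: closedT| |exists 1].
Qed.

Lemma setCD (T : Type) (A B : set T) : A `<=` B -> ~` A `\` B = ~` B.
Proof. by move=> AB; apply/seteqP; split => x; [case|move=> nB; split => // /AB]. Qed.

Definition halfspace a (s : R) : set 'rV[R]_a.+1 := [set v | 0 <= s * v 0 ord0].

Lemma halfspace_polyh a s : s != 0 ->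
  [/\ polyh (@halfspace a s), cone (@halfspace a s) & pointed (@halfspace a s)].
Proof.
move=> s0; have ll : lin (fun v : 'rV[R]_a.+1 => s * v 0 ord0).
  by move=> k x y; rewrite !mxE scaleRE; ring.
have [pF cF] := polyh_forms (I := unit) (fun _ => ll).
have E : [set x : 'rV[R]_a.+1 | forall _ : unit, 0 <= s * x 0 ord0] = halfspace s.
  by apply/seteqP; split => x; [exact|move=> h _].
split; [by rewrite -E|by rewrite -E|].
exists (fun v : 'rV[R]_a.+1 => s * v 0 ord0), (s *: delta_mx 0 ord0); split => //.
- by rewrite /halfspace /= !mxE eqxx mulr1 -expr2 sqr_ge0.
- by rewrite !mxE eqxx mulr1 -expr2 exprn_even_gt0.
Qed.

Lemma full_reduce b a d (h : 'rV[R]_a.+1 -> 'rV[R]_d.+1) q : q != 0 ->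
  embed setT h -> homog setT h ->
  exists h' : 'rV[R]_a -> 'rV[R]_d, [/\ embed setT h' /\ homog setT h',
    (forall z, (h' @` setT) z) -> nbhs (h q) (h @` setT) &
    cc b (h' @` setT) -> lcc b (~` (h @` setT)) id [set h q]].
Proof.
move=> q0 eh hh; have [pT cT] := polyhT 'rV[R]_a.+1.
have [T' [h' [se [_ [eT' hT'] [_ T'E _] full cc']]]] := lcc_reduce pT cT eh hh Logic.I q0.
have T'T : T' = setT.
  by apply/seteqP; split => // z _; apply/T'E; exists 1.
by exists h'; rewrite -T'T; split => //; exact: cc'.
Qed.

Lemma embed_setT_image_closed a d (h : 'rV[R]_a -> 'rV[R]_d) :
  embed setT h -> homog setT h -> closed (h @` setT).
Proof. by have [pT cT] := polyhT 'rV[R]_a; exact: cone_image_closed. Qed.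

(** Such an [h] need not be linear, nor its image a subspace. The image of a half-space, a pointed
    cone, has simply connected complement; paths and homotopies there are pushed off the rest of the
    image, which comes from nonzero vectors, where the quotient by a line reduces the local
    condition to the hypothesis one dimension lower. *)
Lemma linear_complement_step b a d (h : 'rV[R]_a.+1 -> 'rV[R]_d.+1) :
  (forall h' : 'rV[R]_a -> 'rV[R]_d, embed setT h' -> homog setT h' -> cc b (h' @` setT)) ->
  embed setT h -> homog setT h -> cc b (h @` setT).
Proof.
move=> IH eh hh; have [pT cT] := polyhT 'rV[R]_a.+1.
have clh := embed_setT_image_closed eh hh.
have loc q : q != 0 -> lcc b (~` (h @` setT)) id [set h q].
  move=> q0; have [h' [[eh' hh'] _ cc']] := full_reduce b q0 eh hh.
  by apply: cc'; exact: IH.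
have [pD cD ptD] := @halfspace_polyh a 1 (oner_neq0 _).
pose D := @halfspace a 1.
have eD : embed D h by exact: embed_sub eh.
have hD : homog D h by move=> k x k0 _; exact: hh.
have [_ c0 /(_ isT) c1] := pointed_complement pD cD eD hD ptD.
have sub : h @` D `<=` h @` setT by move=> _ [x _ <-]; exists x.
have E := setCD sub.
have locX z : (~` (h @` D)) z -> (h @` setT) z -> lcc b (~` (h @` D) `\` h @` setT) id [set z].
  move=> nz [q _ hq]; rewrite E -hq; apply: loc; apply/eqP => q0; apply: nz.
  by exists q => //; rewrite q0 /D /halfspace /= mxE mulr0.
split.
- have [|d0 d00 dP] := loc (delta_mx 0 ord0) _ 1 ltr01.
    by apply/eqP => /rowP/(_ ord0)/eqP; rewrite !mxE eqxx oner_eq0.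
  by have [[y [ny _]] _ _] := dP _ erefl; exists y.
- move=> x y nx ny; have sx z : (~` (h @` setT)) z -> (~` (h @` D)) z by move=> n /sub.
  have [p [pp p0 p1]] := c0 _ _ (sx _ nx) (sx _ ny).
  have [||||p' [pp' p'0 p'1 _]] := @pth_avoid _ _ b _ setT (h @` setT) p clh _ _ pp.
  + by [].
  + by move=> z Xz Kz; split; [exact: locX|apply: lcc_open => //; exact: openT].
  + by rewrite E p0.
  + by rewrite E p1.
  by exists p'; rewrite -E; split => //; [rewrite p'0|rewrite p'1].
- move=> bT p q Yp Yq pq0 pq1; rewrite -E; rewrite bT in locX.
  apply: hmt_avoid => //; [by rewrite E..|].
  by apply: c1 => //; rewrite -E in Yp Yq; [apply: pth_sub Yp|apply: pth_sub Yq] => z [].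
Qed.

(** One of three directions, with first coordinates 1, 0 and -1, always works; the signs of the
    first coordinates of [x] and [y] decide which. *)
Lemma ray_avoiding d (x y : 'rV[R]_d.+2) : x != 0 -> y != 0 ->
  exists2 u, u != 0 & ~ ray u x /\ ~ ray u y.
Proof.
move=> x0 y0; pose i1 : 'I_d.+2 := lift ord0 ord0.
pose e (s : R) (t : R) : 'rV[R]_d.+2 := s *: delta_mx 0 ord0 + t *: delta_mx 0 i1.
have e0 s t : e s t 0 ord0 = s by rewrite !mxE eqxx /= mulr1 mulr0 addr0.
have e1 s t : e s t 0 i1 = t by rewrite !mxE eqxx /= mulr1 mulr0 add0r.
have ne s t : s != 0 \/ t != 0 -> e s t != 0.
  move=> st; apply/eqP => E; move: (e0 s t) (e1 s t); rewrite E !mxE => s0 t0.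
  by case: st; rewrite -?s0 -?t0 eqxx.
have pos (z : 'rV[R]_d.+2) s t : z != 0 -> ray (e s t) z -> exists2 k : R, 0 < k & z 0 ord0 = k * s.
  move=> z0 [k k0 zE]; exists k; last by rewrite zE mxE e0.
  rewrite lt_neqAle k0 andbT; apply: contra_neq z0 => kk.
  by rewrite zE -kk scale0r.
have u0 s : e s 1 != 0 by apply: ne; right; exact: oner_neq0.
have n1 (z : 'rV[R]_d.+2) : z != 0 -> z 0 ord0 <= 0 -> ~ ray (e 1 1) z.
  by move=> z0 z1 /(pos _ _ _ z0)[k k0 zE]; lra.
have nN (z : 'rV[R]_d.+2) : z != 0 -> 0 <= z 0 ord0 -> ~ ray (e (-1) 1) z.
  by move=> z0 z1 /(pos _ _ _ z0)[k k0 zE]; lra.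
have n0 (z : 'rV[R]_d.+2) : z != 0 -> z 0 ord0 != 0 -> ~ ray (e 0 1) z.
  by move=> z0 /eqP z1 /(pos _ _ _ z0)[k k0 zE]; apply: z1; rewrite zE mulr0.
have [x1|x1|x1] := ltgtP (x 0 ord0) 0; have [y1|y1|y1] := ltgtP (y 0 ord0) 0.
- by exists (e 1 1) => //; split; apply: n1 => //; lra.
- by exists (e 0 1) => //; split; apply: n0 => //; apply/eqP => h; lra.
- by exists (e 1 1) => //; split; apply: n1 => //; lra.
- by exists (e 0 1) => //; split; apply: n0 => //; apply/eqP => h; lra.
- by exists (e (-1) 1) => //; split; apply: nN => //; lra.
- by exists (e (-1) 1) => //; split; apply: nN => //; lra.
- by exists (e 1 1) => //; split; apply: n1 => //; lra.
- by exists (e (-1) 1) => //; split; apply: nN => //; lra.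
- by exists (e 1 1) => //; split; apply: n1 => //; lra.
Qed.

Lemma lin_embed (V W : normedModType R) (D : set V) (g : V -> W) : continuous g -> lin g ->
  (forall x, g x = 0 -> x = 0) -> embed D g.
Proof.
move=> cg lg ig; split; first exact: continuous_con.
  move=> x y _ _ gxy; apply/eqP; rewrite -subr_eq0; apply/eqP/ig.
  by rewrite (linB lg) gxy subrr.
move=> q _; exists 1 => // v l _ _ _ _.
by rewrite !(linD lg) (linZ lg) addrAC subrr add0r.
Qed.

Definition line_map d (u : 'rV[R]_d) (v : 'rV[R]_1) : 'rV[R]_d := v 0 ord0 *: u.

Lemma line_map_embed d (u : 'rV[R]_d) D : u != 0 ->
  embed D (line_map u) /\ homog D (line_map u).
Proof.
move=> u0; have ll : lin (line_map u).
  by move=> k x y; rewrite /line_map !mxE scalerDl scalerA.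
split; last by move=> k x _ _; exact: linZ.
apply: lin_embed => //; first exact: lin_cts.
move=> x /eqP; rewrite scaler_eq0 (negbTE u0) orbF => /eqP x0.
by apply/rowP => i; rewrite (ord1 i) x0 mxE.
Qed.

Lemma ray_image d (u : 'rV[R]_d) : ray u = line_map u @` @halfspace 0 1.
Proof.
apply/seteqP; split => [_ [k k0 ->]|_ [v v0 <-]].
  by exists (const_mx k); rewrite /line_map /halfspace /= mxE ?mul1r.
by exists (v 0 ord0) => //; move: v0; rewrite /halfspace /= mul1r.
Qed.

Lemma closed_ray d (u : 'rV[R]_d) : u != 0 -> closed (ray u).
Proof.
move=> u0; have [eh hh] := line_map_embed (@halfspace 0 1) u0.
have [pD cD _] := @halfspace_polyh 0 1 (oner_neq0 _).
by rewrite ray_image; exact: cone_image_closed pD cD eh hh.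
Qed.

Lemma point_complement0 d : cc false [set (0 : 'rV[R]_d.+2)].
Proof.
split=> //.
- exists (const_mx 1) => /rowP/(_ ord0)/eqP; rewrite !mxE; exact/negP/oner_neq0.
- move=> x y /eqP x0 /eqP y0; have [u u0 [nx ny]] := ray_avoiding x0 y0.
  have [c0 _] := star_conn (star_ray u0).
  have [p [pp p0 p1]] := c0 _ _ nx ny; exists p; split => //.
  by apply: pth_sub pp => z nz z0; apply: nz; rewrite z0; exists 0; rewrite ?scale0r.
Qed.

Lemma image_row0 d (h : 'rV[R]_0 -> 'rV[R]_d) : homog setT h -> h @` setT = [set 0].
Proof.
move=> hh; have h0 : h 0 = 0 by apply: homog0 hh; case: (polyhT 'rV[R]_0).
apply/seteqP; split => [_ [x _ <-]|_ ->]; first by rewrite [x]thinmx0 h0.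
by exists 0.
Qed.

Lemma linear_complement0 a : forall d (h : 'rV[R]_a -> 'rV[R]_d), (a.+2 <= d)%N ->
  embed setT h -> homog setT h -> cc false (h @` setT).
Proof.
elim: a => [|a IH] [|[|d]] h // ad eh hh; first by rewrite image_row0//; exact: point_complement0.
by apply: linear_complement_step => // h' eh' hh'; exact: IH.
Qed.

(** Both paths are first pushed off a ray that misses their ends, by homotopies avoiding the origin:
    at nonzero points the ray is locally a line, of codimension at least 2. The complement of the
    ray is star-shaped. *)
Lemma point_complement1 d : cc true [set (0 : 'rV[R]_d.+3)].
Proof.
have [n0 c0 _] := point_complement0 d.+1; split => // _ p q Yp Yq pq0 pq1.
have [_ /(_ 0)/eqP x0] := Yp; have [_ /(_ 1)/eqP y0] := Yp.
have [u u0 [nx ny]] := ray_avoiding x0 y0.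
have [eh hh] := line_map_embed setT u0.
have rE : ~` [set 0] `\` ray u = ~` ray u.
  by apply: setCD => _ ->; exists 0; rewrite ?scale0r.
have loc z : (~` [set 0]) z -> ray u z -> lcc false (~` [set 0] `\` ray u) id [set z] /\
    lcc true (~` [set 0]) id [set z].
  move=> /eqP z0 [k k0 zE]; split; last first.
    by apply: lcc_open; [rewrite openC; exact: compact_closed (@norm_hausdorff _ _) (@compact_set1 _ _)|exact/eqP].
  rewrite rE; have nu : 0 < `|u| by rewrite normr_gt0.
  (* Within distance |z| of [z] the ray coincides with its line, as the coefficient of [u] stays
     nonnegative. *)
  apply: (@lcc_germ _ _ _ _ (line_map u @` setT) z `|z|); first by rewrite normr_gt0.
  - by have [_ cT] := polyhT 'rV[R]_1; case: (scaling_image cT hh).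
  - move=> y yz; split=> [[k' k'0 E]|[v _ vy]].
      exists (const_mx (k' - k)) => //; rewrite /line_map mxE scalerBl -E zE.
      by rewrite addrC addKr.
    exists (k + v 0 ord0); last by rewrite -vy zE /line_map scalerDl.
    move: yz; rewrite -vy zE /line_map !normrZ ltr_pM2r// (ger0_norm k0) ltr_norml; lra.
  - exact: linear_complement0.
have pY (a : R -> 'rV[R]_d.+3) : pth (~` [set (0 : 'rV[R]_d.+3)]) a -> a 0 = p 0 ->
    a 1 = p 1 -> exists a' : R -> 'rV[R]_d.+3,
    [/\ pth (~` ray u) a', a' 0 = p 0, a' 1 = p 1 & hmt (~` [set (0 : 'rV[R]_d.+3)]) a a'].
  move=> Ya a0 a1.
  have := @pth_avoid _ _ false _ (~` [set 0]) (ray u) a (closed_ray u0) _ loc Ya.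
  by rewrite rE a0 a1; exact.
have [p' [Yp' p'0 p'1 hp]] := pY p Yp erefl erefl.
have [q' [Yq' q'0 q'1 hq]] := pY q Yq (esym pq0) (esym pq1).
apply: hmt_trans hp (hmt_trans _ (hmt_sym hq)).
have [_ c1] := star_conn (star_ray u0).
apply: (@hmt_sub _ _ (~` ray u)); first by rewrite -rE => z [].
by apply: c1 => //; rewrite ?q'0 ?q'1.
Qed.

Lemma linear_complement1 a : forall d (h : 'rV[R]_a -> 'rV[R]_d), (a.+3 <= d)%N ->
  embed setT h -> homog setT h -> cc true (h @` setT).
Proof.
elim: a => [|a IH] [|[|[|d]]] h // ad eh hh.
  by rewrite image_row0//; exact: point_complement1.
by apply: linear_complement_step => // h' eh' hh'; exact: IH.
Qed.

Lemma pointed_not_onto a d (D : set 'rV[R]_a) (h : 'rV[R]_a -> 'rV[R]_d) :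
  polyh D -> cone D -> embed D h -> homog D h -> pointed D -> ~ (forall y, (h @` D) y).
Proof.
move=> pD cD eh hh ptD full.
by have [[y ny] _ _] := pointed_complement pD cD eh hh ptD; apply: ny.
Qed.

(** Invariance of domain by induction on d. The image [O] of an open half-space is open by the
    induction hypothesis. It is also relatively closed in the complement of the image of the
    opposite closed half-space, which is path connected because that half-space is pointed; so [O]
    fills this complement. *)
Lemma linear_onto d (h : 'rV[R]_d -> 'rV[R]_d) : embed setT h -> homog setT h ->
  forall y, (h @` setT) y.
Proof.
elim: d h => [|d IH] h eh hh y; first by exists 0; rewrite // [RHS]thinmx0 [LHS]thinmx0.
have [pT cT] := polyhT 'rV[R]_d.+1; have [ch ih _] := eh.
have half s : s != 0 -> [/\ polyh (@halfspace d s), cone (@halfspace d s),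
    embed (@halfspace d s) h, homog (@halfspace d s) h & pointed (@halfspace d s)].
  move=> /(@halfspace_polyh d)[? ? ?]; split => //; first exact: embed_sub eh.
  by move=> k x k0 _; exact: hh.
have [pD cD eD hD ptD] := half 1 (oner_neq0 _).
have n1 : (-1 : R) != 0 by rewrite oppr_eq0 oner_neq0.
have [pN cN eN hN _] := half (-1) n1.
have [_ c0 _] := pointed_complement pD cD eD hD ptD.
pose O := h @` [set v : 'rV[R]_d.+1 | v 0 ord0 < 0].
have oO x : O x -> nbhs x O.
  move=> [q q0 <-]; have qn : q != 0 by apply/eqP => qE; move: q0; rewrite /= qE mxE ltxx.
  have [h' [[eh' hh'] full _]] := full_reduce true qn eh hh.
  have /nbhs_dist[r1 r10 r1P] := full (IH h' eh' hh').
  have q0' : 0 < - q 0 ord0 by rewrite oppr_gt0.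
  (* Preimages closer to [q] than minus its first coordinate stay in the open half-space. *)
  have [r2 r20 r2P] := @proper_cone _ _ _ _ _ pT cT eh hh q _ Logic.I q0'.
  refine ((@nbhs_dist _ _ (h q) O).2 _); exists (Num.min r1 r2); first by rewrite lt_min r10.
  move=> w; rewrite lt_min => /andP[/r1P[v _ vw] wr2].
  exists v => //=; have := r2P v Logic.I; rewrite vw => /(_ wr2) vq.
  have := le_lt_trans (coord_le (v - q) ord0) vq; rewrite !mxE ltr_norml; lra.
have [//|ny] := pselect ((h @` @halfspace d 1) y).
  by case=> v _ <-; exists v.
pose o := h (- delta_mx 0 ord0).
have Oo : O o by exists (- delta_mx 0 ord0); rewrite //= !mxE eqxx oppr_lt0 ltr01.
have OU x : O x -> (~` (h @` @halfspace d 1)) x.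
  move=> [v v0 <-] [v' v'0] /ih E; move: v'0; rewrite /halfspace /= E// mul1r.
  by move: v0 => /=; lra.
have [g [[cg Yg] g0 g1]] := c0 _ _ (OU _ Oo) ny.
suff : O y by case=> v _ <-; exists v.
rewrite -g1; suff H : forall s : R, 0 <= s -> s <= 1 -> O (g s) by exact: H.
have cgd (t : R) := (con_distP setT _).1 (continuous_con cg) t Logic.I.
apply: (@real_induction R (fun t => forall s, 0 <= s -> s <= t -> O (g s))).
- by move=> s s0 s0'; rewrite (_ : s = 0) ?g0//; apply: le_anti; rewrite s0'.
- by move=> s t s0 st H s' s'0 s's; apply: H => //; exact: le_trans st.
- move=> t t0 t1 H; have /oO/nbhs_dist[e e0 eP] := H t t0 (lexx _).
  have [d' d'0 dP] := cgd t e e0.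
  exists (t + d' / 2); first by rewrite ltrDl divr_gt0.
  move=> s s0 st; have [st'|st'] := leP s t; first exact: H.
  by apply: eP; apply: dP => //; rewrite ltr_norml; lra.
- move=> t t0 t1 H s s0; rewrite le_eqVlt => /orP[/eqP -> {s s0}|st]; last exact: (H s).
  (* A limit of points of [O] lies in the closed image of {v_0 <= 0}; the path misses the image of
     the hyperplane v_0 = 0, which is part of the other half-space. *)
  have clN : closed (h @` @halfspace d (-1)) by exact: cone_image_closed pN cN eN hN.
  have [[v v0 vg]|nN] := pselect ((h @` @halfspace d (-1)) (g t)).
    exists v => //=; rewrite ltNge; apply/negP => v0'.
    by apply: (Yg t); exists v => //; rewrite /halfspace /= mul1r.
  have /nbhs_dist[e e0 eP] : nbhs (g t) (~` (h @` @halfspace d (-1))).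
    by apply: open_nbhs_nbhs; split => //; rewrite openC.
  have [d' d'0 dP] := cgd t e e0.
  pose s := Num.max 0 (t - d' / 2).
  have st : s < t by rewrite gt_max t0 /=; lra.
  have s0 : 0 <= s by rewrite le_max lexx.
  have sd : t - d' / 2 <= s by rewrite le_max lexx orbT.
  have [v v0 vg] := H s s0 st s s0 (lexx _).
  exfalso; apply: (eP (g s)); last by exists v => //; rewrite /halfspace /=; move: v0 => /=; lra.
  by apply: dP => //; rewrite ltr_norml; lra.
Qed.

(** Restricted to a hyperplane the map is already onto, against injectivity at a vector outside
    it. *)
Lemma no_linear_embedding d (h : 'rV[R]_d.+1 -> 'rV[R]_d) : embed setT h -> homog setT h -> False.
Proof.
move=> eh hh; have [ch ih rh] := eh.
have e0 : delta_mx 0 ord0 != 0 :> 'rV[R]_d.+1.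
  by apply/eqP => /rowP/(_ ord0)/eqP; rewrite !mxE eqxx oner_eq0.
have [pr [se [co [[lpr lse lco] [prse cose prp cop split]]]]] := line_split e0.
have e' : embed setT (h \o se).
  split.
  - by apply: (con_comp (B := setT)) ch => //; exact/continuous_con/lin_cts.
  - by move=> x y _ _ /ih => /(_ Logic.I Logic.I) /(congr1 pr); rewrite !prse.
  - move=> q _; have [r r0 rP] := rh (se q) Logic.I.
    have [r' r'0 r'P] := (con_distP setT _).1 (continuous_con (lin_cts lse)) 0 Logic.I r r0.
    exists r' => // v l vr _ l0 l1; rewrite /= !(linD lse) (linZ lse) (rP _ l)//.
    by have := r'P v Logic.I; rewrite (lin0 lse) !subr0; exact.
have h'' : homog setT (h \o se) by move=> k x k0 _; rewrite /= (linZ lse) hh.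
have [x _ /= hx] := linear_onto e' h'' (h (delta_mx 0 ord0)).
have := ih _ _ Logic.I Logic.I hx => /(congr1 co)/eqP.
by rewrite cose cop eq_sym oner_eq0.
Qed.

End linear_cones.

(** * Polyhedra and the cube *)

Section polyhedra.
Context {R : realType}.

(** Barycentric coordinates with that of the first vertex omitted, so that the parameter set of a
    simplex has interior; [spread] is the parametrization. *)
Definition corner n : set 'rV[R]_n := [set w | (forall i, 0 <= w 0 i) /\ \sum_i w 0 i <= 1].

Lemma lin_sum n : lin (fun w : 'rV[R]_n => \sum_i w 0 i).
Proof.
move=> k x y; rewrite scaleRE mulr_sumr -big_split /=.
by apply: eq_bigr => i _; rewrite !mxE.
Qed.

Lemma lin_coord n i : lin (fun w : 'rV[R]_n => w 0 i).
Proof. by move=> k x y; rewrite !mxE. Qed.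

Lemma polyh_corner n : polyh (@corner n).
Proof.
pose f (j : option 'I_n) (w : 'rV[R]_n) : R :=
  if j is Some i then w 0 i else - \sum_i w 0 i.
pose c (j : option 'I_n) : R := if j is Some i then 0 else 1.
have lf j : lin (f j).
  case: j => [i|] /=; first exact: lin_coord.
  by move=> k x y; rewrite /f lin_sum !scaleRE opprD mulrN.
have := polyh_affine c lf; congr polyh; apply/seteqP; split => w.
  move=> fw; split=> [i|]; first by have := fw (Some i); rewrite /= add0r.
  by have := fw None; rewrite /= subr_ge0.
by move=> [w0 w1] [i|] /=; rewrite ?add0r ?subr_ge0.
Qed.

Lemma compact_corner n : compact (@corner n).
Proof.
have [cl _ _] := polyh_corner n; apply: (compact_rows (M := 1) cl) => w [w0 w1].
case: n w w0 w1 {cl} => [|n] w w0 w1; first by rewrite [w]thinmx0 normr0 ler01.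
have [i ->] := coord_max w; rewrite ger0_norm//; apply: le_trans w1.
by rewrite (bigD1 i)//= lerDl sumr_ge0.
Qed.

Definition spread m (s : seq 'rV[R]_m) (w : 'rV[R]_((size s).-1)) : 'rV[R]_m :=
  s`_0 + \sum_i w 0 i *: (s`_i.+1 - s`_0).

Arguments spread {m} s w.

Lemma conv_hull_spread m (s : seq 'rV[R]_m) : s != [::] ->
  conv_hull s = spread s @` @corner (size s).-1.
Proof.
case: s => // s0 s _; apply/seteqP; split => [x [w [w0 w1 ->]]|_ [w [w0 w1] <-]].
  exists (\row_i w (lift ord0 i)).
    split=> [i|]; first by rewrite mxE.
    rewrite -w1 big_ord_recl /= -[leLHS]add0r; apply: lerD => //.
    by apply: ler_sum => i _; rewrite mxE.
  rewrite /spread /= big_ord_recl /=.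
  have -> : w ord0 = 1 - \sum_(i < size s) w (lift ord0 i).
    by rewrite -w1 big_ord_recl addrK.
  rewrite scalerBl scale1r -addrA; congr (_ + _).
  rewrite scaler_suml -sumrN -big_split /=; apply: eq_bigr => i _.
  by rewrite mxE scalerBr addrC.
have [F F0 FS] : exists2 F : 'I_(size s).+1 -> R, F ord0 = 1 - \sum_j w 0 j &
    forall j, F (lift ord0 j) = w 0 j.
  exists (fun i => if unlift ord0 i is Some j then w 0 j else 1 - \sum_j w 0 j).
    by rewrite unlift_none.
  by move=> j; rewrite liftK.
exists F; split.
- move=> i; case: (unliftP (ord0 : 'I_(size s).+1) i) => [j ->|->]; first by rewrite FS.
  by rewrite F0 subr_ge0.
- by rewrite big_ord_recl F0 (eq_bigr _ (fun j _ => FS j)) subrK.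
- transitivity ((1 - \sum_j w 0 j) *: s0 + \sum_(i < size s) w 0 i *: s`_i); last first.
    rewrite [RHS]big_ord_recl; congr (_ *: _ + _); first by rewrite F0.
    by apply: eq_bigr => j _; congr (_ *: _); exact/esym/FS.
  rewrite /spread scalerBl scale1r -addrA; congr (_ + _).
  rewrite scaler_suml -sumrN -big_split /=; apply: eq_bigr => i _.
  by rewrite scalerBr addrC.
Qed.

Lemma spread_affine m (s : seq 'rV[R]_m) x y (l : R) :
  spread s (x + l *: (y - x)) = spread s x + l *: (spread s y - spread s x).
Proof.
rewrite /spread opprD addrACA subrr add0r -sumrB -addrA; congr (_ + _).
rewrite scaler_sumr -big_split /=; apply: eq_bigr => i _.
by rewrite !mxE -scalerBl scalerA -scalerDl.
Qed.

Lemma spread_cts m (s : seq 'rV[R]_m) : continuous (spread s).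
Proof.
apply: add_cts; first exact: cst_continuous.
apply: (sum_cts (F := fun i (w : 'rV[R]_((size s).-1)) => w 0 i *: (s`_i.+1 - s`_0))) => i.
by apply: scale_cts; [exact: coord_cts|exact: cst_continuous].
Qed.

Lemma spread_embed m (s : seq 'rV[R]_m) D : s != [::] -> affine_indep s -> embed D (spread s).
Proof.
move=> s0 si; split; first exact/continuous_con/spread_cts.
  move=> x y _ _ /eqP; rewrite -subr_eq0 /spread opprD addrACA subrr add0r -sumrB => /eqP E.
  case: s D s0 si x y E => // s0 s _ _ si x y E.
  have [v v0 vS] : exists2 v : 'I_(size s).+1 -> R, v ord0 = - \sum_j (x 0 j - y 0 j) &
      forall j, v (lift ord0 j) = x 0 j - y 0 j.
    exists (fun i => if unlift ord0 i is Some j then x 0 j - y 0 j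
                     else - \sum_j (x 0 j - y 0 j)); first by rewrite unlift_none.
    by move=> j; rewrite liftK.
  have E1 : \sum_i v i = 0.
    by rewrite big_ord_recl v0 (eq_bigr _ (fun j _ => vS j)) addNr.
  have E2 : \sum_i v i *: (s0 :: s)`_i = 0.
    transitivity ((- \sum_j (x 0 j - y 0 j)) *: s0 +
                  \sum_(i < size s) (x 0 i - y 0 i) *: s`_i).
      rewrite big_ord_recl; congr (_ *: _ + _); first by rewrite v0.
      by apply: eq_bigr => j _; congr (_ *: _); exact: vS.
    rewrite -[RHS]E scaleNr scaler_suml -sumrN -big_split /=.
    by apply: eq_bigr => i _; rewrite -scalerBl scalerBr addrC.
  apply/rowP => i; have /eqP := si v E1 E2 (lift ord0 i).
  by rewrite vS subr_eq0 => /eqP.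
move=> q _; exists 1 => // v l _ _ _ _.
by have := @spread_affine _ s q (q + v) l; rewrite addrAC subrr add0r.
Qed.

Lemma compact_hull m (s : seq 'rV[R]_m) : compact (conv_hull s).
Proof.
have [->|s0] := eqVneq s [::].
  rewrite (_ : conv_hull _ = set0); first exact: compact0.
  apply/seteqP; split => // x [w [_ /eqP]].
  by rewrite big_ord0 eq_sym oner_eq0.
rewrite conv_hull_spread//; apply: compact_con_image; first exact: compact_corner.
exact/continuous_con/spread_cts.
Qed.

Lemma closed_hull m (s : seq 'rV[R]_m) : closed (conv_hull s).
Proof. by apply: compact_closed; [exact: norm_hausdorff|exact: compact_hull]. Qed.

Lemma convex_hull m (s : seq 'rV[R]_m) x y (l : R) : conv_hull s x -> conv_hull s y ->
  0 <= l -> l <= 1 -> conv_hull s (x + l *: (y - x)).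
Proof.
have [->|s0] := eqVneq s [::].
  by move=> [w [_ /eqP]]; rewrite big_ord0 eq_sym oner_eq0.
rewrite conv_hull_spread// => -[w Dw <-] [w' Dw' <-] l0 l1.
have [_ vx _] := polyh_corner (size s).-1.
by exists (w + l *: (w' - w)); [exact: vx|exact: spread_affine].
Qed.

Lemma cells_cons m (s : seq 'rV[R]_m) K : cells (s :: K) = conv_hull s `|` cells K.
Proof.
apply/seteqP; split => [x [t /=]|x].
  by rewrite inE => /orP[/eqP -> ?|tK tx]; [left|right; exists t].
by case=> [sx|[t tK tx]]; [exists s => //=; rewrite mem_head|exists t => //=; rewrite inE tK orbT].
Qed.

Lemma cells0 m : cells ([::] : seq (seq 'rV[R]_m)) = set0.
Proof. by apply/seteqP; split => // x [t]. Qed.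

Lemma compact_polyhedron m (P : set 'rV[R]_m) : polyhedron P -> compact P.
Proof.
case=> K ->; elim: K => [|s K IH]; first by rewrite cells0; exact: compact0.
by rewrite cells_cons; apply: compactU => //; exact: compact_hull.
Qed.

Lemma closed_polyhedron m (P : set 'rV[R]_m) : polyhedron P -> closed P.
Proof. by move=> /compact_polyhedron; apply: compact_closed; exact: norm_hausdorff. Qed.

Lemma polyhedronU m (P P' : set 'rV[R]_m) : polyhedron P -> polyhedron P' -> polyhedron (P `|` P').
Proof.
case=> K -> [K' ->]; exists (K ++ K'); apply/seteqP; split => x.
  by case=> -[s sK sx]; exists s => //=; rewrite mem_cat sK ?orbT.
by case=> s /=; rewrite mem_cat => /orP[sK|sK] sx; [left|right]; exists s.
Qed.

Lemma far_closed (V : normedModType R) (A : set V) p : closed A -> ~ A p ->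
  exists2 r : R, 0 < r & forall x, `|x - p| < r -> ~ A x.
Proof.
move=> cA nA; have /nbhs_dist[r r0 rP] : nbhs p (~` A).
  by apply: open_nbhs_nbhs; split => //; rewrite openC.
by exists r.
Qed.

(** The finitely many closed cells that miss [p] stay at a positive distance from it. *)
Lemma cells_near m (K : seq (seq 'rV[R]_m)) p : exists2 r : R, 0 < r &
  forall x s, s \in K -> `|x - p| < r -> conv_hull s x -> conv_hull s p.
Proof.
elim: K => [|s K [r r0 rP]]; first by exists 1.
have [sp|nsp] := pselect (conv_hull s p).
  by exists r => // x t; rewrite inE => /orP[/eqP -> //|tK]; exact: rP.
have [r' r'0 r'P] := far_closed (@closed_hull _ s) nsp.
exists (Num.min r r'); first by rewrite lt_min r0.
move=> x t; rewrite inE lt_min => /orP[/eqP ->|tK] /andP[xr xr'] tx.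
  by case: (r'P x xr').
exact: rP tx.
Qed.

Lemma polyhedron_star m (P : set 'rV[R]_m) p : polyhedron P -> exists2 r : R, 0 < r &
  forall x, `|x - p| < r -> P x -> P p /\
    forall l : R, 0 <= l -> l <= 1 -> P (p + l *: (x - p)).
Proof.
case=> K ->; have [r r0 rP] := cells_near K p; exists r => // x xr [s sK sx].
have sp := rP x s sK xr sx; split; first by exists s.
by move=> l l0 l1; exists s => //; exact: convex_hull.
Qed.

Lemma con_closedU (V W : normedModType R) (A B : set V) (f : V -> W) :
  closed A -> closed B -> con A f -> con B f -> con (A `|` B) f.
Proof.
move=> cA cB /con_distP fA /con_distP fB; apply/con_distP => x ABx e e0.
have near (C : set V) : closed C -> (forall x, C x -> forall e : R, 0 < e -> exists2 d : R, 0 < d &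
    forall y, C y -> `|y - x| < d -> `|f y - f x| < e) ->
    exists2 d : R, 0 < d & forall y, C y -> `|y - x| < d -> `|f y - f x| < e.
  move=> cC fC; have [Cx|nC] := pselect (C x); first exact: fC.
  by have [r r0 rP] := far_closed cC nC; exists r => // y Cy /rP.
have [d1 d10 d1P] := near A cA fA; have [d2 d20 d2P] := near B cB fB.
exists (Num.min d1 d2); first by rewrite lt_min d10.
by move=> y [Ay|By]; rewrite lt_min => /andP[y1 y2]; [exact: d1P|exact: d2P].
Qed.

Lemma pl_map_con m n (P : set 'rV[R]_m) (f : 'rV[R]_m -> 'rV[R]_n) : pl_map P f -> con P f.
Proof.
case=> K [-> fK]; elim: K fK => [|s K IH] fK; first by rewrite cells0.
rewrite cells_cons; apply: con_closedU.
- exact: closed_hull.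
- by apply: closed_polyhedron; exists K.
- have [A [b Ab]] := fK s (mem_head _ _).
  have ca : continuous (fun x : 'rV[R]_m => (x *m A + b : 'rV[R]_n)).
    apply: add_cts; last exact: cst_continuous.
    by apply: lin_cts => k x y; rewrite mulmxDl scalemxAl.
  apply: (@con_eq _ _ _ (fun x : 'rV[R]_m => (x *m A + b : 'rV[R]_n))).
    by move=> x sx; rewrite Ab.
  exact: continuous_con ca.
- by apply: IH => t tK; apply: fK; rewrite inE tK orbT.
Qed.

Lemma pl_map_radial m n (P : set 'rV[R]_m) (f : 'rV[R]_m -> 'rV[R]_n) p : pl_map P f ->
  exists2 r : R, 0 < r & radial_at P f p r.
Proof.
case=> K [-> fK]; have [r r0 rP] := cells_near K p; exists r => // v l vr [s sK sv] l0 l1.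
have pv : `|p + v - p| < r by rewrite addrC addKr.
have sp := rP _ s sK pv sv; have [A [b Ab]] := fK s sK.
have E : p + l *: v = p + l *: (p + v - p) by rewrite addrAC subrr add0r.
rewrite Ab; last by rewrite E; exact: convex_hull.
rewrite (Ab _ sp) (Ab _ sv) !mulmxDl -scalemxAl.
by rewrite opprD addrACA subrr addr0 [p *m A + v *m A - _]addrAC subrr add0r addrAC.
Qed.

Lemma pl_homeo_embed m n (P : set 'rV[R]_m) (Q : set 'rV[R]_n) f : pl_homeo P Q f ->
  embed P f.
Proof.
case=> fP /set_bij_inj fi _; split; first exact: pl_map_con.
  by move=> x y Px Py; apply: fi; rewrite inE.
by move=> q _; exact: pl_map_radial.
Qed.

Definition center n : 'rV[R]_n := const_mx 2^-1.

Lemma cubeE n : @cube R n = [set y | `|y - center n| <= 2^-1].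
Proof.
apply/seteqP; split => y /= yc; last first.
  move=> i; have := le_trans (coord_le (y - center n) i) yc.
  by rewrite !mxE ler_norml; lra.
case: n y yc => [|n] y yc; first by rewrite [y - _]thinmx0 normr0 invr_ge0.
have [i ->] := coord_max (y - center n.+1); have := yc i.
by rewrite !mxE ler_norml; lra.
Qed.

Lemma open_cubeE n (y : 'rV[R]_n) :
  (forall i, 0 < y 0 i < 1) <-> `|y - center n| < 2^-1.
Proof.
split=> yc; last first.
  move=> i; have := le_lt_trans (coord_le (y - center n) i) yc.
  by rewrite !mxE ltr_norml; lra.
case: n y yc => [|n] y yc; first by rewrite [y - _]thinmx0 normr0 invr_gt0.
have [i ->] := coord_max (y - center n.+1); have := yc i.
by rewrite !mxE ltr_norml; lra.
Qed.

Lemma polyh_cube n : polyh (@cube R n).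
Proof. by rewrite cubeE; apply: polyh_box; rewrite invr_ge0. Qed.

Lemma compact_cube n : compact (@cube R n).
Proof.
have [cl _ _] := polyh_cube n; apply: (compact_rows (M := 2^-1 + `|center n|) cl) => x.
rewrite cubeE /= => xc; rewrite -[x](subrK (center n)).
by rewrite (le_trans (ler_normD _ _))// lerD2r.
Qed.

End polyhedra.

Section tangents.
Context {R : realType}.

Lemma embed_comp (V1 V2 V3 : normedModType R) (D : set V1) (B : set V2) (k : V1 -> V2)
    (f : V2 -> V3) :
  embed D k -> embed B f -> (forall x, D x -> B (k x)) -> embed D (fun x => f (k x)).
Proof.
move=> [ck ik rk] [cf if_ rf] DB; split.
- exact: con_comp DB ck cf.
- by move=> x y Dx Dy /(if_ _ _ (DB _ Dx) (DB _ Dy)); exact: ik.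
move=> q Dq; have [r1 r10 R1] := rk q Dq; have [r2 r20 R2] := rf _ (DB _ Dq).
have [d d0 dP] := (con_distP D k).1 ck q Dq r2 r20.
exists (Num.min r1 d); first by rewrite lt_min r10.
move=> v l; rewrite lt_min => /andP[v1 vd] Dv l0 l1.
have E : k (q + v) = k q + (k (q + v) - k q) by rewrite [RHS]addrC subrK.
rewrite R1// R2//; first by rewrite -E.
  by apply: dP => //; rewrite addrC addKr.
by rewrite -E; exact: DB.
Qed.

Lemma tan_sub (V : normedModType R) (D D' : set V) q : D `<=` D' -> tan D q `<=` tan D' q.
Proof. by move=> DD v [l l0 /DD]; exists l. Qed.

Lemma small_multiple (V : normedModType R) (v : V) (r : R) : 0 < r ->
  exists2 s : R, 0 < s /\ s <= 1 & `|s *: v| < r.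
Proof.
move=> r0; have p0 : 0 < 1 + `|v| by rewrite ltr_pwDl.
exists (Num.min 1 (r / 2 / (1 + `|v|))).
  by rewrite lt_min ltr01 !divr_gt0//= ge_min lexx.
have m0 : 0 < Num.min 1 (r / 2 / (1 + `|v|)) by rewrite lt_min ltr01 !divr_gt0.
rewrite normrZ gtr0_norm//; apply: (@le_lt_trans _ _ (r / 2 / (1 + `|v|) * (1 + `|v|))).
  apply: ler_pM => //; first exact: ltW.
    by rewrite ge_min lexx orbT.
  by rewrite lerDr.
by rewrite divfK ?gt_eqF//; lra.
Qed.

Lemma tan_box (V : normedModType R) (D : set V) q (rho : R) : polyh D -> D q -> 0 < rho ->
  tan (D `&` [set y | `|y - q| <= rho]) q = tan D q.
Proof.
move=> [_ vx _] Dq r0; apply/seteqP; split; first by apply: tan_sub => x [].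
move=> v [l l0 Dv]; have [s [s0 s1] sr] := small_multiple (l *: v) r0.
exists (s * l); first exact: mulr_gt0.
split; last by rewrite /= addrC addKr -scalerA ltW.
have := vx _ _ s Dq Dv (ltW s0) s1.
by rewrite addrAC subrr add0r scalerA.
Qed.

Lemma tan_full (V : normedModType R) (D : set V) q (r : R) : 0 < r ->
  (forall y, `|y - q| < r -> D y) -> tan D q = setT.
Proof.
move=> r0 rD; apply/seteqP; split => // v _.
have [s [s0 s1] sr] := small_multiple v r0.
by exists s => //; apply: rD; rewrite addrC addKr.
Qed.

Lemma pointed_tan n (D : set 'rV[R]_n) q y0 (l : 'rV[R]_n -> R) : lin l ->
  (forall y, D y -> l q <= l y) -> D y0 -> l q < l y0 -> pointed (tan D q).
Proof.
move=> ll lD Dy0 ly0; exists l, (y0 - q); split => //.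
- by exists 1 => //; rewrite scale1r addrC subrK.
- by rewrite (linB ll) subr_gt0.
- move=> v [k k0 /lD]; rewrite (linD ll) (linZ ll) scaleRE lerDl.
  by rewrite pmulr_rge0.
Qed.

(** The dichotomy behind invariance of the boundary: the tangent cone is the whole space inside and
    pointed on the boundary, and no homogeneous embedding of a pointed cone fills R^d. *)
Lemma tan_cube n (q : 'rV[R]_n) : cube q ->
  (`|q - center n| < 2^-1 /\ tan (@cube R n) q = setT) \/
  (`|q - center n| = 2^-1 /\ pointed (tan (@cube R n) q)).
Proof.
rewrite cubeE /= le_eqVlt => /orP[/eqP qc|qc]; [right|left]; split=> //.
  case: n q qc => [|n] q qc.
    by move: qc; rewrite [q - _]thinmx0 normr0 => /esym/eqP; rewrite invr_eq0 pnatr_eq0.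
  have [i qi] := coord_max (q - center n.+1).
  have lc : lin (fun v : 'rV[R]_n.+1 => v 0 i) := lin_coord i.
  (* The sign for which s * y_i attains its minimum over the cube on the face through [q]. *)
  pose s : R := if 0 <= (q - center n.+1) 0 i then -1 else 1.
  have ls : lin (fun v : 'rV[R]_n.+1 => s * v 0 i).
    by move=> k x y; rewrite !mxE !scaleRE mulrDr mulrCA.
  apply: (@pointed_tan _ _ _ (center n.+1) _ ls).
  - rewrite -cubeE => y /(_ i); move: qi; rewrite qc /s !mxE.
    by case: (lerP 0 (q 0 i - 2^-1)) => ?; [rewrite ger0_norm//|rewrite ltr0_norm//]; lra.
  - by rewrite /= subrr normr0 invr_ge0.
  - move: qi; rewrite qc /s !mxE.
    by case: (lerP 0 (q 0 i - 2^-1)) => ?; [rewrite ger0_norm//|rewrite ltr0_norm//]; lra.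
apply: (@tan_full _ _ _ (2^-1 - `|q - center n|)); first by rewrite subr_gt0.
move=> y yq /=; rewrite -[y](subrK q) -addrA (le_trans (ler_normD _ _))//.
by rewrite -lerBrDr ltW.
Qed.

(** In the typical use [k] is the inverse of a chart and [phi] another chart. A small box around [q]
    keeps k inside [Y]; properness of [k] and of the composite discards the rest of [D], so the germ
    of the image is that of the tangent cone even with preimages confined to an eps-ball. *)
Lemma compare m e a (Y : set 'rV[R]_m) (phi : 'rV[R]_m -> 'rV[R]_e) (D : set 'rV[R]_a)
    (k : 'rV[R]_a -> 'rV[R]_m) q (r : R) :
  embed Y phi -> polyh D -> compact D -> embed D k -> D q -> 0 < r ->
  (forall z, D z -> `|k z - k q| < r -> Y (k z)) ->
  exists h (r0 : R), [/\ 0 < r0, polyh (tan D q) /\ cone (tan D q),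
    embed (tan D q) h /\ homog (tan D q) h &
    forall eps : R, 0 < eps -> eps <= r0 -> exists2 del : R, 0 < del &
    forall y, `|y| < del -> (h @` tan D q) y <->
      exists z, [/\ D z, `|k z - k q| < eps & phi (k z) = phi (k q) + y]].
Proof.
move=> eY pD cD ek Dq r_gt0 DY; have [ck ik _] := ek.
have [rho rho0 rhoP] := (con_distP D k).1 ck q Dq r r_gt0.
pose D' := D `&` [set y | `|y - q| <= rho / 2].
have rho2 : 0 < rho / 2 by rewrite divr_gt0.
have D'k z : D' z -> Y (k z).
  move=> [Dz zq]; apply: DY => //; apply: rhoP => //.
  by apply: le_lt_trans zq _; lra.
have pD' : polyh D' by apply: polyhI => //; apply: polyh_box; exact: ltW.
have cD' : compact D'.
  apply: (subclosed_compact _ cD) => [|z []//].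
  by case: pD'.
have D'q : D' q by split => //=; rewrite subrr normr0 ltW.
have ek' : embed D' k by apply: embed_sub ek => z [].
have eF : embed D' (fun z => phi (k z)) := embed_comp ek' eY D'k.
have [cF iF _] := eF.
have proper := proper_compact cD' cF iF D'q.
have [h [r1 [r10 pc eh _ hP]]] := germ pD' eF D'q proper.
have ET : tan D' q = tan D q by exact: tan_box.
rewrite ET in pc eh hP.
have [r0 r00 r0P] := proper_compact cD ck ik Dq rho2.
exists h, r0; split => // eps eps0 epsr.
have [d d0 dP] := (con_distP D k).1 ck q Dq eps eps0.
have [d' d'0 d'P] := proper d d0.
exists (Num.min r1 d'); first by rewrite lt_min r10.
move=> y; rewrite lt_min => /andP[yr yd]; rewrite -hP//; split.
  move=> [z D'z zy]; exists z; split => //; first by case: D'z.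
  apply: dP; first by case: D'z.
  by apply: d'P => //; rewrite zy addrC addKr.
move=> [z [Dz zq zy]]; exists z => //; split => //=; apply: ltW.
by apply: r0P => //; exact: lt_le_trans epsr.
Qed.

Lemma scaling_full (V : normedModType R) (C : set V) (r : R) : scaling C -> 0 < r ->
  (forall y, `|y| < r -> C y) -> forall y, C y.
Proof.
move=> sC r0 rC y; have [s [s0 s1] sr] := small_multiple y r0.
have := sC s^-1 _ (_ : 0 < s^-1) (rC _ sr); rewrite scalerA mulVf ?gt_eqF// scale1r.
by apply; rewrite invr_gt0.
Qed.

End tangents.

(** * Charts and boundaries *)

Section charts.
Context {R : realType} {m : nat}.
Implicit Types (N B U : set 'rV[R]_m) (p x : 'rV[R]_m).

(** A chart with its inverse and a metric radius in place of a neighbourhood; of piecewise linearity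
    only [embed] is retained. *)
Definition pchart d N p U (f : 'rV[R]_m -> 'rV[R]_d) (g : 'rV[R]_d -> 'rV[R]_m) (r : R) :=
  [/\ U `<=` N, 0 < r /\ (forall x, N x -> `|x - p| < r -> U x),
      forall x, U x -> cube (f x) /\ g (f x) = x,
      forall y, cube y -> U (g y) /\ f (g y) = y & embed U f /\ embed (@cube R d) g].

Lemma chart_pchart d N p U (f : 'rV[R]_m -> 'rV[R]_d) : chart N p U f ->
  exists g r, pchart N p U f g r.
Proof.
case=> UN /nbhs_dist[r r0 rP] hf; have ef := pl_homeo_embed hf.
case: hf => fP [fU fi fs] [g [gP gf]].
have fg y : cube y -> U (g y) /\ f (g y) = y.
  by move=> /fs[x Ux <-]; rewrite gf.
exists g, r; split => //.
- by split=> // x Nx xr; exact: rP.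
- by move=> x Ux; split; [exact: fU|exact: gf].
split=> //; split; first exact: pl_map_con.
  by move=> y y' /fg[_ E] /fg[_ E'] gg; rewrite -E -E' gg.
by move=> q _; exact: pl_map_radial.
Qed.

Lemma pchart_move d N p U (f : 'rV[R]_m -> 'rV[R]_d) g r x :
  pchart N p U f g r -> `|x - p| < r -> pchart N x U f g (r - `|x - p|).
Proof.
case=> UN [r0 NU] fU gU e xp; split => //; split; first by rewrite subr_gt0.
move=> y Ny yx; apply: NU => //; rewrite -[y](subrK x) -addrA.
by rewrite (le_lt_trans (ler_normD _ _))// -ltrBrDr.
Qed.

Lemma manifold_pchart d N p : pl_manifold d N -> N p -> exists U (f : 'rV[R]_m -> 'rV[R]_d) g r,
  pchart N p U f g r /\
  forall x, N x -> `|x - p| < r -> `|f x - center d| < 2^-1 -> pl_interior d N x.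
Proof.
move=> [_ H] /H[U [f cf]]; have [g [r gr]] := chart_pchart cf.
exists U, f, g, r; split => // x Nx xr fx; split => //; exists U, f; split; last exact/open_cubeE.
case: cf gr => UN _ hf [_ [r0 NU] _ _ _]; split => //.
apply/nbhs_dist; exists (r - `|x - p|); first by rewrite subr_gt0.
move=> y yx Ny; apply: NU => //; rewrite -[y](subrK x) -addrA.
by rewrite (le_lt_trans (ler_normD _ _))// -ltrBrDr.
Qed.

Lemma interior_pchart d N p : pl_interior d N p -> exists U (f : 'rV[R]_m -> 'rV[R]_d) g r,
  pchart N p U f g r /\ `|f p - center d| < 2^-1.
Proof.
case=> _ [U [f [/chart_pchart[g [r gr]] /open_cubeE fp]]].
by exists U, f, g, r.
Qed.

(* [B] has a PL chart onto a neighborhood in R^d of the image of [p]. *)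
Definition flat d B p := exists (phi : 'rV[R]_m -> 'rV[R]_d) (r : R),
  [/\ 0 < r, embed (B `&` [set x | `|x - p| < r]) phi &
      forall eps : R, 0 < eps -> exists2 del : R, 0 < del &
        forall y, `|y - phi p| < del -> exists x, [/\ B x, `|x - p| < eps & phi x = y]].

Lemma flat_interior d N p U (f : 'rV[R]_m -> 'rV[R]_d) g r : pchart N p U f g r -> N p ->
  `|f p - center d| < 2^-1 -> flat d N p.
Proof.
case=> UN [r0 NU] fU gU [ef eg] Np fp.
have Up : U p by apply: NU => //; rewrite subrr normr0.
have [cfp gfp] := fU p Up.
exists f, r; split => //; first by apply: embed_sub ef => x [Nx]; exact: NU.
move=> eps eps0; have [cg _ _] := eg.
have [del del0 delP] := (con_distP _ g).1 cg _ cfp eps eps0.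
exists (Num.min del (2^-1 - `|f p - center d|)); first by rewrite lt_min del0 subr_gt0.
move=> y; rewrite lt_min => /andP[y1 y2].
have cy : cube y.
  rewrite cubeE /= -[y](subrK (f p)) -addrA (le_trans (ler_normD _ _))//.
  by rewrite -lerBrDr ltW.
have [Ug fg] := gU y cy; exists (g y); split => //; first exact: UN.
by rewrite -gfp; exact: delP.
Qed.

(** If f p were on the boundary of the cube, [N] near [p] would be, in the flat chart of [B], the
    image of a pointed cone, which does not fill R^d; but [B] coincides with [N] near [p]. *)
Lemma flat_interior_at d N B p U (f : 'rV[R]_m -> 'rV[R]_d) g r (s : R) : flat d B p ->
  pchart N p U f g r -> N p -> 0 < s -> (forall x, `|x - p| < s -> N x <-> B x) ->
  `|f p - center d| < 2^-1.
Proof.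
move=> [phi [rf [rf0 ephi phiP]]] [UN [r0 NU] fU gU [ef eg]] Np s0 NB.
have Up : U p by apply: NU => //; rewrite subrr normr0.
have [cfp gfp] := fU p Up.
case: (tan_cube cfp) => [[]//|[_ pt]]; exfalso.
have m0 : 0 < Num.min rf s by rewrite lt_min rf0.
have [|h [e0 [e00 [pT cT] [eh hh] hP]]] := compare ephi (polyh_cube d) (@compact_cube R d) eg cfp m0.
  move=> z cz; rewrite gfp lt_min => /andP[z1 z2]; split => //.
  by apply/NB => //; apply: UN; case: (gU z cz).
have [del del0 delP] := hP e0 e00 (lexx _).
have e'0 : 0 < Num.min e0 (Num.min r s) by rewrite !lt_min e00 r0.
have [d' d'0 d'P] := phiP _ e'0.
have [sI _] := scaling_image cT hh.
apply: (pointed_not_onto pT cT eh hh pt).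
apply: (@scaling_full _ _ _ (Num.min del d')) => //; first by rewrite lt_min del0.
move=> y; rewrite lt_min => /andP[y1 y2]; apply/(delP y y1).
have [|x [Bx]] := d'P (phi p + y); first by rewrite addrC addKr.
rewrite !lt_min => /and3P[x1 x2 x3] xy.
have Ux : U x by apply: NU => //; apply/NB.
by have [cx gx] := fU x Ux; exists (f x); rewrite gx gfp.
Qed.

(** At an interior point the tangent cone is the whole space, whose image in the flat chart of [B]
    is everything by [linear_onto]; injectivity of [phi] identifies preimages. *)
Lemma flat_open d N B p U (f : 'rV[R]_m -> 'rV[R]_d) g r (s : R) : flat d B p ->
  pchart N p U f g r -> N p -> 0 < s -> (forall x, `|x - p| < s -> N x -> B x) ->
  `|f p - center d| < 2^-1 ->
  exists2 s' : R, 0 < s' & forall x, `|x - p| < s' -> B x -> N x.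
Proof.
move=> [phi [rf [rf0 ephi phiP]]] [UN [r0 NU] fU gU [ef eg]] Np s0 NB fp.
have Up : U p by apply: NU => //; rewrite subrr normr0.
have [cfp gfp] := fU p Up.
have pT : tan (@cube R d) (f p) = setT.
  by case: (tan_cube cfp) => [[]//|[E _]]; rewrite E ltxx in fp.
have m0 : 0 < Num.min rf s by rewrite lt_min rf0.
have inY z : cube z -> `|g z - p| < Num.min rf s -> (B `&` [set x | `|x - p| < rf]) (g z).
  move=> cz; rewrite lt_min => /andP[z1 z2]; split => //.
  by apply: NB => //; apply: UN; case: (gU z cz).
have [|h [e0 [e00 _ [eh hh] hP]]] := compare ephi (polyh_cube d) (@compact_cube R d) eg cfp m0.
  by rewrite gfp.
rewrite pT in eh hh hP.
have e'0 : 0 < Num.min e0 (Num.min rf s) by rewrite lt_min e00.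
have [|del del0 delP] := hP _ e'0; first by rewrite ge_min lexx.
have [cphi iphi _] := ephi.
have Bp : B p by apply: NB => //; rewrite subrr normr0.
have [|d' d'0 d'P] := (con_distP _ phi).1 cphi p _ del del0.
  by split => //=; rewrite subrr normr0.
exists (Num.min rf d'); first by rewrite lt_min rf0.
move=> x; rewrite lt_min => /andP[x1 x2] Bx.
have [|z [cz]] := (delP (phi x - phi p) _).1 (linear_onto eh hh _).
  exact: d'P.
rewrite gfp lt_min => /andP[_ z1]; rewrite [RHS]addrC subrK => zx.
have <- : g z = x by apply: iphi => //; exact: inY.
by apply: UN; case: (gU z cz).
Qed.

(** As [p] may lie on the boundary of [N], the cube point f' p is moved slightly towards the center;
    the tangent cone at the new point [q] is all of R^(d+1), which would embed in R^d. *)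
Lemma dimension_drop d N B p U (f : 'rV[R]_m -> 'rV[R]_d) g r U' (f' : 'rV[R]_m -> 'rV[R]_d.+1)
    g' r' (s : R) :
  pchart B p U f g r -> pchart N p U' f' g' r' -> N p -> 0 < s ->
  (forall x, `|x - p| < s -> N x -> B x) -> False.
Proof.
move=> [_ [r0 BU] _ _ [ef _]] [UN [r'0 NU] fU gU [_ eg]] Np s0 NB.
have Up : U' p by apply: NU => //; rewrite subrr normr0.
have [cfp gfp] := fU p Up.
have m0 : 0 < Num.min s r / 2 by rewrite divr_gt0// lt_min s0.
have [cg _ _] := eg.
have [del del0 delP] := (con_distP _ g').1 cg _ cfp _ m0.
have [l [l0 l1] lv] := small_multiple (center d.+1 - f' p) del0.
pose q := f' p + l *: (center d.+1 - f' p).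
have [_ vx _] := polyh_cube (R := R) d.+1.
have cc : cube (center d.+1 : 'rV[R]_d.+1) by rewrite cubeE /= subrr normr0 invr_ge0.
have cq : cube q by apply: vx => //; exact: ltW.
have qp : `|g' q - p| < Num.min s r / 2.
  by rewrite -gfp; apply: delP => //; rewrite /q addrC addKr.
have qc : `|q - center d.+1| < 2^-1.
  have -> : q - center d.+1 = (1 - l) *: (f' p - center d.+1).
    by rewrite /q scalerBl scale1r -addrA [l *: _ + _]addrC addrA -[in RHS]scalerN opprB.
  rewrite normrZ ger0_norm ?subr_ge0//.
  move: cfp; rewrite cubeE /= => cfp.
  apply: (@le_lt_trans _ _ ((1 - l) * 2^-1)); first by apply: ler_wpM2l => //; rewrite subr_ge0.
  lra.
have pT : tan (@cube R d.+1) q = setT.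
  by case: (tan_cube cq) => [[]//|[E _]]; rewrite E ltxx in qc.
have [|h [e0 [_ _ [eh hh] _]]] := compare ef (polyh_cube d.+1) (@compact_cube R d.+1) eg cq m0.
  move=> z cz zq; have Nz : N (g' z) by apply: UN; case: (gU z cz).
  have := dist_trans zq qp; rewrite -splitr lt_min => /andP[z1 z2].
  by apply: BU => //; exact: NB.
by rewrite pT in eh hh; exact: no_linear_embedding eh hh.
Qed.

End charts.

Section boundary.
Context {R : realType}.

Lemma lin_inj_embed (V W : normedModType R) (D : set V) (g : V -> W) : continuous g -> lin g ->
  (forall x y, D x -> D y -> g x = g y -> x = y) -> embed D g.
Proof.
move=> cg lg gi; split=> //; first exact: continuous_con.
move=> q _; exists 1 => // v l _ _ _ _.
by rewrite !(linD lg) (linZ lg) [g q + g v]addrC addrK.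
Qed.

(* The projection along the direction from [q] to the center is a chart of the boundary of
   the cube near [q]: by convexity a line in that direction meets the boundary once there. *)
Lemma cube_boundary_flat d (q : 'rV[R]_d.+1) : `|q - center d.+1| = 2^-1 ->
  exists pr : 'rV[R]_d.+1 -> 'rV[R]_d,
  embed ([set y | `|y - center d.+1| = 2^-1] `&` [set y | `|y - q| <= 4^-1]) pr /\
  forall eps : R, 0 < eps -> exists2 del : R, 0 < del & forall z, `|z - pr q| < del ->
    exists y, [/\ `|y - center d.+1| = 2^-1, `|y - q| < eps & pr y = z].
Proof.
move=> qc; set c := center d.+1; pose u := c - q.
have nu : `|u| = 2^-1 by rewrite /u -normrN opprB.
have u0 : u != 0 by rewrite -normr_gt0 nu invr_gt0.
have [pr [se [co [[lpr lse lco] [prse cose pru cou splitE]]]]] := line_split u0.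
have cpr : continuous pr := lin_cts lpr.
have cse : continuous se := lin_cts lse.
exists pr; split.
  (* Since y - c = (1 - t) (x - c) + t (x - q), its norm is at most (1 - t) / 2 + t / 4, less than
     1/2 for 0 < t <= 1. *)
  have key x y (t : R) : `|x - c| = 2^-1 -> `|y - c| = 2^-1 -> `|x - q| <= 4^-1 ->
      `|y - q| <= 4^-1 -> y = x + t *: u -> ~ 0 < t.
    move=> xc yc xq yq E t0.
    have t1 : t <= 1.
      have : `|y - x| <= 2^-1.
        have -> : y - x = (y - q) - (x - q) by rewrite opprB addrA subrK.
        by rewrite (le_trans (ler_normB _ _))//; lra.
      by rewrite E addrC addKr normrZ nu gtr0_norm//; lra.
    have : y - c = (1 - t) *: (x - c) + t *: (x - q).
      rewrite E /u !scalerBr !scalerBl !scale1r; apply/rowP => i; rewrite !mxE; ring.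
    move/(congr1 (fun v => `|v|)); rewrite yc => Ey.
    have : 2^-1 <= (1 - t) * 2^-1 + t * 4^-1 :> R.
      rewrite [leLHS]Ey (le_trans (ler_normD _ _))// !normrZ xc (gtr0_norm t0) ger0_norm ?subr_ge0//.
      by rewrite lerD2l ler_wpM2l// ltW.
    by nra.
  apply: lin_inj_embed => // x y [/= xc xq] [/= yc yq] prE.
  have E : y = x + (co y - co x) *: u.
    move: (splitE x) (splitE y); rewrite prE; move: (se (pr y)) (co x) (co y) => a cx cy.
    by move=> {1}-> {1}->; rewrite scalerBl -addrA [cx *: u + _]addrC subrK.
  have [h|h|h] := ltgtP (co x) (co y).
  - by case: (key x y _ xc yc xq yq E); rewrite subr_gt0.
  - case: (key y x (co x - co y)) => //; last by rewrite subr_gt0.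
    by rewrite {1}E -addrA -scalerDl addrA subrK subrr scale0r addr0.
  - by rewrite E h subrr scale0r addr0.
move=> eps eps0; pose e := Num.min 1 eps / 2.
have e0 : 0 < e by rewrite divr_gt0// lt_min ltr01.
have e1 : e < 1 by rewrite /e ltr_pdivrMr// mul1r gt_min; apply/orP; left; lra.
have ee : e < eps by rewrite /e ltr_pdivrMr// gt_min; apply/orP; right; lra.
have e20 : 0 < e / 2 by rewrite divr_gt0.
have [del del0 delP] := (nbhs_dist _ _).1 (cse (pr q) _ (nbhsx_ballx (se (pr q)) _ e20)).
exists del => // z zd; pose y0 := se z + co q *: u.
have y0q : `|y0 - q| < e / 2.
  have := delP z zd; rewrite /= -ball_normE /= distrC => H.
  by rewrite /y0 [X in _ - X]splitE opprD addrACA subrr addr0.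
pose F (t : R) : R := `|y0 + t *: u - c|.
have cF : continuous F.
  move=> t; apply: (comp_continuous (f := fun t : R => y0 + t *: u - c)) (norm_continuous (V := _)) _.
  apply: sub_cts; last exact: cst_continuous.
  apply: add_cts; first exact: cst_continuous.
  by apply: scale_cts; [move=> ?|exact: cst_continuous].
have FE t : y0 + t *: u - c = (y0 - q) - (1 - t) *: u.
  rewrite /u; apply/rowP => i; rewrite !mxE; ring.
(* As |y0 - q| < e / 2 and |u| = 1/2, the point at -e on the line is not interior to the cube and
   the point at e is in the cube: the line meets the boundary in between. *)
have Fm : 2^-1 <= F (- e).
  rewrite /F FE -normrN opprB (le_trans _ (lerB_dist _ _))// normrZ nu opprK gtr0_norm; last by lra.
  by lra.
have Fp : F e <= 2^-1.
  rewrite /F FE (le_trans (ler_normB _ _))// normrZ nu gtr0_norm; last by rewrite subr_gt0.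
  by lra.
have [|||t /itvP tI Ft] := @IVT R F (- e) e 2^-1.
- by lra.
- exact: continuous_subspaceT.
- by rewrite ge_min le_max Fp Fm orbT.
exists (y0 + t *: u); split => //; last by rewrite (linD lpr) (linZ lpr) pru scaler0 addr0 /y0
  (linD lpr) prse (linZ lpr) pru scaler0 addr0.
rewrite addrAC (le_lt_trans (ler_normD _ _))// normrZ nu.
have : `|t| <= e by rewrite ler_norml !tI.
lra.
Qed.

End boundary.

Section manifold_boundary.
Context {R : realType} {m : nat}.
Implicit Types (N B : set 'rV[R]_m) (p : 'rV[R]_m).

(** [pl_interior] asks for some chart; by invariance of domain the chart at [p] decides the matter
    for all points near [p]. *)
Lemma manifold_chart d N p : pl_manifold d N -> N p ->
  exists U (f : 'rV[R]_m -> 'rV[R]_d) g r, pchart N p U f g r /\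
  forall x, N x -> `|x - p| < r -> pl_boundary d N x <-> `|f x - center d| = 2^-1.
Proof.
move=> mN Np; have [U [f [g [r [pc intx]]]]] := manifold_pchart mN Np.
exists U, f, g, r; split => // x Nx xr; have pcx := pchart_move pc xr.
case: (pc) => UN [r0 NU] fU _ _; have [cfx _] := fU x (NU x Nx xr).
split=> [[_ nI]|E].
  by case: (tan_cube cfx) => [[fx _]|[]//]; case: nI; exact: intx.
split => // /interior_pchart[U' [f' [g' [r' [pc' fx]]]]].
have := flat_interior_at (flat_interior pc' Nx fx) pcx Nx (ltr01 : 0 < 1 :> R).
by move=> /(_ (fun _ _ => iff_refl _)); rewrite E ltxx.
Qed.

Lemma flat_boundary d N p : pl_manifold d.+1 N -> pl_boundary d.+1 N p ->
  flat d (pl_boundary d.+1 N) p.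
Proof.
move=> mN bp; have Np : N p by case: bp.
have [U [f [g [r [[UN [r0 NU] fU gU [ef eg]] bE]]]]] := manifold_chart mN Np.
have Up : U p by apply: NU => //; rewrite subrr normr0.
have [cfp gfp] := fU p Up.
have fpc : `|f p - center d.+1| = 2^-1 by apply/bE => //; rewrite subrr normr0.
have [pr [epr prP]] := cube_boundary_flat fpc.
have [cf _ _] := ef; have [cg _ _] := eg.
have q0 : 0 < 4^-1 :> R by rewrite invr_gt0.
have [d1 d10 d1P] := (con_distP _ f).1 cf p Up _ q0.
exists (fun x => pr (f x)), (Num.min r d1); split; first by rewrite lt_min r0.
  apply: embed_comp epr _.
    by apply: embed_sub ef => x [[Nx _]] /=; rewrite lt_min => /andP[x1 _]; exact: NU.
  move=> x [bx] /=; rewrite lt_min => /andP[x1 x2]; have [Nx _] := bx; split.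
    exact/bE.
  by apply/ltW/d1P => //; exact: NU.
move=> eps eps0; have er0 : 0 < Num.min eps r by rewrite lt_min eps0.
have [d2 d20 d2P] := (con_distP _ g).1 cg _ cfp _ er0.
have [d3 d30 d3P] := prP _ d20.
exists d3 => // z /d3P[y [yc yd yz]].
have cy : cube y by rewrite cubeE /= yc.
have [Ug fg] := gU y cy; have Ng := UN _ Ug.
have := d2P y cy yd; rewrite gfp lt_min => /andP[g1 g2].
by exists (g y); split => //; [apply/bE => //; rewrite fg|rewrite fg].
Qed.

End manifold_boundary.

(** * Cylinders over a boundary *)

Section continuity_lemmas.
Context {R : realType} {V : topologicalType} {W W' : normedModType R}.
Implicit Types (A : set V).

Lemma con_add A (f g : V -> W) : con A f -> con A g -> con A (fun x => f x + g x).
Proof. by move=> cf cg x Ax; apply: cvgD; [exact: cf|exact: cg]. Qed.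

Lemma con_scale A (k : V -> R) (f : V -> W) : con A k -> con A f -> con A (fun x => k x *: f x).
Proof. by move=> ck cf x Ax; apply: cvgZ; [exact: ck|exact: cf]. Qed.

Lemma con_pair A (f : V -> W) (g : V -> W') : con A f -> con A g -> con A (fun x => (f x, g x)).
Proof. by move=> cf cg x Ax; apply: cvg_pair; [exact: cf|exact: cg]. Qed.

End continuity_lemmas.

Section cylinders.
Context {R : realType}.

Lemma defo_conn (W : normedModType R) (Y Z : set W) (F : R * W -> W) :
  con [set z : R * W | 0 <= z.1 <= 1 /\ Y z.2] F ->
  (forall s x, 0 <= s <= 1 -> Y x -> Y (F (s, x))) -> (forall x, Y x -> F (0, x) = x) ->
  (forall x, Y x -> Z (F (1, x))) -> Z `<=` Y ->
  conn0 (R := R) Z /\ conn1 (R := R) Z Z -> conn0 (R := R) Y /\ conn1 (R := R) Y Y.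
Proof.
move=> cF FY F0 FZ ZY [c0 c1].
have c01 : 0 <= (1 : R) <= 1 by rewrite ler01 lexx.
split=> [x y Yx Yy|p q pY qY E0 E1].
  have tr a : Y a -> pth Y (fun s : R => F (clamp s, a)).
    move=> Ya; split; last by move=> t; apply: FY => //; exact: clamp_in.
    apply: con_total cF; last by move=> t; split => //; exact: clamp_in.
    by apply: pair_continuous; [exact: clamp_continuous|exact: cst_continuous].
  have [p [pZ p0 p1]] := c0 _ _ (FZ _ Yx) (FZ _ Yy).
  have pxy : cat (fun s : R => F (clamp s, x)) p 1 = rev (fun s : R => F (clamp s, y)) 0.
    by rewrite cat1 /rev p1 subr0 (clamp_ge1 (lexx _)).
  have pxp : F (clamp (1 : R), x) = p 0 by rewrite p0 (clamp_ge1 (lexx _)).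
  exists (cat (cat (fun s : R => F (clamp s, x)) p) (rev (fun s : R => F (clamp s, y)))); split.
  - apply: pth_cat pxy; last exact/pth_rev/tr.
    by apply: pth_cat pxp; [exact: tr|exact: pth_sub pZ].
  - by rewrite !cat0 (clamp_le0 (lexx _)) F0.
  - by rewrite cat1 /rev subrr (clamp_le0 (lexx _)) F0.
have Fp (s : R -> W) : pth Y s -> pth Z (fun t => F (1, s t)).
  move=> [cs sY]; split; last by move=> t; exact: FZ.
  apply: con_total cF; last by move=> t; split => //; exact: sY.
  by apply: pair_continuous cs; exact: cst_continuous.
apply: (hmt_defo cF FY F0 pY qY E0 E1); apply: hmt_sub ZY _.
by apply: (c1 _ _ (Fp _ pY) (Fp _ qY)); rewrite ?E0 ?E1.
Qed.

Lemma lcc_polyhedron m (P : set 'rV[R]_m) z : polyhedron P -> P z -> lcc true P id [set z].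
Proof.
move=> pP Pz; have [r r0 rP] := polyhedron_star z pP.
move=> e e0; have d0 : 0 < Num.min e r by rewrite lt_min e0.
have st : star (over P id z (Num.min e r)) z.
  split; first by split => //=; rewrite subrr normr0.
  move=> x s [Px]; rewrite lt_min => /andP[xe xr] s0 s1.
  have [_ seg] := rP x xr Px.
  have E : x + s *: (z - x) = z + (1 - s) *: (x - z).
    by apply/rowP => i; rewrite !mxE; ring.
  split; first by rewrite E; apply: seg; lra.
  rewrite /= E addrAC subrr add0r normrZ ger0_norm ?subr_ge0//.
  apply: (@le_lt_trans _ _ `|x - z|); last by rewrite lt_min xe.
  by rewrite ler_piMl//; lra.
have [c0 c1] := star_conn st; have [zz _] := st.
have le : over P id z (Num.min e r) `<=` over P id z e by apply: over_le; rewrite ge_min lexx.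
exists (Num.min e r) => // _ ->; split.
- by exists z; exact: le.
- move=> x y Px Py; have [p [pp p0 p1]] := c0 x y Px Py.
  by exists p; split => //; exact: pth_sub pp.
- by move=> _; exact: conn1_sub c1.
Qed.

(* [A] at height 0 and [N] at height 1, joined by [A `&` N] times the unit interval. *)
Definition cyl m (A N : set 'rV[R]_m) : set ('rV[R]_m * R) :=
  [set z | [\/ A z.1 /\ z.2 = 0, [/\ A z.1, N z.1 & 0 <= z.2 <= 1] | N z.1 /\ z.2 = 1]].

Lemma cyl_sub m (A N : set 'rV[R]_m) z : cyl A N z -> (A `|` N) z.1.
Proof. by case=> [[]|[]|[]]; [left|left|right]. Qed.

Lemma cyl_base m (A N : set 'rV[R]_m) x : A x -> cyl A N (x, 0).
Proof. by move=> Ax; apply: Or31. Qed.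

(** Near [z] both polyhedra are star-shaped, so the cylinder contracts horizontally to the fibre
    over [z]. The fibre is a point or [0, 1], star-shaped about height 0 if [z] lies in [A] and
    about height 1 otherwise. *)
Lemma lcc_cyl m (A N : set 'rV[R]_m) z : polyhedron A -> polyhedron N -> (A `|` N) z ->
  lcc true (cyl A N) (@fst _ _) [set z].
Proof.
move=> pA pN ANz; have [r1 r10 r1P] := polyhedron_star z pA.
have [r2 r20 r2P] := polyhedron_star z pN.
move=> e e0; pose d := Num.min e (Num.min r1 r2).
have d0 : 0 < d by rewrite !lt_min e0 r10.
pose Y := over (cyl A N) (@fst _ _) z d.
pose F (w : R * ('rV[R]_m * R)) := (w.2.1 + w.1 *: (z - w.2.1), w.2.2).
have seg B r x s : (forall x, `|x - z| < r -> B x -> B z /\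
    forall l : R, 0 <= l -> l <= 1 -> B (z + l *: (x - z))) -> `|x - z| < r -> 0 <= s <= 1 ->
    B x -> B (x + s *: (z - x)).
  move=> H xr /andP[s0 s1] Bx; have [_ h] := H x xr Bx.
  rewrite (_ : x + _ = z + (1 - s) *: (x - z)); first by apply: h; lra.
  by apply/rowP => i; rewrite !mxE; ring.
have FY s w : 0 <= s <= 1 -> Y w -> Y (F (s, w)).
  case: w => x t s01 [Ew]; rewrite /= !lt_min => /and3P[xe x1 x2].
  have sA := seg A r1 x s r1P x1 s01; have sN := seg N r2 x s r2P x2 s01.
  split.
    case: Ew => [[/= Ax t0]|[/= Ax Nx t01]|[/= Nx t1]]; [apply: Or31|apply: Or32|apply: Or33];
      by split => //; [exact: sA|exact: sN] || (split => //; exact: sA) || (split => //; exact: sN).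
  rewrite /F /=; have -> : x + s *: (z - x) - z = (1 - s) *: (x - z).
    by apply/rowP => i; rewrite !mxE; ring.
  have [s0 s1] := andP s01.
  rewrite normrZ ger0_norm ?subr_ge0//; apply: (@le_lt_trans _ _ `|x - z|).
    by rewrite ler_piMl//; lra.
  by rewrite !lt_min xe x1 x2.
pose Z : set ('rV[R]_m * R) := cyl A N `&` [set w | w.1 = z].
have ZY : Z `<=` Y by move=> [x t] [Ew /= xz]; split => //=; rewrite xz subrr normr0.
have cF : continuous F.
  apply: pair_continuous; last exact: comp_continuous (@snd_continuous _ _) (@snd_continuous _ _).
  have c1 : continuous (fun w : R * ('rV[R]_m * R) => w.2.1).
    exact: comp_continuous (@snd_continuous _ _) (@fst_continuous _ _).
  apply: add_cts => //; apply: scale_cts; first exact: fst_continuous.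
  by apply: sub_cts => //; exact: cst_continuous.
have PE (t s t' : R) : (z, t) + s *: ((z, t') - (z, t)) = (z, t + s * (t' - t)).
  by transitivity (z + s *: (z - z), t + s * (t' - t)); rewrite // subrr scaler0 addr0.
have [t0 st] : exists t0, star Z (z, t0).
  have [Az|nAz] := pselect (A z).
    exists 0; split; first by split => //; exact: cyl_base.
    move=> [x t] s [Ew /= xz] s0 s1; rewrite xz in Ew *; rewrite PE; split => //.
    have -> : t + s * (0 - t) = (1 - s) * t by ring.
    case: Ew => [[/= _ ->]|[/= _ Nz t01]|[/= Nz ->]]; first by rewrite mulr0; exact: cyl_base.
      by apply: Or32; split => //=; nra.
    by apply: Or32; split => //=; lra.
  have Nz : N z by case: ANz.
  exists 1; split; first by split => //; exact: Or33.
  move=> [x t] s [Ew /= xz] s0 s1; rewrite xz in Ew *; rewrite PE; split => //.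
  case: Ew => [[]//|[]//|[/= _ ->]]; apply: Or33; split => //=.
  by rewrite subrr mulr0 addr0.
have [|||c0 c1] := @defo_conn _ Y Z F _ FY _ _ ZY (star_conn st).
- exact: continuous_con.
- by move=> [x t] _; rewrite /F /= scale0r addr0.
- move=> [x t] /(FY 1 (x, t)); rewrite lexx ler01 => /(_ isT)[E _]; split => //.
  by rewrite /= scale1r addrC subrK.
have le : Y `<=` over (cyl A N) (@fst _ _) z e by apply: over_le; rewrite ge_min lexx.
exists d => // _ ->; split.
- by exists (z, t0); apply: le; apply: ZY; case: st.
- move=> x y Px Py; have [p [pp p0 p1]] := c0 x y Px Py.
  by exists p; split => //; exact: pth_sub pp.
- by move=> _; exact: conn1_sub c1.
Qed.

Lemma lcc_transfer (V1 V2 : normedModType R) b (E K2 : set V2) (K1 : set V1) q z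
    (th : V1 -> V2) (ps : V2 -> V1) (r : R) : 0 < r -> E z -> th q = z -> ps z = q ->
  con [set y | `|y - q| < r] th -> con (E `&` [set x | `|x - z| < r]) ps ->
  (forall y, `|y - q| < r -> [/\ E (th y), ps (th y) = y & K2 (th y) -> K1 y]) ->
  (forall x, E x -> `|x - z| < r -> th (ps x) = x /\ (K1 (ps x) -> K2 x)) ->
  lcc b (~` K1) id [set q] -> lcc b (E `\` K2) id [set z].
Proof.
move=> r0 Ez tq pz cth cps thP psP H e e0.
have qq : `|q - q| < r by rewrite subrr normr0.
have zz : `|z - z| < r by rewrite subrr normr0.
have [d1 d10 d1P] := (con_distP _ th).1 cth q qq e e0.
have e10 : 0 < Num.min d1 r by rewrite lt_min d10.
have [d2 d20 d2P] := H _ e10; have [[y Yy] H0 H1] := d2P q erefl.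
have [d3 d30 d3P] := (con_distP _ ps).1 cps z (conj Ez zz) d2 d20.
have thY : forall y, over (~` K1) id q (Num.min d1 r) y -> over (E `\` K2) id z e (th y).
  move=> y' [nK]; rewrite /= lt_min => /andP[y1 y2]; have [Et _ Kt] := thP y' y2.
  by split; [split => // /Kt|rewrite /= -tq; exact: d1P].
have psY : forall x, over (E `\` K2) id z (Num.min d3 r) x -> over (~` K1) id q d2 (ps x).
  move=> x [[Ex nK]]; rewrite /= lt_min => /andP[x1 x2]; have [_ Kp] := psP x Ex x2.
  by split; [move=> /Kp|rewrite /= -pz; apply: d3P].
have ps_con : con (over (E `\` K2) id z (Num.min d3 r)) ps.
  apply: con_sub cps => x [[Ex _]]; rewrite /= lt_min => /andP[_ x2] //.
have th_con : con (over (~` K1) id q (Num.min d1 r)) th.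
  by apply: con_sub cth => x [_]; rewrite /= lt_min => /andP[_].
have back x : over (E `\` K2) id z (Num.min d3 r) x -> th (ps x) = x.
  by move=> [[Ex _]]; rewrite /= lt_min => /andP[_ x2]; have [] := psP x Ex x2.
exists (Num.min d3 r); first by rewrite lt_min d30.
move=> _ ->; split; first by exists (th y); exact: thY.
- move=> x x' Yx Yx'; have [p [pp p0 p1]] := H0 _ _ (psY _ Yx) (psY _ Yx').
  exists (fun t => th (p t)); split; first exact: pth_map th_con thY pp.
    by rewrite p0 back.
  by rewrite p1 back.
move=> /H1 {}H1 s s' sY s'Y E0 E1.
have := H1 _ _ (pth_map ps_con psY sY) (pth_map ps_con psY s'Y).
rewrite E0 E1 => /(_ erefl erefl)/(hmt_map th_con thY).
rewrite (_ : (fun t => th (ps (s t))) = s); last by apply/funext => t; rewrite back//; case: sY.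
by rewrite (_ : (fun t => th (ps (s' t))) = s')//; apply/funext => t; rewrite back//; case: s'Y.
Qed.

End cylinders.

Section cylinder_charts.
Context {R : realType}.

Lemma near_pair (V : normedModType R) (x p : V) (t u e : R) :
  `|(x, t) - (p, u)| < e -> `|x - p| < e /\ `|t - u| < e.
Proof. by rewrite prod_normE /= gt_max => /andP[]. Qed.

(* The collar [(A `&` N) `*` [0, 1]] continues the chart radially beyond the cube. *)
Lemma lcc_cyl_top m d b (A N K U : set 'rV[R]_m) p (f : 'rV[R]_m -> 'rV[R]_d)
    (g : 'rV[R]_d -> 'rV[R]_m) r :
  pchart N p U f g r -> N p ->
  (forall x, N x -> `|x - p| < r -> A x <-> `|f x - center d| = 2^-1) ->
  lcc b (~` [set y | cube y /\ K (g y)]) id [set f p] ->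
  lcc b (cyl A N `\` [set z | K z.1 /\ z.2 = 1]) id [set (p, 1)].
Proof.
case=> UN [r0 NU] fU gU [[cf _ _] [cg _ _]] Np Abd.
have Up : U p by apply: NU => //; rewrite subrr normr0.
have [cfp gfp] := fU p Up; pose c : 'rV[R]_d := center d.
have ih : 0 < 2^-1 :> R by rewrite invr_gt0.
(* [clip] is the radial retraction of R^d to the cube; outside, [mu] is the ratio of |y - c| to
   1/2. *)
pose mu (y : 'rV[R]_d) : R := Num.max 1 (2 * `|y - c|).
have mu1 y : 1 <= mu y by rewrite le_max lexx.
have mu0 y : 0 < mu y := lt_le_trans ltr01 (mu1 y).
have cnc : continuous (fun y : 'rV[R]_d => 2 * `|y - c|).
  have csub : continuous (fun y : 'rV[R]_d => y - c).
    by apply: sub_cts; [move=> ?|exact: cst_continuous].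
  exact: (comp_continuous (comp_continuous csub (@norm_continuous _ _)) (@mul_cts R 2)).
have cmu : continuous mu.
  move=> y; apply: (@continuous_max R _ (cst 1) (fun y : 'rV[R]_d => 2 * `|y - c|) y).
    exact: cst_continuous.
  exact: cnc.
pose clip y := c + (mu y)^-1 *: (y - c).
have cclip : continuous clip.
  apply: add_cts; first exact: cst_continuous.
  apply: scale_cts; first by move=> y; exact: (cvgV (lt0r_neq0 (mu0 y)) (cmu y)).
  by apply: sub_cts; [move=> ?|exact: cst_continuous].
have clip_in y : 2 * `|y - c| <= 1 -> clip y = y.
  by move=> y1; rewrite /clip /mu max_l// invr1 scale1r addrC subrK.
have clip_out y : 1 <= 2 * `|y - c| -> `|clip y - c| = 2^-1.
  move=> y1; rewrite /clip addrC addKr /mu max_r// normrZ ger0_norm ?invr_ge0 ?mulr_ge0//.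
  by rewrite invfM -mulrA mulVf ?mulr1// gt_eqF//; lra.
have clip_cube y : cube (clip y).
  rewrite cubeE /=; case: (lerP (2 * `|y - c|) 1) => y1.
    by rewrite clip_in// -/c; lra.
  by rewrite clip_out// ltW.
(* Inside the cube the height is 1; outside, a point at distance (2 - t) / 2 from the center goes to
   height t over its radial projection. [ps] inverts this by stretching with the factor 2 - t. *)
pose th y := (g (clip y), Num.min 1 (2 - 2 * `|y - c|)).
pose ps (z : 'rV[R]_m * R) := c + (2 - z.2) *: (f z.1 - c).
have qc : 2 * `|f p - c| <= 1 by move: cfp; rewrite cubeE /= -/c; lra.
have [d1 d10 d1P] := (con_distP _ g).1 cg _ cfp r r0.
have /nbhs_dist[d2 d20 d2P] := cclip (f p) _ (nbhsx_ballx (clip (f p)) _ d10).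
(* At most 1/2, so that |y - c| < 1 and the heights stay positive, away from the base. *)
pose rho := Num.min 2^-1 (Num.min r d2).
have rho0 : 0 < rho by rewrite !lt_min ih r0.
have cfd (x : 'rV[R]_m) (t : R) : cyl A N (x, t) -> `|t - 1| < 1 -> N x /\
    ((t = 1) \/ (A x /\ 0 < t <= 1)).
  rewrite ltr_norml => -[[/= _ ->]|[/= Ax Nx t1]|[/= Nx ->]] t2; last by split => //; left.
    by exfalso; lra.
  by split => //; right; split => //; lra.
apply: (@lcc_transfer _ _ _ b _ _ _ (f p) _ th ps rho) => //.
- exact: Or33.
- by rewrite /th clip_in// gfp min_l//; lra.
- by rewrite /ps /=; have -> : 2 - 1 = 1 :> R by [lra]; rewrite scale1r addrC subrK.
- apply: con_pair.
    by apply: con_comp (continuous_con cclip) cg => y _; exact: clip_cube.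
  apply: continuous_con.
  have cn2 : continuous (fun y : 'rV[R]_d => 2 - 2 * `|y - c|).
    by apply: sub_cts => //; exact: cst_continuous.
  move=> y; apply: (@continuous_min R _ (cst 1) (fun y : 'rV[R]_d => 2 - 2 * `|y - c|) y).
    exact: cst_continuous.
  exact: cn2.
- apply: con_add; first exact/continuous_con/cst_continuous.
  apply: con_scale.
    apply/continuous_con/sub_cts; [exact: cst_continuous|exact: snd_continuous].
  apply: con_add; last exact/continuous_con/cst_continuous.
  apply: con_comp (continuous_con (@fst_continuous _ _)) cf => -[x t] [Ex] /near_pair[x1 t1].
  move: x1 t1; rewrite !lt_min => /and3P[_ x1 _] /andP[t1 _].
  by apply: NU => //=; case: (cfd x t Ex) => //; lra.
- move=> y; rewrite !lt_min => /and3P[y1 y2 y3].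
  have [Ug fg] := gU _ (clip_cube y); have Ng := UN _ Ug.
  have gp : `|g (clip y) - p| < r.
    rewrite -gfp; apply: d1P => //.
    have := d2P y y3; rewrite /= -ball_normE /= distrC (clip_in (f p))//.
  have yc : `|y - c| < 1.
    by rewrite -[y](subrK (f p)) -addrA (le_lt_trans (ler_normD _ _))//; lra.
  case: (lerP (2 * `|y - c|) 1) => yc1.
    have E : Num.min 1 (2 - 2 * `|y - c|) = 1 by rewrite min_l//; lra.
    rewrite /th /ps /= E fg clip_in//; split; first by apply: Or33; split => //=; rewrite -(clip_in y).
      by have -> : 2 - 1 = 1 :> R by [lra]; rewrite scale1r addrC subrK.
    move=> [Kg _]; split => //.
    by rewrite cubeE /= -/c; lra.
  have E : Num.min 1 (2 - 2 * `|y - c|) = 2 - 2 * `|y - c| by rewrite min_r//; lra.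
  rewrite /th /ps /= E fg; split.
  + apply: Or32; split => //=; last by lra.
    by apply/Abd => //; rewrite fg clip_out// ltW.
  + have -> : 2 - (2 - 2 * `|y - c|) = mu y by rewrite /mu max_r ?ltW//; ring.
    by rewrite /clip addrAC subrr add0r scalerA divff ?gt_eqF// scale1r addrC subrK.
  + by move=> [_]; lra.
move=> [x t] Ex /near_pair[]; rewrite !lt_min => /and3P[x1 x2 x3] /and3P[t1 _ _].
have [|Nx tx] := cfd x t Ex; first by lra.
have Ux : U x by exact: NU.
have [cfx gfx] := fU x Ux.
case: tx => [E|[Ax t01]].
  have Ep : ps (x, t) = f x.
    by rewrite /ps /= E; have -> : 2 - 1 = 1 :> R by [lra]; rewrite scale1r addrC subrK.
  rewrite Ep /= gfx E; split; last by case.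
  have fc : 2 * `|f x - c| <= 1 by move: cfx; rewrite cubeE /= -/c; lra.
  by rewrite /th clip_in// gfx min_l//; lra.
have fc := (Abd x Nx x2).1 Ax; rewrite -/c in fc.
have pc : ps (x, t) - c = (2 - t) *: (f x - c) by rewrite /ps addrC addKr.
have np : 2 * `|ps (x, t) - c| = 2 - t.
  by rewrite pc normrZ fc ger0_norm; [field|lra].
split.
  rewrite /th np; have -> : clip (ps (x, t)) = f x.
    rewrite /clip /mu np max_r; last by lra.
    rewrite pc scalerA mulVf; first by rewrite scale1r addrC subrK.
    by rewrite gt_eqF//; lra.
  by rewrite gfx min_r; [congr pair; ring|lra].
move=> [cp Kp]; have t1' : t = 1.
  by move: cp; rewrite cubeE /= -/c; lra.
move: Kp; rewrite /ps /= t1'; have -> : 2 - 1 = 1 :> R by [lra].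
by rewrite scale1r addrC subrK gfx.
Qed.

End cylinder_charts.

(** * Attaching a manifold with a spine *)

Section pushing.
Context {R : realType} {V : topologicalType}.
Implicit Types (E Y : set V).

(* Inside [E], paths of [Y] with ends in [Y'] can be deformed into [Y'], and if [b] then
   homotopies of [Y] between paths of [Y'] can be replaced by homotopies in [Y']. *)
Definition pushes (b : bool) E Y Y' :=
  (forall p : R -> V, pth Y p -> Y' (p 0) -> Y' (p 1) ->
    exists p', [/\ pth Y' p', p' 0 = p 0, p' 1 = p 1 & hmt E p p']) /\
  (b -> forall p q : R -> V, pth Y' p -> pth Y' q -> hmt Y p q -> hmt Y' p q).

Lemma pushes_refl b E Y : Y `<=` E -> pushes b E Y Y.
Proof.
by move=> YE; split=> [p Yp _ _|//]; exists p; split => //; apply/hmt_refl/(pth_sub YE).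
Qed.

Lemma pushes_trans b E Y Y' Y'' : Y'' `<=` Y' -> pushes b E Y Y' -> pushes b E Y' Y'' ->
  pushes b E Y Y''.
Proof.
move=> YY [S1 J1] [S2 J2]; split.
  move=> p Yp /[dup] Y0 /YY Y'0 /[dup] Y1 /YY Y'1.
  have [p1 [Yp1 e0 e1 h1]] := S1 p Yp Y'0 Y'1.
  have [||p2 [Yp2 e0' e1' h2]] := S2 p1 Yp1; [by rewrite e0|by rewrite e1|].
  by exists p2; split; rewrite ?e0' ?e1'//; exact: hmt_trans h2.
move=> bb p q Yp Yq h; apply: (J2 bb) => //; apply: (J1 bb) h => //; exact: pth_sub Yp || exact: pth_sub Yq.
Qed.

Lemma pushes_sub (b b' : bool) E E' Y Y' : (b' -> b) -> E `<=` E' -> pushes b E Y Y' -> pushes b' E' Y Y'.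
Proof.
move=> bb EE [S J]; split; last by move=> /bb; exact: J.
move=> p Yp Y0 Y1; have [p' [? ? ? h]] := S p Yp Y0 Y1.
by exists p'; split => //; exact: hmt_sub h.
Qed.

End pushing.

Arguments pushes R {V} b E Y Y'.

(** * Pushing off the spine and undoing the collapse *)

Section avoiding_the_top.
Context {R : realType} {m d : nat} (A N : set 'rV[R]_m).
Context (mN : pl_manifold d N) (AN : A `&` N = pl_boundary d N).
Let E := cyl A N.

Definition top (K : set 'rV[R]_m) : set ('rV[R]_m * R) := [set z | K z.1 /\ z.2 = 1].

Lemma closed_top K : closed K -> closed (top K).
Proof.
move=> cK; rewrite (_ : top K = (fst @^-1` K) `&` (snd @^-1` [set 1]))//.
apply: closedI; first by apply: (@closed_comp _ _ fst) => // z _; exact: fst_continuous.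
apply: (@closed_comp _ _ snd) => [z _|]; first exact: snd_continuous.
exact: closed_eq.
Qed.

Lemma topU K K' : top (K `|` K') = top K `|` top K'.
Proof.
by apply/seteqP; split => z; [case=> [[Kz|Kz] z1]; [left|right]|case=> [[Kz z1]|[Kz z1]];
  split => //; [left|right]].
Qed.

Lemma lcc_local b (W : normedModType R) (Y Y' : set W) z (r : R) : 0 < r ->
  (forall x, `|x - z| < r -> Y x <-> Y' x) -> lcc b Y id [set z] -> lcc b Y' id [set z].
Proof.
move=> r0 YY H e e0; have e'0 : 0 < Num.min e r by rewrite lt_min e0.
have [del del0 delP] := H _ e'0; have [[y Yy] H0 H1] := delP z erefl.
have inl e1 : over Y id z (Num.min e1 r) `<=` over Y' id z e1.
  by move=> x [Yx]; rewrite /= lt_min => /andP[x1 x2]; split => //; exact/YY.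
have inr : over Y' id z (Num.min del r) `<=` over Y id z del.
  by move=> x [Yx]; rewrite /= lt_min => /andP[x1 x2]; split => //; exact/YY.
exists (Num.min del r); first by rewrite lt_min del0.
move=> _ ->; split; first by exists y; exact: inl.
- move=> x x' /inr Yx /inr Yx'; have [p [pp p0 p1]] := H0 _ _ Yx Yx'.
  by exists p; split => //; apply: pth_sub pp.
- by move=> /H1; apply: conn1_sub.
Qed.

Lemma cc_le (b b' : bool) (W : normedModType R) (C : set W) : (b' -> b) -> cc b C -> cc b' C.
Proof. by move=> bb [? ? H]; split => // /bb. Qed.

(** The case of an empty set to be avoided: with the collar, [E] is Euclidean at all top points,
    boundary points of [N] included. *)
Lemma lcc_top p : N p -> lcc true E id [set (p, 1)].
Proof.
move=> Np; have [U [f [g [r [pc bE]]]]] := manifold_chart mN Np.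
have := @lcc_cyl_top R m d true A N set0 U p f g r pc Np.
rewrite (_ : cyl A N `\` _ = E); last by apply/seteqP; split => [z []|z Ez] //; split => // -[].
apply.
  by move=> x Nx xr; rewrite -bE// -AN; split => // -[].
apply: lcc_open; last by move=> [].
rewrite (_ : ~` _ = setT); first exact: openT.
by apply/seteqP; split => // y _ [].
Qed.

(** In a Euclidean neighbourhood of the top point the germ of the image of [D] is a homogeneous
    embedding of the tangent cone, so only the complement of the latter has to be examined. *)
Lemma lcc_top_image b a (D : set 'rV[R]_a) (k : 'rV[R]_a -> 'rV[R]_m) q :
  polyh D -> compact D -> embed D k -> D q -> (forall z, D z -> N (k z)) ->
  (forall h : 'rV[R]_a -> 'rV[R]_d, polyh (tan D q) -> cone (tan D q) ->
     embed (tan D q) h -> homog (tan D q) h -> cc b (h @` tan D q)) ->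
  lcc b (E `\` top (k @` D)) id [set (k q, 1)].
Proof.
move=> pD cD ek Dq DN H; have Np := DN q Dq.
have [U [f [g [r [pc bE]]]]] := manifold_chart mN Np.
apply: (lcc_cyl_top pc Np) => [x Nx xr|].
  by rewrite -bE// -AN; split => // -[].
case: pc => UN [r0 NU] fU gU [ef eg].
have Up : U (k q) by apply: NU => //; rewrite subrr normr0.
have [cfp gfp] := fU _ Up.
have [|h [e0 [e00 [pT cT] [eh hh] hP]]] := compare ef pD cD ek Dq r0.
  by move=> z Dz zq; apply: NU => //; exact: DN.
have e0' : 0 < Num.min e0 r by rewrite lt_min e00.
have [|del del0 delP] := hP _ e0'; first by rewrite ge_min lexx.
have [cg _ _] := eg.
have [d1 d10 d1P] := (con_distP _ g).1 cg _ cfp _ e0'.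
have [sC _] := scaling_image cT hh.
apply: (@lcc_germ _ _ _ _ (h @` tan D q) _ (Num.min del d1)) => //.
- by rewrite lt_min del0.
- move=> v; rewrite lt_min => /andP[v1 v2]; rewrite delP//; split.
    move=> [cv [z Dz gz]]; exists z; split => //; rewrite gz.
      by rewrite -{2}gfp; apply: d1P => //; rewrite addrC addKr.
    by case: (gU _ cv).
  move=> [z [Dz]]; rewrite lt_min => /andP[_ zr] <-.
  have Uz : U (k z) by apply: NU => //; exact: DN.
  by have [cz gz] := fU _ Uz; split => //; exists z.
- exact: H.
Qed.

Lemma lcc_top_pointed b a (D : set 'rV[R]_a) (k : 'rV[R]_a -> 'rV[R]_m) q :
  polyh D -> compact D -> embed D k -> D q -> (forall z, D z -> N (k z)) -> pointed (tan D q) ->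
  lcc b (E `\` top (k @` D)) id [set (k q, 1)].
Proof.
move=> pD cD ek Dq DN pt; apply: lcc_top_image => // h pT cT eh hh.
by apply: (@cc_le true) => //; exact: pointed_complement.
Qed.

Lemma tan_corner a (q : 'rV[R]_a) : corner q ->
  tan (@corner R a) q = setT \/ pointed (tan (@corner R a) q).
Proof.
move=> [q0 q1]; have [[i qi]|npos] := pselect (exists i, q 0 i = 0).
  right; apply: (@pointed_tan _ _ _ _ (delta_mx 0 i) _ (lin_coord i)).
  - by move=> y [y0 _]; rewrite qi.
  - split=> [j|]; first by rewrite mxE; case: eqP.
    rewrite (bigD1 i)//= mxE !eqxx big1 ?addr0// => j ji.
    by rewrite mxE (negPf ji) andbF.
  - by rewrite qi mxE !eqxx.
have [s1|s1] := eqVneq (\sum_i q 0 i) 1.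
  right; have ls : lin (fun w : 'rV[R]_a => - \sum_i w 0 i).
    by move=> k x y; rewrite lin_sum !scaleRE opprD mulrN.
  apply: (@pointed_tan _ _ _ _ 0 _ ls).
  - by move=> y [_ y1]; rewrite s1 lerN2.
  - split=> [i|]; first by rewrite mxE.
    by rewrite big1// => i _; rewrite mxE.
  - by rewrite s1 [X in _ < - X]big1 ?oppr0 ?oppr_lt0// => i _; rewrite mxE.
left; have s1' : \sum_i q 0 i < 1 by rewrite lt_neqAle s1.
apply/seteqP; split => // v _.
suff [l l0 [lq ls]] : exists2 l : R, 0 < l & (forall i, 0 <= q 0 i + l * v 0 i) /\
    \sum_i q 0 i + l * \sum_i v 0 i <= 1.
  exists l => //; split=> [i|]; first by rewrite !mxE.
  by rewrite (linD (@lin_sum _ _)) (linZ (@lin_sum _ _)) scaleRE.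
have [l1 l10 l1P] : exists2 l : R, 0 < l & forall k, 0 <= k -> k <= l ->
    forall i, 0 <= q 0 i + k * v 0 i.
  have Hi i : exists2 l : R, 0 < l & forall k, 0 <= k -> k <= l -> 0 <= q 0 i + k * v 0 i.
    have qi : 0 < q 0 i by rewrite lt_neqAle q0 andbT eq_sym; apply/eqP => qi; apply: npos; exists i.
    have [k [k0 _] kv] := small_multiple (v 0 i : R) qi.
    exists k => // k' k'0 k'k; move: kv; rewrite normrZ (gtr0_norm k0) => kv.
    have : `|k' * v 0 i| < q 0 i.
      by rewrite normrM ger0_norm//; apply: le_lt_trans kv; rewrite ler_wpM2r.
    by rewrite ltr_norml; lra.
  have {Hi} /choice[L LP] : forall i, exists l : R, 0 < l /\ forall k, 0 <= k -> k <= l -> 0 <= q 0 i + k * v 0 i.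
    by move=> i; have [l ? ?] := Hi i; exists l.
  exists (\big[Num.min/1]_i L i); first by rewrite lt_bigmin// => i _; case: (LP i).
  move=> k k0 kl i; apply: (LP i).2 => //; apply: le_trans kl _.
  exact: bigmin_le.
have p0 : 0 < 1 - \sum_i q 0 i by rewrite subr_gt0.
have [l2 [l20 _]] := small_multiple (\sum_i v 0 i : R) p0.
rewrite normrZ (gtr0_norm l20) => l2P.
have m0 : 0 < Num.min l1 l2 by rewrite lt_min l10.
exists (Num.min l1 l2) => //; split; first by apply: l1P; [exact: ltW|rewrite ge_min lexx].
have : `|Num.min l1 l2 * \sum_i v 0 i| < 1 - \sum_i q 0 i.
  rewrite normrM (gtr0_norm m0); apply: le_lt_trans l2P; rewrite ler_wpM2r//.
  by rewrite ge_min lexx orbT.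
by rewrite ltr_norml; lra.
Qed.

(** [b] counts as 0 or 1: codimension at least 2, or 3 if [b]. It enters at interior points of the
    simplex; at the others the tangent cone is pointed. *)
Lemma lcc_top_hull (b : bool) (s : seq 'rV[R]_m) p : affine_indep s -> conv_hull s `<=` N ->
  ((size s).-1 + 2 + b <= d)%N -> conv_hull s p ->
  lcc b (E `\` top (conv_hull s)) id [set (p, 1)].
Proof.
have [->|s0] := eqVneq s [::].
  by move=> _ _ _ [w [_ /eqP]]; rewrite big_ord0 eq_sym oner_eq0.
move=> si sN sd; rewrite conv_hull_spread// in sN * => -[q Dq <-].
have DN z : corner z -> N (spread (s := s) z) by move=> Dz; apply: sN; exists z.
have ek := spread_embed (@corner R _) s0 si.
have [E1|pt] := tan_corner Dq; last first.
  by apply: lcc_top_pointed => //; [exact: polyh_corner|exact: compact_corner].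
apply: lcc_top_image => //; [exact: polyh_corner|exact: compact_corner|].
rewrite E1 => h _ _ eh hh; case: b sd => sd.
  by apply: linear_complement1 => //; rewrite -addn3 -[3%N]/(2 + 1)%N addnA.
by apply: linear_complement0 => //; move: sd; rewrite addn0 addn2.
Qed.

(** The simplices are avoided one after the other. They may overlap: a point off the closed union of
    those already treated has a neighbourhood off that union. *)
Lemma pushes_hulls (b : bool) (K : seq (seq 'rV[R]_m)) : (forall s, s \in K -> affine_indep s) ->
  cells K `<=` N -> (forall s, s \in K -> ((size s).-1 + 2 + b <= d)%N) ->
  pushes R b E E (E `\` top (cells K)).
Proof.
elim: K => [|s K IH] Ki KN Kd.
  rewrite cells0 (_ : E `\` _ = E); first exact: pushes_refl.
  by apply/seteqP; split => [z []//|z Ez]; split => // -[].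
have sK : s \in s :: K by rewrite mem_head.
have sub : {subset K <= s :: K} by move=> t tK; rewrite inE tK orbT.
have {}IH : pushes R b E E (E `\` top (cells K)).
  apply: IH => [t /sub|x Kx|t /sub]; [exact: Ki| |exact: Kd].
  by apply: KN; rewrite cells_cons; right.
have sN : conv_hull s `<=` N by move=> x sx; apply: KN; rewrite cells_cons; left.
rewrite cells_cons setUC topU -setDDl.
set Y := E `\` top (cells K) in IH *.
have cK : closed (top (cells K)) by apply: closed_top; apply: (@closed_polyhedron R m (cells K)); exists K.
have cs : closed (top (conv_hull s)) by apply: closed_top; exact: (@closed_hull R m s).
have loc z : Y z -> top (conv_hull s) z -> lcc b (Y `\` top (conv_hull s)) id [set z] /\
    lcc true E id [set z].
  case: z => p t [Ez nK] [/= sp t1]; rewrite t1 in Ez nK *.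
  split; last exact/lcc_top/sN.
  have [r r0 rP] := far_closed cK nK.
  apply: lcc_local r0 _ (lcc_top_hull (Ki s sK) sN (Kd s sK) sp).
  move=> x /rP nx; split=> [[Ex nsx]|[[Ex _] nsx]] //.
have YE : Y `<=` E by move=> z [].
apply: pushes_trans IH _; first by move=> z [].
split=> [p Yp p0 p1|].
  exact: (pth_avoid cs YE loc).
move=> bb p q Yp Yq h; apply: hmt_avoid => // z Yz sz.
by have [+ _] := loc z Yz sz; rewrite bb.
Qed.

(** The attached ball is swept by the level of y_0, starting from the face y_0 = 0 in [Q]. At a
    front point the swept part {y_0 <= t} has a pointed tangent cone, with form -y_0, whatever the
    dimension of the ball. *)
Lemma pushes_elementary b P Q : elementary_collapse P Q -> P `<=` N ->
  Q `<=` P /\ pushes R b E (E `\` top Q) (E `\` top P).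
Proof.
case=> pP [pQ [e [B [f [hf PE QB]]]]] PN.
have QP : Q `<=` P by rewrite PE; left.
split => //; have ef := pl_homeo_embed hf; have [cf fi rf] := ef.
have fB y : cube y -> B (f y) by case: hf => _ [fB _ _] _; exact: fB.
have Bf x : B x -> exists2 y, cube y & f y = x by case: hf => _ [_ _ fs] _ /fs.
have BN y : cube y -> N (f y) by move=> cy; apply: PN; rewrite PE; right; exact: fB.
have cQ : closed (top Q) by apply: closed_top; exact: closed_polyhedron pQ.
pose g (y : 'rV[R]_e.+1) := (f y, 1 : R).
pose al (y : 'rV[R]_e.+1) : R := y 0 ord0.
pose be (y : 'rV[R]_e.+1) : R := 1.
pose D t := @cube R e.+1 `&` [set y | y 0 ord0 <= t].
have sE t : swept (top Q) (@cube R e.+1) g al be t = top Q `|` top (f @` D t).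
  apply/seteqP; split => z [Qz|]; try by left.
    by move=> [y [cy ay] <-]; right; split => //=; exists y => //; split => //; rewrite /= -[t]mulr1.
  by case: z => x u [[y [cy yt] /= <-] ->]; right; exists y => //; split => //; rewrite /be mulr1.
have D0 : f @` D 0 `<=` Q.
  move=> _ [y [cy y0] <-]; have : (Q `&` B) (f y); last by case.
  rewrite QB; exists y => //; split => //; exists ord0; split => //.
  by apply/eqP; rewrite eq_le y0; case/andP: (cy ord0).
have s0E : swept (top Q) (@cube R e.+1) g al be 0 = top Q.
  rewrite sE; apply/seteqP; split => z; last by left.
  by case=> // -[Dz z1]; split => //; exact: D0.
have s1E : swept (top Q) (@cube R e.+1) g al be 1 = top P.
  rewrite sE -topU PE; congr (top (_ `|` _)); apply/seteqP; split => [_ [y [cy _] <-]|x /Bf[y cy <-]].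
    exact: fB.
  by exists y => //; split => //; case/andP: (cy ord0).
have pD t : polyh (D t).
  apply: polyhI; first exact: polyh_cube.
  have lf (i : 'I_1) : lin (fun y : 'rV[R]_e.+1 => - y 0 ord0).
    by move=> k x y; rewrite !mxE scaleRE opprD mulrN.
  have := polyh_affine (fun=> t) lf; congr polyh; apply/seteqP; split => y /=.
    by move=> /(_ ord0); rewrite subr_ge0.
  by move=> yt _; rewrite subr_ge0.
have cD t : compact (D t).
  by apply: (subclosed_compact _ (@compact_cube R e.+1)) => [|y []//]; case: (pD t).
have loc t : 0 < t -> t <= 1 -> forall z, front (@cube R e.+1) g al be t z ->
    forall b', lcc b' (E `\` swept (top Q) (@cube R e.+1) g al be t) id [set z] /\
      lcc true E id [set z].
  move=> t0 t1 _ [y [cy /= ay] <-] b'; split; last exact/lcc_top/BN.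
  rewrite /al /be mulr1 in ay.
  have Dy : D t y by split => //=; rewrite ay.
  (* A front point has y_0 = t > 0, so it is off the face along which the ball meets [Q]. *)
  have nQ : ~ top Q (g y).
    move=> [/= Qy _]; have : (Q `&` B) (f y) by split => //; exact: fB.
    rewrite QB => -[y' [cy' [i [i0 yi']]] /fi E1]; have {}E1 := E1 cy' cy.
    have ei : i = ord0 by apply: val_inj.
    by move: yi'; rewrite E1 ei ay; lra.
  have [r r0 rP] := far_closed cQ nQ.
  have pt : pointed (tan (D t) y).
    have lf : lin (fun y : 'rV[R]_e.+1 => - y 0 ord0).
      by move=> k x y'; rewrite !mxE scaleRE opprD mulrN.
    apply: (@pointed_tan _ _ _ _ 0 _ lf).
    - by move=> y' [_ /= y't]; rewrite ay lerN2.
    - by split=> [i|] /=; rewrite mxE; [rewrite lexx ler01|exact: ltW].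
    - by rewrite ay mxE ltrN2.
  have ek : embed (D t) f by apply: embed_sub ef => y' [].
  have DN z : D t z -> N (f z) by move=> [cz _]; exact: BN.
  have := @lcc_top_pointed b' _ (D t) f y (pD t) (cD t) ek Dy DN pt.
  apply: (lcc_local r0) => x /rP nx; rewrite sE; split=> [[Ex ns]|[Ex ns]]; split => //.
    by case.
  by move=> ?; apply: ns; right.
have cg : con (@cube R e.+1) g by apply: con_pair => //; exact/continuous_con/cst_continuous.
have cal : con (@cube R e.+1) al by apply/continuous_con; exact: coord_cts.
have cbe : con (@cube R e.+1) be by apply/continuous_con; exact: cst_continuous.
have be0 (y : 'rV[R]_e.+1) : @cube R e.+1 y -> 0 <= be y by rewrite ler01.
have cc := @compact_cube R e.+1.
rewrite -s0E -s1E; split=> [p Yp p0 p1|bb p q Yp Yq h].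
  by apply: (sweep_pth cc cg cal cbe be0 (b := b) (X' := E)) => // t t0 t1 z fz; exact: loc.
apply: (sweep_hmt cc cg cal cbe be0) h => // t t0 t1 z fz.
by have [] := loc t t0 t1 z fz true.
Qed.

Lemma pushes_collapses b P Q : collapses P Q -> P `<=` N ->
  Q `<=` P /\ pushes R b E (E `\` top Q) (E `\` top P).
Proof.
elim=> {P Q} [P Q|P|P S Q _ IH1 _ IH2] PN; first exact: pushes_elementary.
  by split => //; apply: pushes_refl => z [].
have [SP p1] := IH1 PN; have [QS p2] := IH2 (subset_trans SP PN).
split; first exact: subset_trans QS SP.
by apply: pushes_trans p2 p1 => z [Ez nP]; split => // -[Sz z1]; apply: nP; split => //; exact: SP.
Qed.

End avoiding_the_top.

Section attaching.
Context {R : realType} {m d : nat} (A N P : set 'rV[R]_m).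

(** Paths and homotopies are lifted to the cylinder up to homotopy, with ends and boundary paths in
    [A] placed at height 0. There they are pushed off the top, and the cylinder without its top
    projects into [A]. *)
Lemma pushes_attach (b : bool) e : polyhedron A -> A `&` N = pl_boundary d N -> spine d N P ->
  polyhedron_dim P e -> (e + 2 + b <= d)%N -> pushes R b (A `|` N) (A `|` N) A.
Proof.
move=> pA AN [mN _ _ PN col] [K [PK Ki Kd]] ed.
set X := A `|` N; pose E := cyl A N.
have pN : polyhedron N by case: mN.
have PN' : P `<=` N by move=> x /PN[].
have pX : polyhedron X by exact: polyhedronU.
have cX : compact X := compact_polyhedron pX.
have top_pushes : pushes R b E E (E `\` top N).
  apply: (@pushes_trans _ _ _ _ _ (E `\` top P)).
  - by move=> z [Ez nN]; split => // -[Pz z1]; apply: nN; split => //; exact: PN'.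
  - rewrite PK; apply: (pushes_hulls mN AN) => //; first by rewrite -PK.
    move=> s sK; apply: leq_trans ed; rewrite !leq_add2r.
    have : (size s <= \max_(s <- K) size s)%N by apply: (@leq_bigmax_seq _ K xpredT size s).
    by rewrite Kd; case: (size s).
  - by have [] := pushes_collapses mN AN b col (@subset_refl _ N).
have [S J] := top_pushes.
have lX : lcc true X id X.
  by apply: lcc_compact cX _ => z Xz; exact: lcc_polyhedron pX Xz.
have lE : lcc true E fst X by apply: lcc_compact cX _ => z; exact: lcc_cyl.
pose io (x : 'rV[R]_m) := (x, 0 : R).
have cio : con A io by apply: con_pair; [exact: con_id|exact/continuous_con/cst_continuous].
have ioE x : A x -> E (io x) /\ fst (io x) = x by move=> Ax; split => //; exact: cyl_base.
have io_top x : A x -> (E `\` top N) (io x).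
  by move=> /ioE[Ex _]; split => // -[_ /= /eqP]; rewrite eq_sym oner_eq0.
have cfst Y : con Y (@fst 'rV[R]_m R) by apply: continuous_con; exact: fst_continuous.
have down z : (E `\` top N) z -> A z.1.
  by case: z => x t [[[]//|[]//|[Nx t1]] nN]; case: nN.
have E_X z : E z -> X z.1 := @cyl_sub R m A N z.
split=> [p Xp A0 A1|bb p q Ap Aq [H [cH HX H0 H1 Hs]]].
  (* [X] itself serves as [Z], so that every point of the path may be redone; [io] prescribes the
     ends. *)
  have [eta eta0 etaP] := pth_local_to_global lX lE cio (cfst E) E_X ioE.
  have [|c [cE c0 c1 hc]] := etaP p Xp _ A0 A1.
    by move=> t _; right; exists (p t); [case: Xp|rewrite subrr normr0].
  have [||c' [c'E c'0 c'1 h']] := S c cE; first by rewrite c0; exact: io_top.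
    by rewrite c1; exact: io_top.
  exists (fun t => (c' t).1); split.
  - exact: (pth_map (cfst (E `\` top N)) down c'E).
  - by rewrite c'0 c0.
  - by rewrite c'1 c1.
  - by apply: hmt_trans hc _; exact: (hmt_map (cfst E) E_X h').
have [eta eta0 etaP] := hmt_local_to_global lE cio ioE.
have [_ pA'] := Ap; have [_ qA'] := Aq.
have e01 : 0 <= (0 : R) <= 1 by rewrite lexx ler01.
have e11 : 0 <= (1 : R) <= 1 by rewrite lexx ler01.
have h : hmt E (fun t : R => io (H (0, clamp t))) (fun t => io (H (1, clamp t))).
  apply: (etaP H cH).
  - by move=> s t _ _; right; exists (H (s, t)) => //; rewrite subrr normr0.
  - by move=> s s01; have [-> ->] := Hs s s01; have [-> ->] := Hs 0 e01.
  - by move=> t t01; rewrite H0// H1.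
have {}h : hmt E (fun t : R => io (p (clamp t))) (fun t => io (q (clamp t))).
  have -> : (fun t : R => io (p (clamp t))) = fun t => io (H (0, clamp t)).
    by apply/funext => t; rewrite H0//; exact: clamp_in.
  have -> : (fun t : R => io (q (clamp t))) = fun t => io (H (1, clamp t)).
    by apply/funext => t; rewrite H1//; exact: clamp_in.
  exact: h.
apply: hmt_clamp2 => //.
have pc (c : R -> 'rV[R]_m) : pth A c -> pth (E `\` top N) (fun t : R => io (c (clamp t))).
  move=> Ac; apply: (pth_map cio io_top (p := fun t => c (clamp t))).
  by apply: pth_comp Ac; exact: clamp_continuous.
exact: (hmt_map (cfst (E `\` top N)) down (J bb _ _ (pc p Ap) (pc q Aq) h)).
Qed.

End attaching.

(** * Multisections *)

Section multisections.
Context {R : realType} {n k m : nat} {M : set 'rV[R]_m} {H : 'I_k.+1 -> set 'rV[R]_m}.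
Context (nk : n = k.*2 \/ n = k.*2.+1) (k0 : (0 < k)%N).
Context (M_closed : closed_pl_manifold n M) (MH : multisection n M H).
Implicit Types (S L : {set 'I_k.+1}) (p x : 'rV[R]_m) (r : nat).

Local Notation cap := (handlebody_cap M H).

(** For nonempty [S] with at most k elements this is the boundary of [cap S]; for empty [S] it is
    [M], which starts the induction. *)
Definition outer S : set 'rV[R]_m := cap S `&` [set x | exists2 j, j \notin S & H j x].

Lemma capP S x : cap S x <-> M x /\ forall i, i \in S -> H i x.
Proof. by split=> -[Mx Hx]; split => // i; exact: Hx. Qed.

Lemma capU1 j S x : cap (j |: S) x <-> cap S x /\ H j x.
Proof.
rewrite !capP; split=> [[Mx Hx]|[[Mx Hx] Hj]].
  by split; [split => // i iS|]; apply: Hx; rewrite !inE ?iS ?orbT ?eqxx.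
by split => // i; rewrite !inE => /orP[/eqP ->|]; last exact: Hx.
Qed.

Lemma k_lt_n : (k < n)%N.
Proof. by case: nk => ->; rewrite -addnn -?addnS ?ltnS -[X in (X < _)%N]addn0 ?ltn_add2l ?leq_addr //. Qed.

Lemma cap_manifold S d : (0 < #|S|)%N -> (d + #|S| = n.+1)%N -> pl_manifold d (cap S).
Proof.
move=> S0 dE; have kn := k_lt_n.
have [Sk|Sk] := leqP #|S| k.
  have [|mS _ _] := multisection_proper MH (S := S); first by rewrite S0.
  by rewrite (_ : d = (n - #|S|).+1)//; lia.
have ST : S = [set: 'I_k.+1]%SET.
  by apply/eqP; rewrite eqEcard finset.subsetT cardsT card_ord.
have [[mc _] _] := multisection_central MH; rewrite ST (_ : d = n - k)%N//.
by move: dE; rewrite ST cardsT card_ord; lia.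
Qed.

Lemma fin_radius (I : finType) (Q : I -> R -> Prop) :
  (forall i e e', 0 < e' -> e' <= e -> Q i e -> Q i e') ->
  (forall i, exists2 e : R, 0 < e & Q i e) -> exists2 e : R, 0 < e & forall i, Q i e.
Proof.
move=> Qle HQ; have {HQ} /choice[e eP] : forall i, exists e : R, 0 < e /\ Q i e.
  by move=> i; have [e ? ?] := HQ i; exists e.
have e0 : 0 < \big[Num.min/1]_i e i by rewrite lt_bigmin// => i _; case: (eP i).
exists (\big[Num.min/1]_i e i) => // i; have [_] := eP i; apply: Qle => //.
exact: bigmin_le.
Qed.

Lemma handlebody_closed j : closed (H j).
Proof. by have [pH _] := multisection_manifold MH j; exact: closed_polyhedron. Qed.

Lemma outer_flat S p : (#|S| < k)%N -> outer S p ->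
  ((0 < #|S|)%N -> pl_boundary (n - #|S|).+1 (cap S) = outer S) ->
  flat (n - #|S|) (outer S) p.
Proof.
move=> Sk Op IH; have [S0|] := posnP #|S|; last first.
  move=> S0; rewrite -IH//; apply: flat_boundary; last by rewrite IH.
  by apply: cap_manifold => //; have := k_lt_n; lia.
have SE : S = finset.set0 by apply/eqP; rewrite -cards_eq0 S0.
have OM : outer S = M.
  apply/seteqP; split => [x [[]]//|x Mx].
  split; first by split => // i; rewrite /= SE inE.
  by move: Mx; rewrite (multisection_cover MH) => -[j _ Hj]; exists j; rewrite ?SE ?inE.
rewrite S0 subn0 OM; case: M_closed => _ bM.
have Mp : M p by rewrite -OM.
have ip : pl_interior n M p.
  by apply: contrapT => ni; have : pl_boundary n M p by []; rewrite bM.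
have [U [f [g [r [pc fp]]]]] := interior_pchart ip.
exact: flat_interior pc Mp fp.
Qed.

(** Induction on #|S|. With S' = S minus i, [cap S] lies in [outer S'], which is flat of the same
    dimension, being [M] or the boundary of [cap S']. At a point in no further handlebody the two
    coincide locally, so it is interior. If a point of H_j were interior, [cap S] would contain a
    neighbourhood of it in [outer S'], and [cap (j |: S')] would lie locally in [cap (j |: S)], of
    one dimension less. *)
Lemma cap_boundary S : (0 < #|S| <= k)%N -> pl_boundary (n - #|S|).+1 (cap S) = outer S.
Proof.
have [r] := ubnP #|S|; elim: r S => // r IH S; rewrite ltnS => Sr /andP[S0 Sk].
have kn := k_lt_n.
have [i iS] : exists i, i \in S by apply/set0Pn; rewrite -cards_eq0 -lt0n.
pose S' := S :\ i.
have iS' : i \notin S' by rewrite !inE eqxx.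
have SE : S = i |: S' by rewrite finset.setD1K.
have cS : #|S| = #|S'|.+1 by rewrite SE cardsU1 iS'.
have S'k : (#|S'| < k)%N by rewrite -cS.
have {IH} fl p : outer S' p -> flat (n - #|S'|) (outer S') p.
  move=> Op; apply: outer_flat => // S'0; apply: IH; first by rewrite -cS.
  by rewrite S'0 ltnW.
have dE : (n - #|S|).+1 = (n - #|S'|)%N by lia.
have mS : pl_manifold (n - #|S'|) (cap S) by apply: cap_manifold => //; lia.
have sub p : cap S p -> outer S' p.
  by rewrite {1}SE capU1 => -[S'p Hp]; split => //; exists i.
rewrite dE; apply/seteqP; split => p.
  move=> bp; have Sp : cap S p by case: bp.
  split => //; apply: contrapT => nO.
  have [e e0 eP] : exists2 e : R, 0 < e & forall j, forall x, `|x - p| < e -> j \notin S -> ~ H j x.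
    apply: fin_radius => [j e e' _ ee P x xe|j]; first by apply: P; exact: lt_le_trans ee.
    have [jS|jS] := boolP (j \in S); first by exists 1.
    have nH : ~ H j p by move=> Hj; apply: nO; exists j.
    have [e e0 eP] := far_closed (@handlebody_closed j) nH.
    by exists e => // x /eP.
  have [U [f [g [r' [pc bE]]]]] := manifold_chart mS Sp.
  have := flat_interior_at (fl _ (sub _ Sp)) pc Sp e0 _.
  rewrite (bE p Sp _).1//; last by case: pc => _ [r0 _] _ _ _; rewrite subrr normr0.
  rewrite ltxx => H'; suff : false by []; apply: H' => x xe; split; first exact: sub.
  move=> [S'x [j jS' Hj]]; rewrite SE; apply/capU1; split => //.
  have [jS|/(eP j x xe)//] := boolP (j \in S).
  by move: jS; rewrite SE in_setU1 (negPf jS') orbF => /eqP <-.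
move=> [Sp [j jS Hj]].
have [U [f [g [r' [pc bE]]]]] := manifold_chart mS Sp.
have [UN [r0 NU] fU _ _] := pc.
have pp : `|p - p| < r' by rewrite subrr normr0.
apply/bE => //.
have [cfp _] := fU p (NU p Sp pp).
case: (tan_cube cfp) => [[fp _]|[]//]; exfalso.
have [e e0 eP] := flat_open (fl _ (sub _ Sp)) pc Sp ltr01 (fun x _ => @sub x) fp.
have jS' : j \notin S' by apply: contra jS; rewrite !inE => /andP[].
have mN : pl_manifold (n - #|S|).+1 (cap (j |: S')).
  by apply: cap_manifold; rewrite cardsU1 jS'//; lia.
have mB : pl_manifold (n - #|S|) (cap (j |: S)).
  by apply: cap_manifold; rewrite cardsU1 jS//; lia.
have Bp : cap (j |: S) p by apply/capU1.
have Np : cap (j |: S') p by apply/capU1; split => //; move: Sp; rewrite {1}SE capU1 => -[].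
have [U1 [f1 [g1 [r1 [pc1 _]]]]] := manifold_chart mB Bp.
have [U2 [f2 [g2 [r2 [pc2 _]]]]] := manifold_chart mN Np.
apply: (dimension_drop pc1 pc2 Np e0) => x xe /capU1[S'x Hx].
by apply/capU1; split => //; apply: eP => //; split => //; exists j.
Qed.

End multisections.

Section levels.
Context {R : realType} {n k m : nat} {M : set 'rV[R]_m} {H : 'I_k.+1 -> set 'rV[R]_m}.
Context (nk : n = k.*2 \/ n = k.*2.+1) (k0 : (0 < k)%N).
Context (M_closed : closed_pl_manifold n M) (MH : multisection n M H).
Implicit Types (L : seq {set 'I_k.+1}) (S T : {set 'I_k.+1}) (r : nat).

Local Notation cap := (handlebody_cap M H).

Definition caps (L : seq {set 'I_k.+1}) : set 'rV[R]_m := \bigcup_(S in [set` L]) cap S.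

Definition level (r : nat) := caps (enum [set S : {set 'I_k.+1} | #|S| == r]%SET).

Lemma caps_cons S L : caps (S :: L) = cap S `|` caps L.
Proof.
apply/seteqP; split => [x [T /=]|x].
  by rewrite inE => /orP[/eqP -> ?|TL Tx]; [left|right; exists T].
by case=> [Sx|[T TL Tx]]; [exists S => //=; rewrite mem_head|exists T => //=; rewrite inE TL orbT].
Qed.

Lemma levelE r x : level r x <-> exists2 S : {set 'I_k.+1}, #|S| = r & cap S x.
Proof.
split=> [[S /=]|[S Sr Sx]]; first by rewrite mem_enum inE => /eqP Sr; exists S.
by exists S => //=; rewrite mem_enum inE Sr eqxx.
Qed.

Lemma polyhedron_caps L : (forall S, S \in L -> (0 < #|S|)%N) -> polyhedron (caps L).
Proof.
elim: L => [|S L IH] L0.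
  exists [::]; rewrite cells0; apply/seteqP; split => // x [S] //.
rewrite caps_cons; apply: polyhedronU.
  have S0 := L0 S (mem_head _ _).
  have [] // := cap_manifold nk k0 MH S0 (d := n.+1 - #|S|).
  have Sk : (#|S| <= k.+1)%N by rewrite -[X in (_ <= X)%N]card_ord max_card.
  by rewrite subnK//; have := k_lt_n nk k0; lia.
by apply: IH => T TL; apply: L0; rewrite inE TL orbT.
Qed.

Lemma level_sub r : level r `<=` M.
Proof. by move=> x /levelE[S _ []]. Qed.

Lemma levelS r : level r.+1 `<=` level r.
Proof.
move=> x /levelE[S Sr /capP[Mx Hx]].
have [i iS] : exists i, i \in S by apply/set0Pn; rewrite -cards_eq0 Sr.
apply/levelE; exists (S :\ i).
  by apply: succn_inj; rewrite -Sr [in RHS](cardsD1 i) iS.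
by apply/capP; split => // j; rewrite !inE => /andP[_]; exact: Hx.
Qed.

(** The r-fold intersections are attached to the next level one at a time. Of two distinct r-sets
    neither contains the other, so each new piece meets what is already there exactly in [outer S],
    its boundary. *)
Lemma pushes_level (b : bool) r : (0 < r)%N -> (r + b <= k)%N ->
  pushes R b M (level r) (level r.+1).
Proof.
move=> r0 rk; have kn := k_lt_n nk k0.
have polyL : polyhedron (level r.+1).
  by apply: polyhedron_caps => S; rewrite mem_enum inE => /eqP ->.
have main L : uniq L -> (forall S, S \in L -> #|S| = r) ->
    pushes R b M (level r.+1 `|` caps L) (level r.+1).
  elim: L => [|S L IH].
    rewrite (_ : caps [::] = set0); last by apply/seteqP; split => // x [S].
    by rewrite setU0 => _ _; apply: pushes_refl; exact: level_sub.
  move=> /= /andP[SL uL] Lr; have Sr := Lr S (mem_head _ _).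
  have Lr' T : T \in L -> #|T| = r by move=> TL; apply: Lr; rewrite inE TL orbT.
  have {}IH := IH uL Lr'; rewrite caps_cons setUCA setUC.
  have LM : level r.+1 `|` caps L `<=` M by move=> x [/level_sub//|[T _ []]].
  apply: pushes_trans IH; first by left.
  have Sk : (0 < #|S| <= k)%N by rewrite Sr r0; lia.
  have [_ _ [P [spP dP]]] := multisection_proper MH Sk.
  have SM : cap S `<=` M by move=> x [].
  apply: (@pushes_sub _ _ b b ((level r.+1 `|` caps L) `|` cap S)) => //.
    by move=> x [/LM|/SM].
  apply: (pushes_attach _ _ spP dP).
  - apply: polyhedronU polyL _; apply: polyhedron_caps => T TL; by rewrite Lr'.
  - rewrite (cap_boundary nk k0 M_closed MH Sk); apply/seteqP; split => x.
      move=> [Lx Sx]; split => //; case: Lx => [/levelE[T Tr Tx]|[T /= TL Tx]].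
        have /fintype.subsetPn[j jT jS] : ~~ (T \subset S).
          by apply/negP => /subset_leq_card; rewrite Tr Sr ltnn.
        by exists j => //; have [_ HT] := (capP _ _).1 Tx; exact: HT.
      have /fintype.subsetPn[j jT jS] : ~~ (T \subset S).
        apply/negP => TS; have : T == S by rewrite eqEcard TS Sr Lr' /=.
        by move/eqP => E; case/negP: SL; rewrite -E.
      by exists j => //; have [_ HT] := (capP _ _).1 Tx; exact: HT.
    move=> [Sx [j jS Hj]]; split => //; left; apply/levelE; exists (j |: S)%SET.
      by rewrite cardsU1 jS Sr.
    exact/capU1.
  (* The spine dimension is r, or k - 1 if n = 2k and r = k; with r + b <= k the codimension is at
     least 2 + b in each case. *)
  - rewrite Sr; case: ifP => [/andP[/eqP nE /eqP rE]|/negP nE]; first by rewrite nE; lia.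
    case: nk => nE'; last by lia.
    have : r != k by apply/negP => /eqP rE; apply: nE; rewrite nE' rE !eqxx.
    by lia.
have -> : level r = level r.+1 `|` level r.
  by apply/seteqP; split => x; [right|case=> // /levelS].
apply: main; first exact: enum_uniq.
by move=> S; rewrite mem_enum inE => /eqP.
Qed.

Lemma level1 : level 1 = M.
Proof.
apply/seteqP; split => [x /level_sub//|x Mx].
move: (Mx); rewrite {1}(multisection_cover MH) => -[i _ Hi].
apply/levelE; exists [set i]%SET; first by rewrite cards1.
by apply/capP; split => // j; rewrite inE => /eqP ->.
Qed.

Lemma levelk : level k = k_fold_union M H.
Proof. by apply/seteqP; split => x => [/levelE[S Sk Sx]|[S Sk Sx]]; [exists S|apply/levelE; exists S]. Qed.

Lemma level_central : level k.+1 = central M H.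
Proof.
apply/seteqP; split => x => [/levelE[S Sk Sx]|Sx]; last first.
  by apply/levelE; exists [set: 'I_k.+1]%SET => //; rewrite cardsT card_ord.
suff ST : [set: 'I_k.+1]%SET = S by rewrite /central ST.
by apply/esym/eqP; rewrite eqEcard finset.subsetT cardsT card_ord Sk leqnn.
Qed.

Lemma pushes_k_fold : pushes R true M M (k_fold_union M H).
Proof.
have main r : (r < k)%N -> pushes R true M M (level r.+1).
  elim: r => [|r IH] rk; first by rewrite level1; exact: pushes_refl.
  apply: pushes_trans (@levelS _) (IH (ltnW rk)) _.
  by apply: pushes_level => //; rewrite addn1.
by rewrite -levelk; have := main k.-1; rewrite prednK//; apply.
Qed.

(** One further step, at r = k, where codimension 2 suffices for paths. *)
Lemma pushes_central : pushes R false M M (central M H).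
Proof.
have p1 : pushes R false M M (level k).
  by rewrite levelk; apply: pushes_sub pushes_k_fold.
rewrite -level_central; apply: pushes_trans (@levelS _) p1 _.
by apply: pushes_level => //; rewrite addn0.
Qed.

End levels.

(** * Fundamental groups of subspaces *)

Section fundamental_groups.
Context {R : realType} {V : topologicalType} {A B : set V} (AB : A `<=` B).
Local Notation I := (unit_interval R).

Lemma set_val_continuous (D : set V) : continuous (set_val : D -> V).
Proof. exact: initial_continuous. Qed.

Lemma ival_in (t : I) : 0 <= ival t <= 1.
Proof. by rewrite ival_ge0 ival_le1. Qed.

Definition real_path (D : set V) (p : I -> D) (t : R) : V := set_val (p (clampI t)).

Lemma pth_real_path (D : set V) (p : I -> D) : continuous p -> pth D (real_path p).
Proof.
move=> cp; split; last by move=> t; exact: set_valP.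
apply: (comp_continuous (f := fun t => p (clampI t))); last exact: set_val_continuous.
exact: comp_continuous clampI_continuous cp.
Qed.

Lemma real_pathE (D : set V) (p : I -> D) (t : I) : real_path p (ival t) = set_val (p t).
Proof. by rewrite /real_path ivalK. Qed.

Lemma real_path0 (D : set V) (p : I -> D) : real_path p 0 = set_val (p zero).
Proof. by rewrite -(ival0 (R := R)) real_pathE. Qed.

Lemma real_path1 (D : set V) (p : I -> D) : real_path p 1 = set_val (p one).
Proof. by rewrite -(ival1 (R := R)) real_pathE. Qed.

Lemma loop_of_pth (x : A) (p : R -> V) : pth A p -> p 0 = set_val x -> p 1 = set_val x ->
  exists q : {path I from x to x}, forall t, set_val (q t) = p (ival t).
Proof.
move=> [cp pA] p0 p1.
pose q (t : I) : A := exist _ (p (ival t)) (mem_set (pA (ival t))).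
have cq : continuous q.
  by apply: continuous_comp_initial; exact: comp_continuous ival_continuous cp.
have q0 : q zero = x by apply: val_inj; rewrite /= ival0.
have q1 : q one = x by apply: val_inj; rewrite /= ival1.
by exists (mk_path cq q0 q1).
Qed.

Lemma hmt_path_homotopic (D : set V) (x : D) (p q : {path I from x to x}) :
  hmt D (real_path p) (real_path q) <-> path_homotopic p q.
Proof.
split=> [[H [cH HD H0 H1 Hs]]|[K [cK K0 K1 Ks]]].
  pose K (z : I * I) : D := exist _ (H (ival z.1, ival z.2)) (mem_set (HD _)).
  have i0 : 0 <= (0 : R) <= 1 by rewrite lexx ler01.
  exists K; split.
  - apply: continuous_comp_initial; apply: (comp_continuous _ cH).
    apply: pair_continuous.
      exact: comp_continuous (@fst_continuous _ _) ival_continuous.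
    exact: comp_continuous (@snd_continuous _ _) ival_continuous.
  - by move=> t; apply: val_inj; rewrite /= ival0 H0 ?ival_in// real_pathE.
  - by move=> t; apply: val_inj; rewrite /= ival1 H1 ?ival_in// real_pathE.
  - move=> s; have [Hs0 Hs1] := Hs _ (ival_in s).
    split; apply: val_inj; rewrite /= ?ival0 ?ival1.
      by rewrite Hs0 real_path0 path_zero.
    by rewrite Hs1 real_path1 path_one.
exists (fun z => set_val (K (clampI z.1, clampI z.2))); split.
- apply: (comp_continuous (f := fun z => K (clampI z.1, clampI z.2))); last exact: set_val_continuous.
  apply: (comp_continuous _ cK); apply: pair_continuous.
    exact: comp_continuous (@fst_continuous _ _) clampI_continuous.
  exact: comp_continuous (@snd_continuous _ _) clampI_continuous.
- by move=> z; exact: set_valP.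
- by move=> t t01; rewrite /= (clampI_le0 (lexx _)) K0.
- by move=> t t01; rewrite /= (clampI_ge1 (lexx _)) K1.
- move=> s _; rewrite /= (clampI_le0 (lexx _)) (clampI_ge1 (lexx _)).
  have [-> ->] := Ks (clampI s).
  by rewrite real_path0 real_path1 path_zero path_one.
Qed.

Lemma real_path_map (x : A) (p : {path I from x to x}) :
  real_path (map_loop (subfun AB) p) = real_path p.
Proof. by []. Qed.

Lemma pushes_epimorphism b : pushes R b B B A -> forall x : A, epimorphism (pi1_incl R AB x).
Proof.
move=> [S _] x c; pose p := repr c.
have cp : continuous p by exact: (@cts_fun _ _ p).
have e0 : real_path p 0 = set_val x by rewrite real_path0 path_zero.
have e1 : real_path p 1 = set_val x by rewrite real_path1 path_one.
have Ax : A (set_val x) := set_valP x.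
have [||p' [Ap' p'0 p'1 h]] := S _ (pth_real_path cp); [by rewrite e0|by rewrite e1|].
rewrite e0 in p'0; rewrite e1 in p'1.
have [q qE] := loop_of_pth Ap' p'0 p'1.
exists (\pi_(pi1 R x) q); rewrite -[RHS]reprK; apply/pi1_eq.
apply: path_homotopic_trans (map_loop_homotopic _ (pi1_repr q)) _.
apply/hmt_path_homotopic/(hmt_trans _ (hmt_sym h)).
apply: hmt_sym; apply: hmt_eq; first exact: pth_sub Ap'.
by move=> t t01; rewrite real_path_map /real_path qE ival_clampE.
Qed.

(** Injectivity is the second half of [pushes]: a homotopy in [B] between loops of [A] is replaced
    by one in [A]. *)
Lemma pushes_isomorphism : pushes R true B B A -> forall x : A, isomorphism (pi1_incl R AB x).
Proof.
move=> pB x; have sur := @pushes_epimorphism true pB x; have [_ /(_ isT) J] := pB.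
have inj : injective (pi1_incl R AB x).
  move=> a a' /pi1_eq /hmt_path_homotopic h; rewrite -[a]reprK -[a']reprK; apply/pi1_eq.
  apply/hmt_path_homotopic; apply: J; last exact: h.
    by apply: pth_real_path; exact: (@cts_fun _ _ (repr a)).
  by apply: pth_real_path; exact: (@cts_fun _ _ (repr a')).
have [g gP] := choice sur.
by exists g => // a; apply: inj; rewrite gP.
Qed.

End fundamental_groups.

Theorem theorem16 (R : realType) (n k m : nat) (M : set 'rV[R]_m)
    (H : 'I_k.+1 -> set 'rV[R]_m)
    (nk : n = k.*2 \/ n = k.*2.+1)
    (M_closed : closed_pl_manifold n M)
    (M_connected : connected_space M)
    (MH : multisection n M H) :
  (forall x : central M H,
     epimorphism (pi1_incl R (@central_sub R m k M H) x)) /\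
  (forall x : k_fold_union M H,
     isomorphism (pi1_incl R (@k_fold_union_sub R m k M H) x)).
Proof.
(* For k = 0 the single handlebody is [M], and so are both subspaces. *)
have [k0|k0] := posnP k; last first.
  split; first exact/pushes_epimorphism/(pushes_central nk k0 M_closed MH).
  exact/pushes_isomorphism/(pushes_k_fold nk k0 M_closed MH).
have cE : central M H = M.
  apply/seteqP; split => [x []//|x Mx]; apply/capP; split => // i _.
  move: Mx; rewrite (multisection_cover MH) => -[j _ Hj].
  suff -> : i = j by [].
  by apply: val_inj; move: (ltn_ord i) (ltn_ord j) => /=; lia.
have uE : k_fold_union M H = M.
  apply/seteqP; split => [x [S _ []]//|x Mx].
  (* The empty subfamily, whose [handlebody_cap] is [M]. *)
  exists finset.set0; first by rewrite /= cards0 k0.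
  by apply/capP; split => // i; rewrite inE.
split.
  by apply: (@pushes_epimorphism _ _ _ _ _ true); rewrite cE; exact: pushes_refl.
by apply: pushes_isomorphism; rewrite uE; exact: pushes_refl.
Qed.
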